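(* Let $d\ge2$ and let $\mathbb{P}$ satisfy Assumptions A1–A2 below, with $\epsilon,\lambda,\sigma$ as defined in the context. If $$\lambda>4d\sigma^2(1+9\epsilon),$$ then Kalikow's condition is satisfied in direction $e_1$. In particular, $X$ is ballistic in direction $e_1$, i.e. $\liminf_{n\to\infty}\frac{X_n\cdot e_1}{n}>0$ $P_0$-a.s.
   Context: Let $V=\{x\in\mathbb{Z}^d:|x|_1=1\}$, $\mathcal P$ the probability vectors on $V$, $\Omega=\mathcal P^{\mathbb{Z}^d}$; for $\omega\in\Omega$, $P_{x,\omega}$ is the law of the nearest-neighbour Markov chain $X$ from $x$ with $P_{x,\omega}(X_{n+1}=y+e\mid X_n=y)=\omega(y,e)$; $\mathbb{P}$ is a law on $\Omega$ and $P_x=\mathbb{P}\otimes P_{x,\omega}$ the annealed law. (A1) $\omega(x)$, $x\in\mathbb{Z}^d$, are i.i.d. with law $\mu$; (A2) $\epsilon:=4d\,\|\omega(0)-(\frac1{2d},\dots,\frac1{2d})\|_{L^\infty(\mu)}\in(0,1)$ (the essential sup over $e\in V$ of $|\omega(0,e)-\frac1{2d}|$, times $4d$). $\lambda:=\mathbb{E}(\omega(0,e_1)-\omega(0,-e_1))$, $\sigma:=\sqrt{\sum_{e\in V}\mathrm{Var}_\mu(\omega(0,e))}$. For $B\subsetneq\mathbb{Z}^d$ nonempty connected, $T_B=\inf\{n\ge0:X_n\notin B\}$ and $g_B(x,y,\omega)=E_{x,\omega}\big(\sum_{n=0}^{T_B}\mathbf 1_{\{X_n=y\}}\big)$. Kalikow's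 environment on $B$ from $x\in B$ is $\omega_B^x(y,e)=\mathbb{E}(g_B(x,y,\omega)\omega(y,e))/\mathbb{E}(g_B(x,y,\omega))$ for $y\in B$, and its drift is $\vec d_{B,x}(y)=\sum_{e\in V}\omega_B^x(y,e)e$. Kalikow's condition holds in direction $\ell\in S^{d-1}$ if $\varepsilon_K(\ell):=\inf\{\vec d_{B,0}(y)\cdot\ell: B\subsetneq\mathbb{Z}^d\text{ connected}, 0,y\in B\}>0$. *)

(* Defs.v *)
From HB Require Import structures.
From mathcomp Require Import all_boot all_order all_algebra.
From mathcomp Require Import all_classical all_reals all_analysis ess_sup_inf.
Set Implicit Arguments. Unset Strict Implicit. Unset Printing Implicit Defensive.
Import Order.TTheory GRing.Theory Num.Theory.
Import numFieldNormedType.Exports.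
Local Open Scope classical_set_scope.
Local Open Scope ring_scope.

Definition Zd (d : nat) := 'rV[int]_d.

(* The set V = {x in Z^d : |x|_1 = 1} is indexed by (coordinate, sign):
   (i, true) |-> +e_i, (i, false) |-> -e_i. *)
Definition Dir (d : nat) := ('I_d * bool)%type.

Definition unitv (d : nat) (e : Dir d) : Zd d :=
  \row_j (if j == e.1 then (if e.2 then 1 else -1) else 0).

Definition env (R : realType) (d : nat) := Zd d -> Dir d -> R.

Definition pos (d n : nat) (x : Zd d) (s : {ffun 'I_n -> Dir d}) (k : nat)
  : Zd d := x + \sum_(j < n | (j < k)%N) unitv (s j).

(* quenched probability P_{x,omega} that the first n steps are given by s *)
Definition path_weight (R : realType) (d n : nat) (w : env R d) (x : Zd d)
  (s : {ffun 'I_n -> Dir d}) : R :=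
  \prod_(k < n) w (pos x s k) (s k).

(* Green function g_B(x,y,omega) = E_{x,omega}[ sum_{n=0}^{T_B} 1{X_n = y} ]
   = sum_n P_{x,omega}(X_0, ..., X_n in B, X_n = y)   (for y in B). *)
Definition green (R : realType) (d : nat) (B : set (Zd d)) (x y : Zd d)
  (w : env R d) : \bar R :=
  (\sum_(0 <= n <oo)
     (\sum_(s : {ffun 'I_n -> Dir d} |
             [forall k : 'I_n.+1, pos x s k \in B] && (pos x s n == y))
        path_weight w x s)%:E)%E.

Definition nn_connected (d : nat) (B : set (Zd d)) : Prop :=
  forall x y, B x -> B y -> exists n (s : {ffun 'I_n -> Dir d}),
    (forall k : 'I_n.+1, B (pos x s k)) /\ pos x s n = y.

Section RWRE.
Context (R : realType) (d : nat) (dT : measure_display) (T : measurableType dT)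
  (P : probability T R).

Definition kalikow_env (om : T -> env R d) (B : set (Zd d)) (x y : Zd d)
  (e : Dir d) : R :=
  fine (\int[P]_t (green B x y (om t) * (om t y e)%:E))%E
  / fine (\int[P]_t green B x y (om t))%E.

Definition dotR (z : Zd d) (l : 'rV[R]_d) : R := \sum_i (z 0 i)%:~R * l 0 i.

Definition kalikow_drift_dot (om : T -> env R d) (B : set (Zd d)) (x y : Zd d)
  (l : 'rV[R]_d) : R :=
  \sum_(e : Dir d) kalikow_env om B x y e * dotR (unitv e) l.

Definition kalikow_condition (om : T -> env R d) (l : 'rV[R]_d) : Prop :=
  0 < inf [set r : R | exists (B : set (Zd d)) (y : Zd d),
             [/\ nn_connected B, B <> setT, B 0, B y &
                 r = kalikow_drift_dot om B 0 y l]].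

Definition prob_vectors (om : T -> env R d) : Prop :=
  (forall t x e, 0 <= om t x e) /\ (forall t x, \sum_(e : Dir d) om t x e = 1).

Definition iid_env (om : T -> env R d) : Prop :=
  [/\ (forall x e, measurable_fun setT (fun t => om t x e)),
      (forall x (A : Dir d -> set R), (forall e, measurable (A e)) ->
         P [set t | forall e, A e (om t x e)] = P [set t | forall e, A e (om t 0 e)])
    & (forall (S : seq (Zd d)) (A : Zd d -> Dir d -> set R), uniq S ->
         (forall x e, measurable (A x e)) ->
         fine (P [set t | forall x, x \in S -> forall e, A x e (om t x e)])
         = \prod_(x <- S) fine (P [set t | forall e, A x e (om t x e)]))].

Definition eps_env (om : T -> env R d) : R :=
  (4 * d%:R) * fine (ess_sup P
     (fun t => (\big[Num.max/0]_(e : Dir d) `|om t 0 e - (2 * d%:R)^-1|)%:E)).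

Definition e1idx (i : 'I_d) : bool := (val i == 0)%N.

Definition e1vec : 'rV[R]_d := \row_i (if e1idx i then 1 else 0).

Definition lambda_env (om : T -> env R d) : R :=
  fine ('E_P[fun t => (\sum_(e : Dir d | e1idx e.1)
                        (if e.2 then om t 0%R e else - om t 0%R e))%R])%E.

Definition sigma_env (om : T -> env R d) : R :=
  Num.sqrt (\sum_(e : Dir d) fine (variance P (fun t => om t 0 e))).

(* X is a process whose law is the annealed law P_0 = PP (x) P_{0,omega}:
   its finite-dimensional distributions are E[P_{0,omega}(X_0..X_n = path)] *)
Definition annealed_walk (om : T -> env R d) (X : nat -> T -> Zd d) : Prop :=
  (forall n z, measurable [set t | X n t = z]) /\
  (forall n (s : {ffun 'I_n -> Dir d}),
     P [set t | forall k : 'I_n.+1, X k t = pos 0 s k]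
     = (\int[P]_t (path_weight (om t) 0 s)%:E)%E).

End RWRE.

(* Main.v *)
Require Import Defs.
From HB Require Import structures.
From mathcomp Require Import all_boot all_order all_algebra.
From mathcomp Require Import all_classical all_reals all_analysis ess_sup_inf measurable_realfun.
From mathcomp Require Import zify ring lra.
Set Implicit Arguments. Unset Strict Implicit. Unset Printing Implicit Defensive.
Import Order.TTheory GRing.Theory Num.Theory.
Import numFieldNormedType.Exports.
Local Open Scope classical_set_scope.
Local Open Scope ring_scope.

(**
  Kalikow's condition. For a discount z < 1 the Green function is
  g(x, y) = h(x) / (1 - z sum_e w(y,e) h(y+e)), where the discounted hitting probability h of y
  does not involve w(y). Integrating w(y) out, the annealed drift at y is bounded below by
  kalikow_const > 0: expand 1/(sum_e w(y,e) a_e) to second order around its mean and use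
  uniform ellipticity. Testing the annealed Green measure on finite sets against b^lev and L - lev
  bounds E g_B(0, y), the probability to leave {lev >= 0} and the mean time to reach level L by
  constants that do not depend on z or on the set, and z tends to 1.

  Ballisticity. After the first visit to level i, as long as the walk stays above i it only sees
  fresh environment, so the event "level i is visited and never undercut afterwards" (i is a
  regeneration level) is independent of the past and has probability at least kalikow_const.
  Hence regeneration levels exist almost surely. Call a regeneration level i bad if some window
  [i, i + n) takes longer than a times its number of regeneration levels; a covering argument and
  E T_L <= L / c give P(i bad) <= 1 / (c a), so almost surely some regeneration level is not bad
  for a large a, which bounds the level of the walk from below linearly in time.
*)

(** * Paths and killed transition sums *)

(** The annealed walk is not Markov, so martingale arguments do not apply to it directly. What
    survives averaging is linear: the weights [E (g(0,y) w(y,e))] still obey Dynkin's formula, as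
    the Green measure of a Markov chain would. That chain is Kalikow's walk, and its drift is at
    least [c] at every site. Hence every function that is superharmonic for all nearest-neighbour
    walks of drift at least [c] may be tested against it. The discount is there because finiteness
    of [E g] is itself to be proved: for z < 1 all quantities are bounded by 1/(1 - z), and only
    bounds uniform in z are kept. The factors 1 - z h(y+e) may all become small as z tends to 1; the
    one-site estimate survives because ellipticity compares their sum with their random average,
    whatever their size. In the second half the process is known only through its finite-dimensional
    laws, so everything is transported to the law of its level on integer sequences. A maximal
    inequality takes the place of a law of large numbers for regeneration times; it requires
    independence at a single level and no moments of the time between regenerations. *)

Section Paths.
Context (R : realType) (d : nat).
Implicit Types (w : env R d) (x y : Zd d) (s : seq (Dir d)) (B : set (Zd d)).

Definition endpt x s : Zd d := x + \sum_(e <- s) unitv e.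

Fixpoint wt w x s : R :=
  if s is e :: s' then w x e * wt w (x + unitv e) s' else 1.

Definition ffun_tuple n (s : n.-tuple (Dir d)) : {ffun 'I_n -> Dir d} :=
  [ffun i => tnth s i].

Lemma ffun_tuple_bij n : bijective (@ffun_tuple n).
Proof.
exists (fun f : {ffun 'I_n -> Dir d} => [tuple f i | i < n]) => [s|f].
  by apply/eq_from_tnth => i; rewrite tnth_mktuple ffunE.
by apply/ffunP => i; rewrite ffunE tnth_mktuple.
Qed.

Lemma endpt_cons x e s : endpt x (e :: s) = endpt (x + unitv e) s.
Proof. by rewrite /endpt big_cons addrA. Qed.

Lemma endpt_nil x : endpt x [::] = x.
Proof. by rewrite /endpt big_nil addr0. Qed.

Lemma endpt_cat x s s' : endpt x (s ++ s') = endpt (endpt x s) s'.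
Proof. by rewrite /endpt big_cat addrA. Qed.

Lemma pos_ffun_tuple n x (s : n.-tuple (Dir d)) k :
  pos x (ffun_tuple s) k = endpt x (take k s).
Proof.
rewrite /pos /endpt; congr (_ + _).
case: n s => [|n] s.
  by rewrite big_ord0 tuple0 /= big_nil.
have e0 : Dir d := tnth s ord0.
rewrite (big_nth e0) big_mkord size_take size_tuple.
have E : forall m, (m <= n.+1)%N -> (forall j, (j < m)%N = (j < k)%N && (j < n.+1)%N) ->
   \sum_(j < n.+1 | (j < k)%N) unitv (ffun_tuple s j) =
   \sum_(i < m) unitv (nth e0 (take k s) i).
  move=> m mn mk; rewrite (big_ord_widen_cond n.+1 xpredT (fun i => unitv (nth e0 (take k s) i))) //=.
  apply: eq_big => [j|j jk]; first by rewrite mk ltn_ord andbT.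
  by rewrite ffunE nth_take // (tnth_nth e0).
case: ltnP => h; apply: E; lia.
Qed.

Lemma path_weight_tuple n w x (s : n.-tuple (Dir d)) :
  path_weight w x (ffun_tuple s) = wt w x s.
Proof.
rewrite /path_weight.
under eq_bigr do rewrite pos_ffun_tuple ffunE.
elim: n x s => [|n IH] x s; first by rewrite big_ord0 tuple0.
rewrite big_ord_recl /=; case/tupleP: s => e s /=.
rewrite tnth0 endpt_nil; congr (_ * _).
rewrite -IH; apply: eq_bigr => i _.
by rewrite /= tnthS endpt_cons.
Qed.

Lemma big_tuple_consE n (F : n.+1.-tuple (Dir d) -> R) (Q : pred (n.+1.-tuple (Dir d))) :
  \sum_(u | Q u) F u = \sum_(e : Dir d) \sum_(s : n.-tuple (Dir d) | Q [tuple of e :: s]) F [tuple of e :: s].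
Proof.
rewrite (pair_big_dep xpredT (fun e (s : n.-tuple _) => Q [tuple of e :: s])) /=.
rewrite (reindex (fun p : Dir d * n.-tuple (Dir d) => [tuple of p.1 :: p.2])) //=.
exists (fun u => (thead u, [tuple of behead u])) => [[e s] _|u _] /=.
  by congr pair; apply/val_inj.
by rewrite [RHS]tuple_eta.
Qed.

Fixpoint inside B x s : bool :=
  (x \in B) && (if s is e :: s' then inside B (x + unitv e) s' else true).

Lemma inside_ffun_tuple n B x (s : n.-tuple (Dir d)) :
  [forall k : 'I_n.+1, pos x (ffun_tuple s) k \in B] = inside B x s.
Proof.
transitivity [forall k : 'I_n.+1, endpt x (take k s) \in B].
  by apply: eq_forallb => k; rewrite pos_ffun_tuple.
apply/forallP/idP.
  elim: n x s => [|n IH] x s.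
    by move=> /(_ ord0); rewrite tuple0 /= endpt_nil => ->.
  case/tupleP: s => e s h /=.
  have := h ord0; rewrite /= endpt_nil => -> /=.
  by apply: IH => k; have := h (lift ord0 k); rewrite /= endpt_cons.
elim: n x s => [|n IH] x s.
  by rewrite tuple0 /= andbT => xB k; rewrite endpt_nil.
case/tupleP: s => e s /= /andP[xB h] k.
case: (unliftP ord0 k) => [j|] ->; last by rewrite /= endpt_nil.
by rewrite /= endpt_cons; apply: IH.
Qed.

(** The n-step kernel of the walk killed on leaving [B], in first-step form so that inductions run
    on the starting point. [killE] and [greenE] tie it to the sums over paths in [green]. *)
Fixpoint kill B w n x y : R :=
  if n is m.+1 then (x \in B)%:R * \sum_(e : Dir d) w x e * kill B w m (x + unitv e) y
  else ((x \in B) && (x == y))%:R.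

Fixpoint surv B w n x : R :=
  if n is m.+1 then (x \in B)%:R * \sum_(e : Dir d) w x e * surv B w m (x + unitv e)
  else (x \in B)%:R.

Lemma killE B w n x y :
  \sum_(s : n.-tuple (Dir d) | inside B x s && (endpt x s == y)) wt w x s = kill B w n x y.
Proof.
elim: n x => [|n IH] x /=.
  rewrite big_mkcond /= (big_pred1 [tuple]) => [|s]; last by apply/esym/eqP; exact: tuple0.
  by rewrite /= endpt_nil andbT; case: ifP.
rewrite big_tuple_consE /= mulr_sumr; apply: eq_bigr => e _.
rewrite -IH !mulr_sumr big_mkcond [RHS]big_mkcond; apply: eq_bigr => s _ /=.
rewrite endpt_cons; case: (x \in B) => /=; last by rewrite mul0r if_same.
by case: ifP => // _; rewrite mul1r.
Qed.

Lemma survE B w n x :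
  \sum_(s : n.-tuple (Dir d) | inside B x s) wt w x s = surv B w n x.
Proof.
elim: n x => [|n IH] x /=.
  rewrite big_mkcond /= (big_pred1 [tuple]) => [|s]; last by apply/esym/eqP; exact: tuple0.
  by rewrite /= andbT; case: ifP.
rewrite big_tuple_consE /= mulr_sumr; apply: eq_bigr => e _.
rewrite -IH !mulr_sumr big_mkcond [RHS]big_mkcond; apply: eq_bigr => s _ /=.
case: (x \in B) => /=; last by rewrite mul0r if_same.
by case: ifP => // _; rewrite mul1r.
Qed.

Lemma greenE B x y w : green B x y w = (\sum_(0 <= n <oo) (kill B w n x y)%:E)%E.
Proof.
apply: eq_eseriesr => n _; congr EFin; rewrite -killE.
rewrite (reindex (@ffun_tuple n)) /=; last exact/onW_bij/ffun_tuple_bij.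
apply: eq_big => [s|s _]; last exact: path_weight_tuple.
by rewrite inside_ffun_tuple pos_ffun_tuple take_oversize // size_tuple.
Qed.

Lemma wt_cat w x s s' : wt w x (s ++ s') = wt w x s * wt w (endpt x s) s'.
Proof.
elim: s x => [|e s IH] x /=; first by rewrite mul1r endpt_nil.
by rewrite IH endpt_cons mulrA.
Qed.

(** Row sums below 1 are allowed because [zero_at] deletes the exits of a site and must remain in
    the class. *)
Definition substoch w := (forall x e, 0 <= w x e) /\ (forall x, \sum_e w x e <= 1).

Lemma substoch_sum_le w x (f : Dir d -> R) M : substoch w -> 0 <= M ->
  (forall e, f e <= M) -> \sum_e w x e * f e <= M.
Proof.
move=> [w0 w1] M0 fM; apply: (@le_trans _ _ (\sum_e w x e * M)).
  by apply: ler_sum => e _; rewrite ler_wpM2l.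
by rewrite -mulr_suml ler_piMl.
Qed.

Lemma wt_ge0 w x s : substoch w -> 0 <= wt w x s.
Proof. by move=> [w0 _]; elim: s x => //= e s IH x; rewrite mulr_ge0. Qed.

Lemma kill_ge0 B w n x y : substoch w -> 0 <= kill B w n x y.
Proof.
move=> [w0 w1]; elim: n x => [|n IH] x /=; first exact: ler0n.
by rewrite mulr_ge0// sumr_ge0// => e _; rewrite mulr_ge0.
Qed.

Lemma kill_le1 B w n x y : substoch w -> kill B w n x y <= 1.
Proof.
move=> hw; elim: n x => [|n IH] x /=; first by rewrite lern1 leq_b1.
by case: (x \in B); rewrite ?mul0r// mul1r substoch_sum_le.
Qed.

Lemma surv_ge0 B w n x : substoch w -> 0 <= surv B w n x.
Proof.
move=> [w0 w1]; elim: n x => [|n IH] x /=; first exact: ler0n.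
by rewrite mulr_ge0// sumr_ge0// => e _; rewrite mulr_ge0.
Qed.

Lemma surv_le1 B w n x : substoch w -> surv B w n x <= 1.
Proof.
move=> hw; elim: n x => [|n IH] x /=; first by rewrite lern1 leq_b1.
by case: (x \in B); rewrite ?mul0r// mul1r substoch_sum_le.
Qed.

Lemma surv_notin B w n x : x \notin B -> surv B w n x = 0.
Proof. by case: n => [|n] /negbTE /= ->; rewrite ?mul0r. Qed.

Lemma surv_kill B w n x (r : seq (Zd d)) : uniq r -> (forall y, B y -> y \in r) ->
  surv B w n x = \sum_(y <- r) kill B w n x y.
Proof.
move=> ur Br; elim: n x => [|n IH] x /=.
  case: (boolP (x \in B)) => xB /=; last by rewrite big1.
  have xr : x \in r by apply: Br; apply/set_mem.
  rewrite (bigD1_seq x) //= eqxx big1 ?addr0 // => i.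
  by rewrite eq_sym => /negbTE ->.
rewrite -mulr_sumr; congr (_ * _).
by rewrite exchange_big; apply: eq_bigr => e _; rewrite IH mulr_sumr.
Qed.

End Paths.

(** * The discounted Green function *)

Section DiscountedGreen.
Context (R : realType) (d : nat).
Implicit Types (w : env R d) (x y : Zd d) (B : set (Zd d)) (z : R).

(** Iterating the inequality gives [u <= z ^+ n * |M|], which tends to 0; no finiteness of the
    domain is required. Applied to the difference of two bounded solutions and to its opposite, this
    is the uniqueness principle behind [gz_first_passage] and [dynkin]. The alternative [u x <= 0]
    covers sites outside the domain. *)
Lemma discount_max_principle w z (u : Zd d -> R) M : substoch w -> 0 <= z < 1 ->
  (forall x, u x <= M) ->
  (forall x, u x <= 0 \/ u x <= z * \sum_e w x e * u (x + unitv e)) ->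
  forall x, u x <= 0.
Proof.
move=> hw /andP[z0 z1] uM hu x.
pose M' := `|M|.
have key n : forall x, u x <= z ^+ n * M'.
  elim: n => [|n IH] x'; first by rewrite mul1r (le_trans (uM _)) ?ler_norm.
  have h0 : 0 <= z ^+ n * M' by rewrite mulr_ge0 ?exprn_ge0 ?normr_ge0.
  case: (hu x') => [h|h]; first by rewrite (le_trans h) // mulr_ge0 ?exprn_ge0 ?normr_ge0.
  rewrite (le_trans h) // exprS -mulrA ler_wpM2l //.
  by apply: substoch_sum_le.
have cv : (fun n => z ^+ n * M') @ \oo --> 0.
  rewrite -[X in _ --> X](mul0r M'); apply: cvgM; last exact: cvg_cst.
  by apply: cvg_expr; rewrite ger0_norm.
rewrite -(cvg_lim _ cv) //; apply: limr_ge; first by apply: cvgP cv.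
by apply: nearW => n; apply: key.
Qed.

Definition gz B w z x y : R := limn (series (fun n => z ^+ n * kill B w n x y)).

Section zfix.
Variables (z : R).
Hypothesis z01 : 0 <= z < 1.
Let z0 : 0 <= z. Proof. by case/andP: z01. Qed.
Let z1 : z < 1. Proof. by case/andP: z01. Qed.

Lemma gz_is_cvg B w x y : substoch w ->
  cvgn (series (fun n => z ^+ n * kill B w n x y)).
Proof.
move=> hw; apply: (@series_le_cvg _ _ (geometric 1 z)).
- by move=> n; rewrite mulr_ge0 ?exprn_ge0 ?kill_ge0.
- by move=> n; rewrite /= mul1r exprn_ge0.
- by move=> n; rewrite /= mul1r ler_piMr ?exprn_ge0 ?kill_le1.
- by apply: is_cvg_geometric_series; rewrite ger0_norm.
Qed.

Lemma gz_ge_partial B w x y N : substoch w ->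
  \sum_(n < N) z ^+ n * kill B w n x y <= gz B w z x y.
Proof.
move=> hw; rewrite -(big_mkord xpredT (fun n => z ^+ n * kill B w n x y)).
apply: (nondecreasing_cvgn_le (u_ := series (fun n => z ^+ n * kill B w n x y))).
  by apply: nondecreasing_series => n _ _; rewrite mulr_ge0 ?exprn_ge0 ?kill_ge0.
exact: gz_is_cvg.
Qed.

Lemma gz_ge0 B w x y : substoch w -> 0 <= gz B w z x y.
Proof. by move=> hw; have := gz_ge_partial B x y 0 hw; rewrite big_ord0. Qed.

Lemma gz_le B w x y : substoch w -> gz B w z x y <= (1 - z)^-1.
Proof.
move=> hw; apply: limr_le; first exact: gz_is_cvg.
apply: nearW => n; apply: (@le_trans _ _ (series (geometric 1 z) n)).
  apply: ler_sum => k _ /=; rewrite mul1r ler_piMr ?exprn_ge0 ?kill_le1 //.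
have cv : series (geometric 1 z) @ \oo --> (1 - z)^-1.
  by rewrite -[X in _ --> X]mul1r; apply: cvg_geometric_series; rewrite ger0_norm.
rewrite -(cvg_lim _ cv) //; apply: nondecreasing_cvgn_le; last exact: cvgP cv.
by apply: nondecreasing_series => k _ _ /=; rewrite mul1r exprn_ge0.
Qed.

Lemma gzE B w x y : substoch w ->
  gz B w z x y = (x \in B)%:R * ((x == y)%:R + z * \sum_e w x e * gz B w z (x + unitv e) y).
Proof.
move=> hw; apply: cvg_lim => //; rewrite -cvg_shiftS /=.
have E n : series (fun n => z ^+ n * kill B w n x y) n.+1 =
  (x \in B)%:R * ((x == y)%:R + z * \sum_e w x e *
     series (fun n => z ^+ n * kill B w n (x + unitv e) y) n).
  rewrite /series /= big_nat_recl // expr0 mul1r.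
  under [X in _ = _ * (_ + _ * X)]eq_bigr => e _ do rewrite mulr_sumr.
  rewrite exchange_big /= mulrDr; congr (_ + _); first by case: (x \in B); rewrite ?mul1r ?mul0r.
  rewrite !mulr_sumr; apply: eq_bigr => k _.
  rewrite exprS -/(kill B w k.+1 x y) /= !mulr_sumr.
  by apply: eq_bigr => e _; ring.
rewrite [X in X @ _ --> _](_ : _ = fun n => (x \in B)%:R * ((x == y)%:R + z * \sum_e w x e *
     series (fun n => z ^+ n * kill B w n (x + unitv e) y) n)); last by apply/funext.
apply: cvgMr; apply: cvgD; first exact: cvg_cst.
apply: cvgMr; apply: cvg_big => [|e _]; first exact: add_continuous.
by apply: cvgMr; apply: gz_is_cvg.
Qed.

Definition zero_at y w : env R d := fun x e => if x == y then 0 else w x e.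

Lemma zero_at_substoch y w : substoch w -> substoch (zero_at y w).
Proof.
move=> [w0 w1]; split=> [x e|x]; rewrite /zero_at; first by case: ifP.
by case: (x == y) => //; rewrite big1.
Qed.

Lemma hit_y B w y : substoch w -> y \in B -> gz B (zero_at y w) z y y = 1.
Proof.
move=> hw yB; rewrite gzE; last exact: zero_at_substoch.
rewrite yB eqxx mul1r big1 ?mulr0 ?addr0 // => e _.
by rewrite /zero_at eqxx mul0r.
Qed.

(** Without exits [y] is visited at most once, so this Green function is a discounted hitting
    probability. Formally, it minus 1 is a bounded subsolution that vanishes at [y]. *)
Lemma hit_le1 B w x y : substoch w -> y \in B -> gz B (zero_at y w) z x y <= 1.
Proof.
move=> hw yB; have hw0 := zero_at_substoch y hw; rewrite -subr_le0.
apply: (@discount_max_principle w z (fun x => gz B (zero_at y w) z x y - 1) (1 - z)^-1 hw z01).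
  by move=> x'; rewrite lerBlDr ler_wpDr ?gz_le.
move=> x'; case: (eqVneq x' y) => [->|xy].
  by left; rewrite hit_y // subrr.
rewrite gzE // (negbTE xy) add0r; case: (x' \in B); last by left; rewrite mul0r sub0r lerN10.
right; rewrite mul1r.
under eq_bigr do rewrite /zero_at (negbTE xy).
under [X in _ <= z * X]eq_bigr do rewrite mulrBr mulr1.
rewrite sumrB mulrBr lerD2l lerN2.
rewrite -[leRHS]mulr1 ler_pM //; [by apply: sumr_ge0 => e _; apply: hw.1 | exact: ltW | exact: hw.2].
Qed.

(* First-passage decomposition: deleting the exits of [y] turns the Green function into the
   discounted hitting probability of [y], which does not depend on [w y]. *)
Lemma gz_first_passage B w x y : substoch w -> y \in B ->
  gz B w z x y = gz B (zero_at y w) z x y * gz B w z y y.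
Proof.
move=> hw yB; have hw0 := zero_at_substoch y hw; set h := gz B (zero_at y w) z.
pose v x := gz B w z x y - h x y * gz B w z y y.
have vE x' : v x' = (x' \in B)%:R * (z * \sum_e zero_at y w x' e * v (x' + unitv e)).
  rewrite /v; case: (eqVneq x' y) => [->|xy].
    rewrite /h hit_y // mul1r subrr big1 ?mulr0 // => e _.
    by rewrite /zero_at eqxx mul0r.
  rewrite [in LHS]gzE // /h [in LHS](gzE _ _ _ hw0) (negbTE xy) !add0r -/h.
  rewrite -!mulrA -mulrBr -mulrBr; congr (_ * (_ * _)).
  rewrite mulr_suml -sumrB; apply: eq_bigr => e _.
  by rewrite /zero_at (negbTE xy) mulrBr !mulrA.
have bd (a b c : R) : 0 <= a <= c -> 0 <= b <= c -> `|a - b| <= c.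
  by move=> /andP[? ?] /andP[? ?]; rewrite ler_norml; apply/andP; split; lra.
have hb x' : `|v x'| <= (1 - z)^-1.
  apply: bd; first by rewrite gz_ge0 // gz_le.
  rewrite mulr_ge0 ?gz_ge0 //= -[leRHS]mul1r ler_pM ?gz_ge0 ?hit_le1 ?gz_le //.
have vle0 : v x <= 0.
  apply: (@discount_max_principle _ z v (1 - z)^-1 hw0 z01).
    by move=> x'; rewrite (le_trans _ (hb x')) ?ler_norm.
  by move=> x'; case: (boolP (x' \in B)) (vE x') => _ ->; [right; rewrite mul1r|left; rewrite mul0r].
have vge0 : - v x <= 0.
  apply: (@discount_max_principle _ z (fun x => - v x) (1 - z)^-1 hw0 z01).
    by move=> x'; rewrite (le_trans _ (hb x')) // -normrN ler_norm.
  move=> x'; case: (boolP (x' \in B)) (vE x') => _ ->; last by left; rewrite mul0r oppr0.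
  by right; rewrite mul1r -mulrN -sumrN; under [X in _ <= _ * X]eq_bigr do rewrite mulrN.
by apply/eqP; rewrite -subr_eq0 -/(v x) eq_le vle0 -oppr_le0 vge0.
Qed.

(** Visits to [y] form a geometric series: [g = 1 + q * g] with [q] the discounted return
    probability, at most [z]. All dependence on [w y] is now explicit, since [q] is linear in it
    with coefficients free of [w y]. *)
Lemma gz_return B w y : substoch w -> y \in B ->
  gz B w z y y = (1 - z * \sum_e w y e * gz B (zero_at y w) z (y + unitv e) y)^-1.
Proof.
move=> hw yB; set q := z * _.
have q1 : q < 1.
  rewrite (le_lt_trans _ z1) // -[leRHS]mulr1 ler_wpM2l //.
  by apply: substoch_sum_le => // e; apply: hit_le1.
have : gz B w z y y = 1 + q * gz B w z y y.
  rewrite [LHS]gzE // yB eqxx mul1r /q -mulrA mulr_suml.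
  congr (_ + z * _); apply: eq_bigr => e _.
  by rewrite gz_first_passage // mulrA.
have nz : 1 - q != 0 by rewrite subr_eq0 gt_eqF.
move=> E; apply: (mulIf nz); rewrite mulVf // mulrBr mulr1 {1}E mulrC; ring.
Qed.

Lemma potentialE B w x (r : seq (Zd d)) (phi : Zd d -> R) : substoch w ->
  uniq r -> (forall y, B y -> y \in r) ->
  \sum_(y <- r) gz B w z x y * phi y =
  (x \in B)%:R * (phi x + z * \sum_e w x e * \sum_(y <- r) gz B w z (x + unitv e) y * phi y).
Proof.
move=> hw ur Br; under eq_bigr do rewrite gzE // -mulrA.
rewrite -mulr_sumr; case: (boolP (x \in B)) => xB; last by rewrite !mul0r.
rewrite !mul1r; under eq_bigr do rewrite mulrDl.
rewrite big_split /=; congr (_ + _).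
  rewrite (bigD1_seq x) //=; last by apply: Br; apply/set_mem.
  by rewrite eqxx mul1r big1 ?addr0 // => y; rewrite eq_sym => /negbTE ->; rewrite mul0r.
under eq_bigr do rewrite -mulrA mulr_suml.
rewrite -mulr_sumr exchange_big /=; congr (_ * _); apply: eq_bigr => e _.
by rewrite mulr_sumr; apply: eq_bigr => y _; rewrite mulrA.
Qed.

(** Dynkin's formula for the walk killed outside a finite set: both sides solve the same discounted
    equation and are bounded, so uniqueness applies. *)
Lemma dynkin B w x (r : seq (Zd d)) (f : Zd d -> R) : substoch w ->
  uniq r -> (forall y, B y -> y \in r) ->
  \sum_(y <- r) gz B w z x y *
    (f y - z * \sum_e w y e * (((y + unitv e) \in B)%:R * f (y + unitv e)))
  = (x \in B)%:R * f x.
Proof.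
move=> hw ur Br; pose phi y := f y - z * \sum_e w y e * (((y + unitv e) \in B)%:R * f (y + unitv e)).
pose U x := \sum_(y <- r) gz B w z x y * phi y.
pose v x := U x - (x \in B)%:R * f x.
have vE x' : v x' = (x' \in B)%:R * (z * \sum_e w x' e * v (x' + unitv e)).
  rewrite /v {1}/U potentialE // -mulrBr; congr (_ * _); rewrite /phi.
  rewrite addrAC [_ - _ - f x']addrAC subrr add0r addrC -mulrBr -sumrB.
  by congr (_ * _); apply: eq_bigr => e _; rewrite mulrBr.
pose M := \sum_(y <- r) (1 - z)^-1 * `|phi y| + \sum_(y <- r) `|f y|.
have hb x' : `|v x'| <= M.
  apply: (le_trans (ler_normB _ _)); apply: lerD.
    apply: (le_trans (ler_norm_sum _ _ _)); apply: ler_sum => y _.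
    by rewrite normrM ler_pM ?normr_ge0 // ger0_norm ?gz_ge0 ?gz_le.
  case: (boolP (x' \in B)) => xB; last by rewrite mul0r normr0 sumr_ge0.
  rewrite mul1r (bigD1_seq x') //=; last by apply: Br; apply/set_mem.
  by rewrite lerDl sumr_ge0.
have vle0 : v x <= 0.
  apply: (@discount_max_principle _ z v M hw z01).
    by move=> x'; rewrite (le_trans _ (hb x')) ?ler_norm.
  by move=> x'; case: (boolP (x' \in B)) (vE x') => _ ->; [right; rewrite mul1r|left; rewrite mul0r].
have vge0 : - v x <= 0.
  apply: (@discount_max_principle _ z (fun x => - v x) M hw z01).
    by move=> x'; rewrite (le_trans _ (hb x')) // -normrN ler_norm.
  move=> x'; case: (boolP (x' \in B)) (vE x') => _ ->; last by left; rewrite mul0r oppr0.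
  by right; rewrite mul1r -mulrN -sumrN; under [X in _ <= _ * X]eq_bigr do rewrite mulrN.
by apply/eqP; rewrite -subr_eq0 -/(U x) -/(v x) eq_le vle0 -oppr_le0 vge0.
Qed.

End zfix.

Fixpoint reach N : seq (Zd d) :=
  if N is n.+1 then undup (reach n ++ [seq x + unitv e | x <- reach n, e <- enum {: Dir d}])
  else [:: 0].

Lemma reach_uniq N : uniq (reach N).
Proof. by case: N => //= n; apply: undup_uniq. Qed.

Lemma reachS N x : x \in reach N -> x \in reach N.+1.
Proof. by move=> xr /=; rewrite mem_undup mem_cat xr. Qed.

Lemma reach_step N x e : x \in reach N -> x + unitv e \in reach N.+1.
Proof.
move=> xr /=; rewrite mem_undup mem_cat; apply/orP; right.
by apply/allpairsP; exists (x, e); rewrite /= mem_enum.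
Qed.

Lemma reach_mono k N x : (k <= N)%N -> x \in reach k -> x \in reach N.
Proof.
move=> /subnK <-; elim: (N - k)%N => // m IH /IH; rewrite addSn; exact: reachS.
Qed.

(** Truncation to a finite set, so that Dynkin's formula is a finite sum. A walk from 0 cannot
    notice it within [N] steps, which is the content of [kill_local] and [surv_local]. *)
Definition inreach B N : set (Zd d) := B `&` [set` reach N].

Lemma inreach_mem B N k x : (k <= N)%N -> x \in reach k -> (x \in inreach B N) = (x \in B).
Proof.
move=> kN xr; apply/idP/idP; first by rewrite in_setI => /andP[].
by move=> xB; rewrite in_setI xB /=; apply/mem_set/reach_mono/xr.
Qed.

Lemma kill_local B w N n k x y : x \in reach k -> (n + k <= N)%N ->
  kill (inreach B N) w n x y = kill B w n x y.
Proof.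
elim: n k x => [|n IH] k x xr nk /=; have kN : (k <= N)%N by lia.
  by rewrite (inreach_mem B kN xr).
rewrite (inreach_mem B kN xr).
congr (_ * _); apply: eq_bigr => e _; congr (_ * _).
by apply: (IH k.+1); [exact: reach_step | lia].
Qed.

Lemma surv_local B w N n k x : x \in reach k -> (n + k <= N)%N ->
  surv (inreach B N) w n x = surv B w n x.
Proof.
elim: n k x => [|n IH] k x xr nk /=; have kN : (k <= N)%N by lia.
  by rewrite (inreach_mem B kN xr).
rewrite (inreach_mem B kN xr).
congr (_ * _); apply: eq_bigr => e _; congr (_ * _).
by apply: (IH k.+1); [exact: reach_step | lia].
Qed.

(** The right side is the discounted flux across edges that leave [B]; exits from the truncated set
    that stay in [B] are not counted. An exit within [n] steps is discounted by at least [z ^+ n],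
    and induction on the first step makes this precise. *)
Lemma exit_prob_le B w z N n k x : substoch w -> (forall x, \sum_e w x e = 1) ->
  0 <= z < 1 -> x \in reach k -> (n + k <= N)%N -> x \in B ->
  z ^+ n * (1 - surv B w n x) <=
  \sum_(y <- reach N) gz (inreach B N) w z x y *
     (z * \sum_e w y e * ((y + unitv e) \notin B)%:R).
Proof.
move=> hw w1 z01; have /andP[z0 z1] := z01.
pose phi y := z * \sum_e w y e * ((y + unitv e) \notin B)%:R.
have phi0 y : 0 <= phi y.
  by rewrite mulr_ge0 // sumr_ge0 // => e _; rewrite mulr_ge0 ?ler0n ?hw.1.
have Br : forall y, inreach B N y -> y \in reach N by move=> y [].
elim: n k x => [|n IH] k x xr nk xB.
  rewrite /= xB subrr mulr0 sumr_ge0 // => y _.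
  by apply: mulr_ge0; [exact: gz_ge0 | exact: phi0].
have kN : (k <= N)%N by lia.
rewrite potentialE ?reach_uniq // (inreach_mem B kN xr).
rewrite xB mul1r /= xB mul1r -{1}(w1 x) -sumrB /phi -mulrDr -big_split /= mulr_sumr mulr_sumr.
apply: ler_sum => e _; rewrite -{1}[w x e]mulr1 -mulrBr -mulrDr mulrCA [leRHS]mulrCA.
apply: ler_wpM2l; first exact: hw.1.
rewrite exprS -mulrA; apply: ler_wpM2l => //.
have [eB|eB] := boolP (x + unitv e \in B).
  by rewrite add0r; apply: (IH k.+1) => //; [exact: reach_step | lia].
rewrite (surv_notin _ _ eB) subr0 mulr1 /=.
rewrite ler_wpDr ?exprn_ile1 ?(ltW z1) // sumr_ge0 // => y _.
by apply: mulr_ge0; [exact: gz_ge0 | exact: phi0].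
Qed.

End DiscountedGreen.

(** * Law of the environment *)

Section EnvironmentLaw.
Context (R : realType) (d : nat).

Definition rectangle (S : seq (Zd d)) (C : Zd d -> Dir d -> set R) : set (Zd d -> Dir d -> R) :=
  [set w | forall x, x \in S -> forall e, C x e (w x e)].

(** The i.i.d. hypothesis prescribes probabilities of exactly these sets. They are stable under
    intersection and generate the sigma-algebra, so they determine the law. *)
Definition rectangles : set (set (Zd d -> Dir d -> R)) :=
  [set A | exists S C, (forall x e, measurable (C x e)) /\ A = rectangle S C].

Definition env_space : measurableType rectangles.-sigma := g_sigma_algebraType rectangles.

Lemma rectangles_setI : setI_closed rectangles.
Proof.
move=> _ _ [S [C [mC ->]]] [S' [C' [mC' ->]]].
exists (S ++ S'), (fun x e => (if x \in S then C x e else setT) `&`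
                              (if x \in S' then C' x e else setT)).
split=> [x e|]; first by apply: measurableI; case: ifP.
apply/seteqP; split=> w /=.
  move=> [h h'] x _ e; split.
    by case: ifP => // /h; apply.
  by case: ifP => // /h'; apply.
move=> h; split=> x xS e.
  by have [] := h x (ltac:(by rewrite mem_cat xS)) e; rewrite xS.
by have [_] := h x (ltac:(by rewrite mem_cat xS orbT)) e; rewrite xS.
Qed.

Lemma measurable_coord x e : measurable_fun [set: env_space] (fun w : env_space => w x e).
Proof.
move=> _ Y mY; rewrite setTI; apply: sub_sigma_algebra.
exists [:: x], (fun _ e' => if e' == e then Y else setT); split=> [_ e'|].
  by case: ifP.
apply/seteqP; split=> w /= h.
  by move=> x'; rewrite inE => /eqP -> e'; case: eqP => // ->.
by have := h x (mem_head _ _) e; rewrite eqxx.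
Qed.

Lemma measurable_rectangle dT (T : measurableType dT) (om : T -> env R d) S C :
  (forall x e, measurable_fun setT (fun t => om t x e)) ->
  (forall x e, measurable (C x e)) ->
  measurable [set t | rectangle S C (om t)].
Proof.
move=> mom mC.
rewrite [X in measurable X](_ : _ =
  \bigcap_(x in [set` S]) \bigcap_(e in [set: Dir d]) ((fun t => om t x e) @^-1` C x e)); last first.
  by apply/seteqP; split=> t /= h x xS e => [_|]; apply: h.
apply: fin_bigcap_measurable => // x xS.
apply: fin_bigcap_measurable => [|e _]; first exact: finite_finset.
by rewrite -[X in measurable X]setTI; apply: mom.
Qed.

Lemma measurable_env dT (T : measurableType dT) (om : T -> env_space) :
  (forall x e, measurable_fun setT (fun t => om t x e)) -> measurable_fun setT om.
Proof.
move=> mom; apply: measurability => // _ [_ [S [C [mC ->]]] <-].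
by rewrite setTI; apply: measurable_rectangle.
Qed.

Section law.
Context d1 (T1 : measurableType d1) d2 (T2 : measurableType d2)
  (P1 : probability T1 R) (P2 : {measure set T2 -> \bar R})
  (om1 : T1 -> env R d) (om2 : T2 -> env R d).
Hypothesis mom1 : forall x e, measurable_fun setT (fun t => om1 t x e).
Hypothesis mom2 : forall x e, measurable_fun setT (fun t => om2 t x e).
Hypothesis eqr : forall S C, uniq S -> (forall x e, measurable (C x e)) ->
  P1 [set t | rectangle S C (om1 t)] = P2 [set t | rectangle S C (om2 t)].

Lemma env_law_eq (psi : env_space -> \bar R) : measurable_fun [set: env_space] psi ->
  (forall w, (0 <= psi w)%E) ->
  (\int[P1]_t psi (om1 t) = \int[P2]_t psi (om2 t))%E.
Proof.
move=> mpsi psi0.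
pose f1 : T1 -> env_space := om1; pose f2 : T2 -> env_space := om2.
have mf1 : measurable_fun setT f1 := measurable_env mom1.
have mf2 : measurable_fun setT f2 := measurable_env mom2.
pose m1 : {measure set env_space -> \bar R} := pushforward P1 f1.
pose m2 : {measure set env_space -> \bar R} := pushforward P2 f2.
have T1E : (\int[P1]_t psi (om1 t) = \int[m1 mf1]_w psi w)%E.
  by rewrite (ge0_integral_pushforward mf1).
have T2E : (\int[P2]_t psi (om2 t) = \int[m2 mf2]_w psi w)%E.
  by rewrite (ge0_integral_pushforward mf2).
rewrite T1E T2E; apply: eq_measure_integral => A mA _.
apply: (@measure_unique _ R env_space rectangles (fun _ => setT)) => //.
- exact: rectangles_setI.
- move=> i; exists [::], (fun _ _ => setT); split=> //.
  by apply/seteqP; split.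
- by rewrite bigcup_const //; exists 0%N.
- move=> _ [S [C [mC ->]]]; rewrite /= /pushforward.
  have -> : rectangle S C = rectangle (undup S) C.
    by apply/seteqP; split=> w h x xS; apply: h; rewrite mem_undup in xS *.
  by apply: eqr => //; apply: undup_uniq.
- by move=> k; rewrite /= /pushforward preimage_setT probability_setT ltry.
Qed.

End law.
End EnvironmentLaw.

Section BoundedIntegrals.
Context (R : realType) dT (T : measurableType dT) (P : probability T R).

Lemma bounded_integrable (f : T -> R) M : measurable_fun setT f ->
  (forall t, `|f t| <= M) -> P.-integrable setT (EFin \o f).
Proof.
move=> mf fM; have hT : (P setT < +oo)%E by rewrite probability_setT ltry.
apply: measurable_bounded_integrable => //.
exists M; split; first exact: num_real.
by move=> x Mx t _ /=; rewrite (le_trans (fM t)) // ltW.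
Qed.

Lemma sum_integrable (I : Type) (r : seq I) (f : I -> T -> R) :
  (forall i, P.-integrable setT (EFin \o f i)) ->
  P.-integrable setT (EFin \o (fun t => \sum_(i <- r) f i t)).
Proof.
move=> fi; rewrite [X in P.-integrable _ X](_ : _ = fun t => (\sum_(i <- r) (f i t)%:E)%E); last first.
  by apply/funext => t /=; rewrite sumEFin.
by apply: integrable_sum => // i *; exact: fi.
Qed.

Lemma Rintegral_sum (I : Type) (r : seq I) (f : I -> T -> R) :
  (forall i, P.-integrable setT (EFin \o f i)) ->
  \int[P]_t (\sum_(i <- r) f i t) = \sum_(i <- r) \int[P]_t f i t.
Proof.
move=> fi; elim: r => [|i r IH].
  under eq_Rintegral do rewrite big_nil.
  by rewrite big_nil Rintegral_cst // mul0r.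
rewrite big_cons -IH -RintegralD //; last exact: sum_integrable.
by apply: eq_Rintegral => t _; rewrite big_cons.
Qed.

Lemma Rintegral_cstT (r : R) : \int[P]_t r = r.
Proof. by rewrite Rintegral_cst // (congr1 fine (probability_setT P)) mulr1. Qed.

Lemma RintegralE (f : T -> R) : P.-integrable setT (EFin \o f) ->
  (\int[P]_t (f t)%:E)%E = (\int[P]_t f t)%:E.
Proof. by move=> fi; rewrite /Rintegral fineK //; apply: integrable_fin_num. Qed.

End BoundedIntegrals.

Section Measurability.
Context (R : realType) (d : nat) dT (T : measurableType dT).

Lemma measurable_fun_bigsum (I : Type) (r : seq I) (f : I -> T -> R) :
  (forall i, measurable_fun setT (f i)) -> measurable_fun setT (fun t => \sum_(i <- r) f i t).
Proof.
move=> mf; elim: r => [|i r IH].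
  by under eq_fun do rewrite big_nil; exact: measurable_cst.
by under eq_fun do rewrite big_cons; exact: measurable_funD.
Qed.

Lemma measurable_funV_pos (f : T -> R) : measurable_fun setT f -> (forall t, 0 <= f t) ->
  measurable_fun setT (fun t => (f t)^-1).
Proof.
move=> mf f0; rewrite [X in measurable_fun _ X](_ : _ = fun t => powR (f t) (-1)).
  by apply: (measurableT_comp (f := @powR R ^~ (-1))) => //; exact: measurable_powR.
by apply/funext => t; rewrite powR_inv1.
Qed.

Variable om : T -> env R d.
Hypothesis mom : forall x e, measurable_fun setT (fun t => om t x e).

Lemma measurable_kill B n x y : measurable_fun setT (fun t => kill B (om t) n x y).
Proof.
elim: n x => [|n IH] x /=; first exact: measurable_cst.
apply: measurable_funM; first exact: measurable_cst.
by apply: measurable_fun_bigsum => e; apply: measurable_funM.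
Qed.

Lemma measurable_surv B n x : measurable_fun setT (fun t => surv B (om t) n x).
Proof.
elim: n x => [|n IH] x /=; first exact: measurable_cst.
apply: measurable_funM; first exact: measurable_cst.
by apply: measurable_fun_bigsum => e; apply: measurable_funM.
Qed.

Lemma measurable_wt x s : measurable_fun setT (fun t => wt (om t) x s).
Proof.
elim: s x => [|e s IH] x /=; first exact: measurable_cst.
exact: measurable_funM.
Qed.

Lemma measurable_gz B z x y : 0 <= z < 1 -> (forall t, substoch (om t)) ->
  measurable_fun setT (fun t => gz B (om t) z x y).
Proof.
move=> z01 hom.
apply: (measurable_fun_cvg
  (h := fun n t => series (fun k => z ^+ k * kill B (om t) k x y) n)).
  move=> n; apply: measurable_fun_bigsum => k.
  by apply: measurable_funM; [exact: measurable_cst | exact: measurable_kill].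
by move=> t _; apply: gz_is_cvg.
Qed.

End Measurability.

(* Law equalities are proved for functions on all of [env_space]; this retraction onto
   substochastic environments makes the Green function a genuine function there. *)
Section Clamp.
Context (R : realType) (d : nat).

Definition clamp (w : env R d) : env R d := fun x e =>
  `|w x e| * (Num.max 1 (\sum_e' `|w x e'|))^-1.

Lemma clamp_substoch w : substoch (clamp w).
Proof.
have m0 x : 0 < Num.max 1 (\sum_e' `|w x e'|) by rewrite lt_max ltr01.
split=> [x e|x]; first by rewrite mulr_ge0 // invr_ge0 ltW.
by rewrite -mulr_suml ler_pdivrMr // mul1r le_max lexx orbT.
Qed.

Lemma clamp_id w : (forall x e, 0 <= w x e) -> (forall x, \sum_e w x e = 1) -> clamp w = w.
Proof.
move=> w0 w1; apply/funext => x; apply/funext => e; rewrite /clamp.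
rewrite ger0_norm //; under eq_bigr do rewrite ger0_norm //.
by rewrite w1 maxxx invr1 mulr1.
Qed.

Lemma measurable_clamp dT (T : measurableType dT) (om : T -> env R d) :
  (forall x e, measurable_fun setT (fun t => om t x e)) ->
  forall x e, measurable_fun setT (fun t => clamp (om t) x e).
Proof.
move=> mom x e; apply: measurable_funM; first exact: measurableT_comp.
apply: measurable_funV_pos; last by move=> t; rewrite le_max ler01.
apply: measurable_maxr; first exact: measurable_cst.
by apply: measurable_fun_bigsum => e'; exact: measurableT_comp.
Qed.

End Clamp.

(** * Stationarity and resampling for an i.i.d. environment *)

Section IIDLaw.
Context (R : realType) (d : nat) dT (T : measurableType dT) (P : probability T R).
Variable om : T -> env R d.
Hypothesis hiid : iid_env P om.
Let mom : forall x e, measurable_fun setT (fun t => om t x e).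
Proof. by case: hiid. Qed.

Lemma iid_rectangle S C : uniq S -> (forall x e, measurable (C x e)) ->
  P [set t | rectangle S C (om t)] =
  (\prod_(x <- S) fine (P [set t | forall e, C x e (om t 0 e)]))%:E.
Proof.
move=> uS mC; have [_ h2 h3] := hiid.
rewrite -[LHS]fineK; last exact/fin_num_measure/measurable_rectangle.
by rewrite h3 //; congr EFin; apply: eq_bigr => x _; rewrite h2.
Qed.

Lemma shift_law (x : Zd d) (psi : env_space R d -> \bar R) : measurable_fun [set: env_space R d] psi ->
  (forall w, (0 <= psi w)%E) ->
  (\int[P]_t psi (om t) = \int[P]_t psi (fun y => om t (x + y)%R))%E.
Proof.
apply: (@env_law_eq R d _ T _ T P P om (fun t y => om t (x + y))) => // S C uS mC.
have -> : [set t | rectangle S C (fun y => om t (x + y))] =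
    [set t | rectangle (map (+%R x) S) (fun y => C (y - x)) (om t)].
  apply/seteqP; split=> t /= h y yS e.
    by move: yS => /mapP[u uS' ->]; rewrite addrAC subrr add0r; apply: h.
  have := h (x + y); rewrite addrAC subrr add0r; apply.
  by apply: map_f.
have uS' : uniq (map (+%R x) S) by rewrite map_inj_uniq //; apply: addrI.
rewrite iid_rectangle //; apply/esym; apply: (etrans (iid_rectangle uS' _)) => //.
congr EFin; rewrite big_map; apply: eq_bigr => y _.
by rewrite addrAC subrr add0r.
Qed.

Definition mix (A : pred (Zd d)) (w w' : env R d) : env R d :=
  fun x => if A x then w x else w' x.

(** Resampling: replacing the environment outside [A] by an independent copy preserves the law,
    since a rectangle splits into its sites in [A] and outside [A]. Freezing [t] and integrating
    over [t'] then plays the role of conditioning on the environment in [A]. *)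
Lemma mix_law A (psi : env_space R d -> \bar R) : measurable_fun [set: env_space R d] psi ->
  (forall w, (0 <= psi w)%E) ->
  (\int[P]_t psi (om t) = \int[P]_t \int[P]_t' psi (mix A (om t) (om t')))%E.
Proof.
move=> mpsi psi0.
have mmix x e : measurable_fun setT (fun p : T * T => mix A (om p.1) (om p.2) x e).
  rewrite /mix; case: (A x).
    exact: (measurableT_comp (mom x e) measurable_fst).
  exact: (measurableT_comp (mom x e) measurable_snd).
rewrite (@env_law_eq R d _ T _ (T * T)%type P (P \x P)%E om
          (fun p => mix A (om p.1) (om p.2)) mom mmix _ psi mpsi psi0).
  rewrite -[RHS](fubini_tonelli1 (fun p : T * T => psi (mix A (om p.1) (om p.2)))) //.
  exact: (measurableT_comp mpsi (measurable_env mmix)).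
move=> S C uS mC; rewrite iid_rectangle //.
have -> : [set p | rectangle S C (mix A (om p.1) (om p.2))] = ([set t | rectangle [seq x <- S | A x] C (om t)] `*`
                               [set t | rectangle [seq x <- S | predC A x] C (om t)]).
  apply/seteqP; split=> -[t t'] /=.
    move=> h; split=> x; rewrite mem_filter => /andP[Ax xS] e.
      by have := h x xS e; rewrite /mix Ax.
    by have := h x xS e; rewrite /mix (negbTE Ax).
  move=> [h h'] x xS e; rewrite /mix; case: ifP => Ax.
    by apply: h; rewrite mem_filter Ax.
  by apply: h'; rewrite mem_filter /= Ax.
apply/esym; apply: (etrans (@product_measure1E _ _ T T R P P _ _
  (measurable_rectangle _ mom mC) (measurable_rectangle _ mom mC))).
have uA := filter_uniq A uS; have uC := filter_uniq (predC A) uS.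
apply: (etrans (congr2 (fun a b : \bar R => (a * b)%E) (iid_rectangle uA mC) (iid_rectangle uC mC))).
by rewrite -EFinM; congr EFin; rewrite !big_filter [RHS](bigID A).
Qed.

End IIDLaw.

(** * The drift of the annealed Green measure *)

Lemma Rintegral_ae_ge0 (R : realType) dT (T : measurableType dT) (P : probability T R)
  (f : T -> R) : P.-integrable setT (EFin \o f) -> {ae P, forall t, 0 <= f t} ->
  0 <= \int[P]_t f t.
Proof.
move=> fi f0.
have /(ae_eq_integral (fun t => `|f t|%:E)) E : ae_eq P setT (EFin \o f) (fun t => `|f t|%:E).
  by apply: filterS f0 => t ft _ /=; rewrite ger0_norm.
rewrite /Rintegral; have mf := measurable_int _ fi.
rewrite [X in fine X]E //; first by rewrite fine_ge0 // integral_ge0.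
by apply/measurable_EFinP; apply: measurableT_comp => //; apply/measurable_EFinP.
Qed.

Lemma Rintegral_affine3 (R : realType) dT (T : measurableType dT) (P : probability T R)
  (f g h : T -> R) (k0 k1 k2 k3 : R) : P.-integrable setT (EFin \o f) ->
  P.-integrable setT (EFin \o g) -> P.-integrable setT (EFin \o h) ->
  P.-integrable setT (EFin \o (fun t => k0 + k1 * f t + k2 * g t + k3 * h t)) /\
  \int[P]_t (k0 + k1 * f t + k2 * g t + k3 * h t) =
  k0 + k1 * \int[P]_t f t + k2 * \int[P]_t g t + k3 * \int[P]_t h t.
Proof.
move=> fi gi hi.
have Zi k u : P.-integrable setT (EFin \o u) -> P.-integrable setT (EFin \o (fun t => k * u t)).
  by move=> ui; apply: (integrableZl _ k) ui.
have Di (u v : T -> R) : P.-integrable setT (EFin \o u) -> P.-integrable setT (EFin \o v) ->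
    P.-integrable setT (EFin \o (fun t => u t + v t)).
  by move=> ui vi; exact: (integrableD _ ui vi).
have c0 : P.-integrable setT (EFin \o (fun=> k0)).
  by apply: (@bounded_integrable _ _ _ _ _ `|k0|) => //; exact: measurable_cst.
have i1 := Di _ _ c0 (Zi k1 _ fi); have i2 := Di _ _ i1 (Zi k2 _ gi).
split; first exact: Di (Zi k3 _ hi).
rewrite RintegralD //; last exact: Zi.
rewrite RintegralD //; last exact: Zi.
rewrite RintegralD //; last exact: Zi.
by rewrite !RintegralZl // Rintegral_cstT.
Qed.

(** * An inequality for one random probability vector *)

Section SingleSite.
Context (R : realType) (D : finType) dT (T : measurableType dT) (P : probability T R).
Variables (W : D -> T -> R) (up dn : D).
Hypothesis mW : forall e, measurable_fun setT (W e).
Hypothesis W0 : forall e t, 0 <= W e t.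
Hypothesis W1 : forall t, \sum_e W e t = 1.

Let p e := \int[P]_t W e t.
Let sig2 := \sum_e \int[P]_t ((W e t - p e) ^+ 2).
Let lam := p up - p dn.

Let Wle1 e t : W e t <= 1.
Proof. by rewrite -(W1 t) (bigD1 e) //= lerDl sumr_ge0. Qed.

Let Wi e : P.-integrable setT (EFin \o W e).
Proof. by apply: (@bounded_integrable _ _ _ _ _ 1) => // t; rewrite ger0_norm. Qed.

Let p0 e : 0 <= p e. Proof. exact: Rintegral_ge0. Qed.

Let p1 : \sum_e p e = 1.
Proof.
rewrite -Rintegral_sum //; under eq_Rintegral do rewrite W1.
exact: Rintegral_cstT.
Qed.

(* With x = sum_e W e * a e, y its mean and S = sum_e (W e - p e)^2, the integrand dominates
   (W up - W dn - lam)/y - 2 K S/y + (lam - c)/y - (lam - c)(x - y)/y^2, whose mean is explicit. *)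
Lemma single_site_ineq (a : D -> R) (a0 K c : R) : 0 < a0 ->
  (forall e, a0 <= a e) ->
  {ae P, forall t, \sum_e a e <= K * \sum_e W e t * a e} -> 0 <= K ->
  c <= lam - 2 * K * sig2 ->
  0 <= \int[P]_t ((W up t - W dn t - c) * (\sum_e W e t * a e)^-1).
Proof.
move=> a0p ha hK K0 hc.
pose x t := \sum_e W e t * a e.
pose y := \sum_e p e * a e.
pose S t := \sum_e (W e t - p e) ^+ 2.
have xa t : a0 <= x t.
  rewrite -[leLHS]mul1r -(W1 t) mulr_suml; apply: ler_sum => e _.
  by rewrite ler_wpM2l.
have ya : a0 <= y.
  rewrite -[leLHS]mul1r -p1 mulr_suml; apply: ler_sum => e _.
  by rewrite ler_wpM2l.
have y0 : 0 < y := lt_le_trans a0p ya.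
have x0 t : 0 < x t := lt_le_trans a0p (xa t).
have s0 : 0 <= sig2 by apply: sumr_ge0 => e _; apply: Rintegral_ge0 => t _; exact: sqr_ge0.
have v0 : 0 <= lam - c by have := mulr_ge0 K0 s0; lra.
have mx : measurable_fun setT x.
  by apply: measurable_fun_bigsum => e; apply: measurable_funM => //; exact: measurable_cst.
have Sqi e : P.-integrable setT (EFin \o (fun t => (W e t - p e) ^+ 2)).
  apply: (@bounded_integrable _ _ _ _ _ ((1 + p e) ^+ 2)).
    apply: measurable_funX; apply: measurable_funB => //; exact: measurable_cst.
  move=> t; rewrite normrX lerXn2r ?nnegrE ?addr_ge0 ?normr_ge0 //.
  by rewrite (le_trans (ler_normB _ _)) // !ger0_norm // lerD2r.
have Si : P.-integrable setT (EFin \o S) by apply: sum_integrable.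
have xi : P.-integrable setT (EFin \o x).
  apply: sum_integrable => e.
  rewrite [X in P.-integrable _ (EFin \o X)](_ : _ = fun t => a e * W e t).
    by apply: (integrableZl _ (a e)) (Wi e).
  by apply/funext => t; rewrite mulrC.
pose Dl t := W up t - W dn t.
have Di : P.-integrable setT (EFin \o Dl) by exact: (integrableB _ (Wi up) (Wi dn)).
have IS : \int[P]_t S t = sig2 by rewrite Rintegral_sum.
have Ix : \int[P]_t x t = y.
  rewrite Rintegral_sum => [|e].
    by apply: eq_bigr => e _; rewrite RintegralZr.
  rewrite [X in P.-integrable _ (EFin \o X)](_ : _ = fun t => a e * W e t).
    by apply: (integrableZl _ (a e)) (Wi e).
  by apply/funext => t; rewrite mulrC.
have ID : \int[P]_t Dl t = lam by rewrite RintegralB.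
pose k0 := - lam / y + (lam - c) / y + (lam - c) / y.
pose k1 := y^-1. pose k2 := - (2 * K) / y. pose k3 := - (lam - c) / y ^+ 2.
have [Li LE] := @Rintegral_affine3 _ _ _ P Dl S x k0 k1 k2 k3 Di Si xi.
pose f t := (Dl t - c) * (x t)^-1.
have fi : P.-integrable setT (EFin \o f).
  apply: (@bounded_integrable _ _ _ _ _ ((2 + `|c|) * a0^-1)).
    apply: measurable_funM.
      apply: measurable_funB; last exact: measurable_cst.
      exact: measurable_funB.
    by apply: measurable_funV_pos => // t; exact: ltW.
  move=> t; rewrite normrM ler_pM ?normr_ge0 //.
    rewrite (le_trans (ler_normB _ _)) // lerD2r (le_trans (ler_normB _ _)) //.
    by rewrite !ger0_norm // (_ : 2 = 1 + 1) // lerD.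
  by rewrite normfV gtr0_norm // lef_pV2 ?posrE.
have key : {ae P, forall t, 0 <= f t - (k0 + k1 * Dl t + k2 * S t + k3 * x t)}.
  apply: filterS hK => t hA.
  have S0 : 0 <= S t by apply: sumr_ge0 => e _; exact: sqr_ge0.
  (* Each of the two squares is at most [S], and a product is at most the mean of the two
     squares. *)
  have dS e e' : `|(W e t - p e) * (W e' t - p e')| <= S t.
    have dle e1 : (W e1 t - p e1) ^+ 2 <= S t.
      by rewrite /S (bigD1 e1) //= lerDl sumr_ge0 // => *; exact: sqr_ge0.
    move: (dle e) (dle e'); set u := W e t - p e; set v := W e' t - p e' => hu hv.
    rewrite ler_norml; apply/andP; split; nra.
  have A0 : 0 <= \sum_e a e by apply: sumr_ge0 => e _; rewrite (le_trans (ltW a0p)).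
  have uB : `|(Dl t - lam) * (x t - y)| <= 2 * S t * \sum_e a e.
    have -> : (Dl t - lam) * (x t - y) =
      \sum_e a e * ((W e t - p e) * (W up t - p up) - (W e t - p e) * (W dn t - p dn)).
      by rewrite /x /y -sumrB mulr_sumr; apply: eq_bigr => e _; rewrite /Dl /lam; ring.
    rewrite (le_trans (ler_norm_sum _ _ _)) // mulr_sumr; apply: ler_sum => e _.
    have ae0 : 0 <= a e by rewrite (le_trans (ltW a0p)).
    rewrite normrM (ger0_norm ae0) mulrC ler_wpM2r // (le_trans (ler_normB _ _)) //.
    by have := dS e up; have := dS e dn; lra.
  have uB' : - (Dl t - lam) * (x t - y) >= - (2 * S t * (K * x t)).
    move: uB; rewrite ler_norml => /andP[_ uB].
    have := ler_wpM2l (mulr_ge0 (ler0n R 2) S0) hA; rewrite -/(x t); lra.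
  (* Write 1/x = 1/y - (x - y)/(x y) in front of [Dl - lam], and expand one order further in front
     of [lam - c]. The first summand is then nonnegative by [uB']; the second is the exact remainder
     (x - y)^2/(x y^2) times [lam - c]. *)
  have -> : f t - (k0 + k1 * Dl t + k2 * S t + k3 * x t) =
     (- (Dl t - lam) * (x t - y) + 2 * S t * (K * x t)) * (x t * y)^-1
     + (lam - c) * (x t - y) ^+ 2 * (x t * y ^+ 2)^-1.
    rewrite /f /k0 /k1 /k2 /k3; field.
    by rewrite !gt_eqF.
  apply: addr_ge0; apply: mulr_ge0.
  - by lra.
  - by rewrite invr_ge0 mulr_ge0 // ltW.
  - by rewrite mulr_ge0 // sqr_ge0.
  - by rewrite invr_ge0 mulr_ge0 ?sqr_ge0 // ltW.
have FI : P.-integrable setT (EFin \o (fun t => f t - (k0 + k1 * Dl t + k2 * S t + k3 * x t))).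
  exact: (integrableB _ fi Li).
have := Rintegral_ae_ge0 FI key.
rewrite RintegralB // LE IS Ix ID => h.
have : 0 <= k0 + k1 * lam + k2 * sig2 + k3 * y.
  (* The terms linear in [Dl - lam] and [x - y] have mean zero; only the variance penalty is left,
     and [hc] is the condition that it does not win. *)
  have -> : k0 + k1 * lam + k2 * sig2 + k3 * y = (lam - c - 2 * K * sig2) / y.
    by rewrite /k0 /k1 /k2 /k3; field; rewrite gt_eqF.
  by apply: divr_ge0; [lra | exact: ltW].
by move: h; rewrite /f /Dl /x; lra.
Qed.

End SingleSite.

(** * The one-site drift inequality for the random environment *)

Section KalikowInequality.
Context (R : realType) (d : nat) dT (T : measurableType dT) (P : probability T R).
Variable om : T -> env R d.
Hypothesis hd : (0 < d)%N.
Hypothesis hpv : prob_vectors om.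
Hypothesis hiid : iid_env P om.
Hypothesis heps : 0 < eps_env P om < 1.

Definition dir_up : Dir d := (Ordinal hd, true).
Definition dir_dn : Dir d := (Ordinal hd, false).

Lemma iid_measurable x e : measurable_fun setT (fun t => om t x e).
Proof. by case: hiid. Qed.
Let mom := iid_measurable.

Lemma prob_vectors_substoch t : substoch (om t).
Proof. by case: hpv => h0 h1; split => // x; rewrite h1. Qed.
Let hss := prob_vectors_substoch.

Lemma sum_e1idx (F : Dir d -> R) :
  \sum_(e : Dir d | e1idx e.1) F e = F dir_up + F dir_dn.
Proof.
rewrite (bigD1 dir_up) //=; congr (_ + _).
rewrite (big_pred1 dir_dn) // => -[i b] /=.
rewrite /e1idx /dir_up /dir_dn -!pair_eqE /= -!val_eqE /=.
by case: eqP => //= _; case: b.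
Qed.

Lemma lambda_envE :
  lambda_env P om = \int[P]_t om t 0 dir_up - \int[P]_t om t 0 dir_dn.
Proof.
have Wi e : P.-integrable setT (EFin \o (fun t => om t 0 e)).
  apply: (@bounded_integrable _ _ _ _ _ 1) => // t; rewrite ger0_norm ?(hss t).1 //.
  by rewrite (le_trans _ ((hss t).2 0)) // (bigD1 e) //= lerDl sumr_ge0 // => *; apply: (hss t).1.
rewrite -RintegralB // /lambda_env expectation.unlock /Rintegral; congr fine.
by apply: eq_integral => t _; rewrite sum_e1idx.
Qed.

Lemma sigma_envE : sigma_env P om ^+ 2 =
  \sum_e \int[P]_t ((om t 0 e - \int[P]_t om t 0 e) ^+ 2).
Proof.
have E e : fine (variance P (fun t => om t 0 e)) = \int[P]_t ((om t 0 e - \int[P]_t om t 0 e) ^+ 2).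
  by rewrite /variance covariance.unlock expectation.unlock.
rewrite /sigma_env sqr_sqrtr; first by apply: eq_bigr => e _; rewrite E.
by apply: sumr_ge0 => e _; rewrite E; apply: Rintegral_ge0 => t _; exact: sqr_ge0.
Qed.

Lemma eps_env_ae : {ae P, forall t e,
  `|om t 0 e - (2 * d%:R)^-1| <= eps_env P om / (4 * d%:R)}.
Proof.
pose f t : R := \big[Num.max/0]_(e : Dir d) `|om t 0 e - (2 * d%:R)^-1|.
have d0 : 0 < 4 * d%:R :> R by rewrite mulr_gt0 // ltr0n.
(* [fine] sends both infinities to 0, so a positive [eps_env] excludes an infinite essential
   supremum. *)
have fin : ess_sup P (fun t => (f t)%:E) \is a fin_num.
  move: heps; rewrite /eps_env -/f; case: ess_sup => [r //||] /=; rewrite mulr0 ltxx //.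
have := ess_sup_ge P (fun t => (f t)%:E); apply: filterS => t.
rewrite -(fineK fin) lee_fin => h e.
rewrite /eps_env -/f mulrAC divff ?mul1r ?gt_eqF //.
by apply: le_trans h; rewrite /f (bigD1 e) //= le_max lexx.
Qed.

(** The second argument is [lam - 2 * K * sig2] of [single_site_ineq] with [K = 2d(1 + eps)]. The
    cap 1/2 keeps [1 - c] strictly between 0 and 1 once the constant is positive, as the base of
    [pw] requires. *)
Definition kalikow_const : R :=
  Num.min (2^-1) (lambda_env P om - 4 * d%:R * sigma_env P om ^+ 2 * (1 + eps_env P om)).

Let c := kalikow_const.

Lemma site_ineq0 (z : R) (r : Dir d -> R) : 0 <= z < 1 -> (forall e, 0 <= r e <= z) ->
  0 <= \int[P]_t ((om t 0 dir_up - om t 0 dir_dn - c) * (1 - \sum_e om t 0 e * r e)^-1).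
Proof.
move=> /andP[z0 z1] hr; have [w0 w1] := hpv; have /andP[e0 e1] := heps.
have dd : 0 < d%:R :> R by rewrite ltr0n.
have E t : 1 - \sum_e om t 0 e * r e = \sum_e om t 0 e * (1 - r e).
  by rewrite -{1}(w1 t 0) -sumrB; apply: eq_bigr => e _; ring.
under eq_Rintegral do rewrite E.
apply: (@single_site_ineq R (Dir d) _ T P (fun e t => om t 0 e) dir_up dir_dn _ _ _
   (fun e => 1 - r e) (1 - z) (2 * d%:R * (1 + eps_env P om))) => //.
- by rewrite subr_gt0.
- by move=> e; have /andP[] := hr e; lra.
- apply: filterS eps_env_ae => t ht.
  rewrite mulr_sumr; apply: ler_sum => e _.
  rewrite mulrA -[leLHS]mul1r ler_wpM2r //; first by have /andP[] := hr e; lra.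
  have := ht e; rewrite ler_norml => /andP[h _].
  have h2 : (2 * d%:R)^-1 - eps_env P om / (4 * d%:R) <= om t 0 e by lra.
  have k0 : 0 <= 2 * d%:R * (1 + eps_env P om) by rewrite !mulr_ge0 ?ler0n //; lra.
  apply: le_trans (ler_wpM2l k0 h2).
  (* Origin of [K]: ellipticity gives w(e) >= (1 - eps/2)/(2d), and (1 + eps)(1 - eps/2) >= 1 for
     eps in [0, 1]. *)
  have -> : 2 * d%:R * (1 + eps_env P om) * ((2 * d%:R)^-1 - eps_env P om / (4 * d%:R)) =
     (1 + eps_env P om) * (1 - eps_env P om / 2) by field; rewrite gt_eqF.
  by nra.
- by rewrite !mulr_ge0 ?ler0n //; lra.
- rewrite -lambda_envE -sigma_envE /c /kalikow_const ge_min; apply/orP; right.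
  by rewrite le_eqVlt; apply/orP; left; apply/eqP; ring.
Qed.

Lemma denom_bound (w : env R d) y (z : R) (r : Dir d -> R) : 0 <= z < 1 ->
  (forall e, 0 <= r e <= z) -> substoch w -> 1 - z <= 1 - \sum_e w y e * r e.
Proof.
move=> /andP[z0 z1] hr hw; rewrite lerD2l lerN2.
by apply: substoch_sum_le => // e; case/andP: (hr e).
Qed.

Lemma drift_bound (w : env R d) y : substoch w -> 0 <= 1 + (w y dir_up - w y dir_dn) <= 2.
Proof.
move=> [w0 w1].
have le1 e : w y e <= 1.
  by rewrite (le_trans _ (w1 y)) // (bigD1 e) //= lerDl sumr_ge0.
have := le1 dir_up; have := le1 dir_dn; have := w0 y dir_up; have := w0 y dir_dn.
by move=> *; apply/andP; split; lra.
Qed.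

Lemma site_integrable dS (S : measurableType dS) (Q : probability S R) (oS : S -> env R d) y z r k :
  (forall x e, measurable_fun setT (fun t => oS t x e)) ->
  (forall t, substoch (oS t)) -> 0 <= z < 1 -> (forall e, 0 <= r e <= z) ->
  Q.-integrable setT (EFin \o (fun t =>
    (k + (oS t y dir_up - oS t y dir_dn)) * (1 - \sum_e oS t y e * r e)^-1)).
Proof.
move=> moS hS z01 hr; have /andP[z0 z1] := z01.
have zp : 0 < 1 - z by rewrite subr_gt0.
have dp t : 0 < 1 - \sum_e oS t y e * r e := lt_le_trans zp (denom_bound y z01 hr (hS t)).
apply: (@bounded_integrable _ _ _ _ _ ((`|k| + 1) * (1 - z)^-1)).
  apply: measurable_funM.
    by apply: measurable_funD; [exact: measurable_cst | exact: measurable_funB].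
  apply: measurable_funV_pos; last by move=> t; exact: ltW.
  apply: measurable_funB; first exact: measurable_cst.
  by apply: measurable_fun_bigsum => e; apply: measurable_funM => //; exact: measurable_cst.
move=> t; rewrite normrM ler_pM ?normr_ge0 //.
  rewrite (le_trans (ler_normD _ _)) // lerD2l ler_norml.
  have [w0 w1] := hS t.
  have le1 e : oS t y e <= 1.
    by rewrite (le_trans _ (w1 y)) // (bigD1 e) //= lerDl sumr_ge0.
  have := le1 dir_up; have := le1 dir_dn; have := w0 y dir_up; have := w0 y dir_dn.
  by move=> *; apply/andP; split; lra.
by rewrite normfV gtr0_norm // lef_pV2 ?posrE // denom_bound.
Qed.

(** Stationarity moves [site_ineq0] from the origin to [y]. Since [shift_law] is for nonnegative
    integrands and the drift D is signed, it is applied to 1 + D and 2 + D, and D - c is recovered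
    as (2 + c)(1 + D) - (1 + c)(2 + D). *)
Lemma site_ineq y (z : R) (r : Dir d -> R) : 0 <= z < 1 -> (forall e, 0 <= r e <= z) ->
  0 <= \int[P]_t ((om t y dir_up - om t y dir_dn - c) * (1 - \sum_e om t y e * r e)^-1).
Proof.
move=> z01 hr; have := site_ineq0 z01 hr; have [w0 w1] := hpv.
have /andP[z0 z1] := z01; have zp : 0 < 1 - z by rewrite subr_gt0.
pose psi k (w : env_space R d) : \bar R :=
  ((k + (clamp w 0 dir_up - clamp w 0 dir_dn)) * (1 - \sum_e clamp w 0 e * r e)^-1)%:E.
have E k x : 1 <= k ->
    (\int[P]_t psi k (om t) = \int[P]_t psi k (fun y => om t (x + y)%R))%E.
  move=> k1; apply: (shift_law hiid).
    apply/measurable_EFinP; apply: measurable_funM.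
      apply: measurable_funD; first exact: measurable_cst.
      by apply: measurable_funB; apply: measurable_clamp; exact: measurable_coord.
    apply: measurable_funV_pos.
      apply: measurable_funB; first exact: measurable_cst.
      apply: measurable_fun_bigsum => e; apply: measurable_funM; last exact: measurable_cst.
      by apply: measurable_clamp; exact: measurable_coord.
    move=> w; apply: (le_trans (ltW zp)); apply: denom_bound => //; exact: clamp_substoch.
  move=> w; rewrite lee_fin; apply: mulr_ge0.
    have := drift_bound 0 (clamp_substoch w) => /andP[h _]; lra.
  rewrite invr_ge0; apply: (le_trans (ltW zp)); apply: denom_bound => //; exact: clamp_substoch.
have key k : 1 <= k ->
   \int[P]_t ((k + (om t 0 dir_up - om t 0 dir_dn)) * (1 - \sum_e om t 0 e * r e)^-1) =
   \int[P]_t ((k + (om t y dir_up - om t y dir_dn)) * (1 - \sum_e om t y e * r e)^-1).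
  move=> k1; rewrite /Rintegral; congr fine.
  transitivity (\int[P]_t psi k (om t))%E.
    by apply: eq_integral => t _; rewrite /psi clamp_id.
  rewrite (E k y k1); apply: eq_integral => t _.
  by rewrite /psi clamp_id // addr0.
have split_int x : \int[P]_t ((om t x dir_up - om t x dir_dn - c) * (1 - \sum_e om t x e * r e)^-1)
   = (2 + c) * \int[P]_t ((1 + (om t x dir_up - om t x dir_dn)) * (1 - \sum_e om t x e * r e)^-1)
   - (1 + c) * \int[P]_t ((2 + (om t x dir_up - om t x dir_dn)) * (1 - \sum_e om t x e * r e)^-1).
  rewrite -!RintegralZl //; try exact: (@site_integrable _ _ P om x z).
  rewrite -RintegralB //.
  - by apply: eq_Rintegral => t _; ring.
  - by apply: (integrableZl _ (2 + c)) (@site_integrable _ _ P om x z _ _ mom hss z01 hr).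
  - by apply: (integrableZl _ (1 + c)) (@site_integrable _ _ P om x z _ _ mom hss z01 hr).
by rewrite !split_int !key // ler1n.
Qed.

End KalikowInequality.

(** * Drift of the discounted annealed Green function *)

Section KalikowGreen.
Context (R : realType) (d : nat) dT (T : measurableType dT) (P : probability T R).
Variable om : T -> env R d.
Hypothesis hd : (0 < d)%N.
Hypothesis hpv : prob_vectors om.
Hypothesis hiid : iid_env P om.
Hypothesis heps : 0 < eps_env P om < 1.
Let up := dir_up hd.
Let dn := dir_dn hd.
Let c := kalikow_const P om.
Let mom : forall x e, measurable_fun setT (fun t => om t x e) := iid_measurable hiid.
Let hss : forall t, substoch (om t) := prob_vectors_substoch hpv.

(** A conditional comparison suffices: it is checked with the environment in [A] frozen and the rest
    resampled, then integrated. *)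
Lemma mix_law_le A (psi1 psi2 : env_space R d -> \bar R) (k : R) : 0 <= k ->
  measurable_fun [set: env_space R d] psi1 -> measurable_fun [set: env_space R d] psi2 ->
  (forall w, (0 <= psi1 w)%E) -> (forall w, (0 <= psi2 w)%E) ->
  (forall t, (k%:E * \int[P]_t' psi2 (mix A (om t) (om t')) <=
              \int[P]_t' psi1 (mix A (om t) (om t')))%E) ->
  (k%:E * \int[P]_t psi2 (om t) <= \int[P]_t psi1 (om t))%E.
Proof.
move=> k0 m1 m2 p1 p2 h.
have mmix x e : measurable_fun setT (fun p : T * T => mix A (om p.1) (om p.2) x e).
  rewrite /mix; case: (A x).
    exact: (measurableT_comp (mom x e) measurable_fst).
  exact: (measurableT_comp (mom x e) measurable_snd).
have mF (psi : env_space R d -> \bar R) : measurable_fun [set: env_space R d] psi ->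
  (forall w, (0 <= psi w)%E) ->
  measurable_fun setT (fun t => \int[P]_t' psi (mix A (om t) (om t')))%E.
  move=> mpsi ppsi.
  apply: (measurable_fun_fubini_tonelli_F (fun p : T * T => psi (mix A (om p.1) (om p.2)))) => //.
  exact: (measurableT_comp mpsi (measurable_env mmix)).
rewrite (mix_law hiid A m1 p1) (mix_law hiid A m2 p2).
rewrite -ge0_integralZl //; last 2 first.
- exact: mF.
- by move=> t _; apply: integral_ge0.
apply: ge0_le_integral => //.
- by move=> t _; rewrite mule_ge0 // integral_ge0.
- by apply: measurable_funeM; exact: mF.
- exact: mF.
Qed.

Lemma zero_at_mix y w w' : zero_at y (mix (predC1 y) w w') = zero_at y w :> env R d.
Proof. by apply/funext => x; apply/funext => e; rewrite /zero_at /mix /=; case: eqP. Qed.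

(** Freeze the environment off [y]. By first passage and return, the Green function is then a
    constant [H x] times 1/(1 - sum_e w(y,e) r e) with deterministic
    [r e = z * H (y + unitv e) <= z], so [site_ineq] bounds the integral over w(y) alone. *)
Lemma gz_drift_ge B x y (z : R) : 0 <= z < 1 -> y \in B ->
  c * \int[P]_t gz B (om t) z x y <=
  \int[P]_t (gz B (om t) z x y * (om t y up - om t y dn)).
Proof.
move=> z01 yB; have [w0 w1] := hpv; have /andP[z0 z1] := z01.
have lec : c <= 2^-1 by rewrite /c /kalikow_const ge_min lexx.
have gi : P.-integrable setT (EFin \o (fun t => gz B (om t) z x y)).
  apply: (@bounded_integrable _ _ _ _ _ ((1 - z)^-1)); first exact: measurable_gz.
  by move=> t; rewrite ger0_norm ?gz_ge0 ?gz_le.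
have ggi : P.-integrable setT (EFin \o (fun t => gz B (om t) z x y * (om t y up - om t y dn))).
  apply: (@bounded_integrable _ _ _ _ _ ((1 - z)^-1 * 1)).
    by apply: measurable_funM; [exact: measurable_gz | exact: measurable_funB].
  move=> t; rewrite normrM; apply: ler_pM => //.
    by rewrite ger0_norm ?gz_ge0 ?gz_le.
  have := drift_bound hd y (hss t); rewrite -/up -/dn => /andP[h1 h2].
  by rewrite ler_norml; apply/andP; split; lra.
(* If [c <= -1] the trivial bound drift >= -1 suffices. Otherwise [1 + c] is an admissible factor in
   [mix_law_le], and adding 1 to the drift makes the integrands nonnegative. *)
case: (leP c (-1)) => [cle|cgt].
  rewrite -RintegralZl //; apply: le_Rintegral => //.
    by apply: (integrableZl _ c) gi.
  move=> t _; rewrite mulrC ler_wpM2l ?gz_ge0 //.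
  by have := drift_bound hd y (hss t); rewrite -/up -/dn => /andP[h1 h2]; lra.
pose psi1 (w : env_space R d) : \bar R :=
  (gz B (clamp w) z x y * (1 + (clamp w y up - clamp w y dn)))%:E.
pose psi2 (w : env_space R d) : \bar R := (gz B (clamp w) z x y)%:E.
have mcl := measurable_clamp (@measurable_coord R d).
have mg : measurable_fun [set: env_space R d] (fun w => gz B (clamp w) z x y).
  by apply: (measurable_gz mcl) => // w; exact: clamp_substoch.
have : ((1 + c)%:E * \int[P]_t psi2 (om t) <= \int[P]_t psi1 (om t))%E.
  apply: (@mix_law_le (predC1 y)).
  - lra.
  - apply/measurable_EFinP; apply: measurable_funM => //.
    apply: measurable_funD; first exact: measurable_cst.
    by apply: measurable_funB; exact: mcl.
  - exact/measurable_EFinP.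
  - move=> w; rewrite lee_fin; apply: mulr_ge0.
      by apply: gz_ge0 => //; exact: clamp_substoch.
    by case/andP: (drift_bound hd y (clamp_substoch w)).
  - by move=> w; rewrite lee_fin; apply: gz_ge0 => //; exact: clamp_substoch.
  move=> t.
  pose H u := gz B (zero_at y (om t)) z u y.
  pose r e := z * H (y + unitv e).
  have hr e : 0 <= r e <= z.
    have h0 : 0 <= H (y + unitv e) by apply: gz_ge0 => //; exact: zero_at_substoch.
    rewrite mulr_ge0 //=; by rewrite -[leRHS]mulr1 ler_wpM2l // hit_le1.
  have H0 : 0 <= H x by apply: gz_ge0 => //; exact: zero_at_substoch.
  have gE t' : gz B (mix (predC1 y) (om t) (om t')) z x y =
     H x * (1 - \sum_e om t' y e * r e)^-1.
    have hm : substoch (mix (predC1 y) (om t) (om t')).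
      split=> [u e|u]; rewrite /mix; case: (predC1 y u) => //; rewrite ?w1 //.
    rewrite gz_first_passage // gz_return // zero_at_mix; congr (_ * (1 - _)^-1).
    rewrite mulr_sumr; apply: eq_bigr => e _.
    by rewrite /mix /= eqxx /r mulrCA.
  have mE t' : clamp (mix (predC1 y) (om t) (om t')) = mix (predC1 y) (om t) (om t').
    by apply: clamp_id => [u e|u]; rewrite /mix; case: (predC1 y u).
  have yE t' : mix (predC1 y) (om t) (om t') y = om t' y by rewrite /mix /= eqxx.
  have i1 k := @site_integrable R d hd _ T P om y z r k mom hss z01 hr.
  have i0 : P.-integrable setT (EFin \o (fun t' => (1 - \sum_e om t' y e * r e)^-1)).
    rewrite [X in P.-integrable _ (EFin \o X)](_ : _ = fun t' =>
      (2 + (om t' y up - om t' y dn)) * (1 - \sum_e om t' y e * r e)^-1 -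
      (1 + (om t' y up - om t' y dn)) * (1 - \sum_e om t' y e * r e)^-1).
      exact: (integrableB _ (i1 2) (i1 1)).
    by apply/funext => t'; ring.
  have -> : (\int[P]_t' psi2 (mix (predC1 y) (om t) (om t')) =
     (H x * \int[P]_t' (1 - \sum_e om t' y e * r e)^-1)%:E)%E.
    rewrite -RintegralZl // -RintegralE; last by apply: (integrableZl _ (H x)) i0.
    by apply: eq_integral => t' _; rewrite /psi2 mE gE.
  have -> : (\int[P]_t' psi1 (mix (predC1 y) (om t) (om t')) =
     (H x * \int[P]_t' ((1 + (om t' y up - om t' y dn)) * (1 - \sum_e om t' y e * r e)^-1))%:E)%E.
    rewrite -RintegralZl // -RintegralE; last by apply: (integrableZl _ (H x)) (i1 1).
    by apply: eq_integral => t' _; rewrite /psi1 mE gE yE -mulrA [X in _ * X]mulrC.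
  rewrite -EFinM lee_fin mulrCA; apply: ler_wpM2l => //.
  rewrite -subr_ge0 -RintegralZl // -RintegralB //; last by apply: (integrableZl _ (1 + c)) i0.
  apply: (le_trans (site_ineq hd hpv hiid heps y z01 hr)); rewrite -/c -/up -/dn.
  rewrite le_eqVlt; apply/orP; left; apply/eqP.
  by apply: eq_Rintegral => t' _; ring.
have -> : (\int[P]_t psi2 (om t) = (\int[P]_t gz B (om t) z x y)%:E)%E.
  by rewrite -RintegralE //; apply: eq_integral => t _; rewrite /psi2 clamp_id.
have -> : (\int[P]_t psi1 (om t) = (\int[P]_t gz B (om t) z x y
   + \int[P]_t (gz B (om t) z x y * (om t y up - om t y dn)))%:E)%E.
  rewrite -RintegralD // -RintegralE; last exact: (integrableD _ gi ggi).
  by apply: eq_integral => t _; rewrite /psi1 clamp_id // mulrDr mulr1.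
by rewrite -EFinM lee_fin mulrDl mul1r lerD2l.
Qed.

End KalikowGreen.

(** * Bounds on the annealed Green measure *)

Lemma kill_notin_r (R : realType) d (B : set (Zd d)) (w : env R d) n x y :
  y \notin B -> kill B w n x y = 0.
Proof.
move=> yB; elim: n x => [|n IH] x /=.
  by case: (eqVneq x y) => [->|]; rewrite ?(negbTE yB) ?andbF.
by rewrite big1 ?mulr0 // => e _; rewrite IH mulr0.
Qed.

Lemma gz_notin_r (R : realType) d (B : set (Zd d)) (w : env R d) z x y :
  y \notin B -> gz B w z x y = 0.
Proof.
move=> yB; rewrite /gz; under eq_fun do rewrite kill_notin_r // mulr0.
by apply: lim_near_cst => //; apply: nearW => n; rewrite /series /= big1.
Qed.

(** How z tends to 1, along z = 1 - 1/(n + 2): a partial sum loses at most a fixed power of [z] to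
    the discount, so bounds uniform in [z] pass to undiscounted partial sums. *)
Lemma abel_bound (R : realType) (S C : R) k :
  (forall z : R, 0 < z < 1 -> z ^+ k * S <= C) -> S <= C.
Proof.
move=> h.
have cu : (fun n : nat => 1 - (n.+2%:R)^-1 : R) @ \oo --> (1 : R).
  rewrite -[X in _ --> X]subr0; apply: cvgB; first exact: cvg_cst.
  by have := @cvg_harmonic R; rewrite -cvg_shiftS.
have cv : (fun n : nat => (1 - (n.+2%:R)^-1) ^+ k * S) @ \oo --> S.
  rewrite -[X in _ --> X]mul1r; apply: cvgMl.
  elim: k {h} => [|k IH]; first by under eq_fun do rewrite expr0; exact: cvg_cst.
  rewrite -[X in _ --> X]mul1r; under eq_fun do rewrite exprS.
  exact: cvgM cu IH.
rewrite -(cvg_lim _ cv) //; apply: limr_le; first exact: cvgP cv.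
apply: nearW => n; apply: h.
rewrite subr_gt0 invf_lt1 ?ltr0n // ltr1n /= gtrBl invr_gt0 ltr0n //.
Qed.

Section Level.
Context (d : nat).
Hypothesis hd : (0 < d)%N.
Definition lev (x : Zd d) : int := x ord0 (Ordinal hd).

Lemma lev_up x : lev (x + unitv (dir_up hd)) = lev x + 1.
Proof. by rewrite /lev !mxE eqxx. Qed.

Lemma lev_dn x : lev (x + unitv (dir_dn hd)) = lev x - 1.
Proof. by rewrite /lev !mxE eqxx. Qed.

Lemma lev_other x e : e != dir_up hd -> e != dir_dn hd -> lev (x + unitv e) = lev x.
Proof.
case: e => i b; rewrite /lev !mxE /= => h1 h2.
case: eqP => [ii|]; last by rewrite addr0.
by case: b h1 h2; rewrite -ii ?eqxx.
Qed.

Lemma sum_updn (R : realType) (F : Dir d -> R) :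
  (forall e, e != dir_up hd -> e != dir_dn hd -> F e = 0) ->
  \sum_e F e = F (dir_up hd) + F (dir_dn hd).
Proof.
move=> h; rewrite (bigD1 (dir_up hd)) //= (bigD1 (dir_dn hd)) //= big1 ?addr0 //.
by move=> e /andP[]; exact: h.
Qed.

Lemma lev0 : lev 0 = 0. Proof. by rewrite /lev mxE. Qed.

End Level.

(* [pw c (lev - l)] is 1 below level [l] and decays geometrically above it: superharmonic for
   every walk whose drift in direction e1 is at least [c]. *)
Definition pw (R : realType) (c : R) (k : int) : R := if k is Posz n then (1 - c) ^+ n else 1.

Lemma pw_ge0 (R : realType) (c : R) k : c <= 1 -> 0 <= pw c k.
Proof. by move=> c1; case: k => n //=; rewrite exprn_ge0 // subr_ge0. Qed.

Lemma pw_le1 (R : realType) (c : R) k : 0 <= c <= 1 -> pw c k <= 1.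
Proof. by move=> /andP[c0 c1]; case: k => n //=; rewrite exprn_ile1 // ?subr_ge0 // gerBl. Qed.

Lemma pw_neg (R : realType) (c : R) k : k <= 0 -> pw c k = 1.
Proof. by case: k => // -[|n]. Qed.

(** Above the kink the decrease is a nonnegative multiple of gu(1 - c) - gd, which is nonnegative
    because gu - gd >= c g0 >= c gu; this dictates the base [1 - c]. At the kink k = 0 only the
    upward step changes the value, and it gains c gu >= c^2 g0. That strict gain is what bounds the
    Green function. *)
Lemma pw_step (R : realType) (c gu gd g0 : R) (k : int) : 0 <= c -> c <= 1 -> 0 <= gd -> gu <= g0 ->
  c * g0 <= gu - gd ->
  c * c * (k == 0)%:R * g0 <= gu * (pw c k - pw c (k + 1)) + gd * (pw c k - pw c (k - 1)).
Proof.
move=> c0 c1 gd0 gug h.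
have hcu : c * gu <= c * g0 by rewrite ler_wpM2l.
case: k => [[|n]|n].
- rewrite eqxx mulr1 add0r sub0r /= expr0 expr1.
  have : c * (c * g0) <= c * (gu - gd) by rewrite ler_wpM2l.
  by have := mulr_ge0 c0 gd0; lra.
- have -> : Posz n.+1 + 1 = Posz n.+2 by rewrite -PoszD addn1.
  have -> : Posz n.+1 - 1 = Posz n by lia.
  rewrite mulr0 mul0r /= !exprS.
  have -> : gu * ((1 - c) * (1 - c) ^+ n - (1 - c) * ((1 - c) * (1 - c) ^+ n))
    + gd * ((1 - c) * (1 - c) ^+ n - (1 - c) ^+ n) =
    (1 - c) ^+ n * c * (gu * (1 - c) - gd) by ring.
  by rewrite !mulr_ge0 // ?exprn_ge0 ?subr_ge0 //; lra.
- rewrite mulr0 mul0r !pw_neg; [|lia..].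
  by rewrite subrr !mulr0 addr0.
Qed.

Section Annealed.
Context (R : realType) (d : nat) dT (T : measurableType dT) (P : probability T R).
Variable om : T -> env R d.
Hypothesis hd : (0 < d)%N.
Hypothesis hpv : prob_vectors om.
Hypothesis hiid : iid_env P om.
Hypothesis heps : 0 < eps_env P om < 1.
Hypothesis hc : 0 < kalikow_const P om.
Let up := dir_up hd.
Let dn := dir_dn hd.
Let c := kalikow_const P om.
Let mom : forall x e, measurable_fun setT (fun t => om t x e) := iid_measurable hiid.
Let hss : forall t, substoch (om t) := prob_vectors_substoch hpv.
Let levd := lev hd.

Let cle : c <= 2^-1. Proof. by rewrite /c /kalikow_const ge_min lexx. Qed.
Let c1 : c <= 1. Proof. by have := cle; lra. Qed.
Let c01 : 0 <= c <= 1. Proof. by rewrite c1 (ltW hc). Qed.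

Let omle1 t x e : om t x e <= 1.
Proof.
have [w0 w1] := hss t.
by rewrite (le_trans _ (w1 x)) // (bigD1 e) //= lerDl sumr_ge0.
Qed.

Section fixB.
Variables (B : set (Zd d)) (N : nat) (z : R).
Hypothesis z01 : 0 <= z < 1.
Hypothesis B0 : B 0.
Let B' := inreach B N.
Let z0 : 0 <= z. Proof. by case/andP: z01. Qed.

Let g t y := gz B' (om t) z 0 y.
Let G0 y := \int[P]_t g t y.
Let G e y := \int[P]_t (g t y * om t y e).

Let gi y : P.-integrable setT (EFin \o (fun t => g t y)).
Proof.
apply: (@bounded_integrable _ _ _ _ _ ((1 - z)^-1)); first exact: measurable_gz.
by move=> t; rewrite ger0_norm ?gz_ge0 ?gz_le.
Qed.

Let gei y e : P.-integrable setT (EFin \o (fun t => g t y * om t y e)).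
Proof.
apply: (@bounded_integrable _ _ _ _ _ ((1 - z)^-1 * 1)).
  by apply: measurable_funM; [exact: measurable_gz | exact: mom].
move=> t; rewrite normrM; apply: ler_pM => //.
  by rewrite ger0_norm ?gz_ge0 ?gz_le.
by rewrite ger0_norm ?(hss t).1.
Qed.

Let G_ge0 e y : 0 <= G e y.
Proof.
by apply: Rintegral_ge0 => t _; apply: mulr_ge0; [exact: gz_ge0 | exact: (hss t).1].
Qed.

Let G0E y : G0 y = \sum_e G e y.
Proof.
rewrite -Rintegral_sum //; apply: eq_Rintegral => t _.
by rewrite -mulr_sumr hpv.2 mulr1.
Qed.

Let G_out e y : y \notin B' -> G e y = 0.
Proof.
move=> yB; rewrite /G /g; under eq_Rintegral do rewrite gz_notin_r // mul0r.
exact: Rintegral_cstT.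
Qed.

Let G_drift y : c * G0 y <= G up y - G dn y.
Proof.
case: (boolP (y \in B')) => yB; last first.
  by rewrite G0E big1 ?mulr0 ?G_out ?subrr // => e _; rewrite G_out.
rewrite -RintegralB //.
apply: (le_trans (gz_drift_ge hd hpv hiid heps 0 z01 yB)).
rewrite le_eqVlt; apply/orP; left; apply/eqP.
by apply: eq_Rintegral => t _; rewrite mulrBr.
Qed.

(** Integrate the quenched formula: [w y e] occurs only through its product with [g t y], so the
    averaged weights [G e y] satisfy Dynkin's formula of Kalikow's walk. *)
Lemma annealed_dynkin (f : Zd d -> R) :
  f 0 = \sum_(y <- reach d N)
    (G0 y * f y - z * \sum_e G e y * (((y + unitv e) \in B')%:R * f (y + unitv e))).
Proof.
have B'0 : 0 \in B'.
  by rewrite (@inreach_mem d B N 0%N) ?inE.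
have E t : f 0 = \sum_(y <- reach d N) g t y *
    (f y - z * \sum_e om t y e * (((y + unitv e) \in B')%:R * f (y + unitv e))).
  by rewrite (dynkin z01 0 f (hss t) (reach_uniq d N)) ?B'0 ?mul1r // => y [].
have : \int[P]_t (f 0) = f 0 by exact: Rintegral_cstT.
have ai y (k : Dir d -> R) : P.-integrable setT (EFin \o (fun t => \sum_e (g t y * om t y e * k e))).
  apply: sum_integrable => e.
  rewrite [X in P.-integrable _ (EFin \o X)](_ : _ = fun t => k e * (g t y * om t y e)).
    by apply: (integrableZl _ (k e)) (gei y e).
  by apply/funext => t; rewrite mulrC.
have gfi y : P.-integrable setT (EFin \o (fun t => f y * g t y)).
  by apply: (integrableZl _ (f y)) (gi y).
pose k y e : R := z * (((y + unitv e) \in B')%:R * f (y + unitv e)).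
move=> <-; rewrite (_ : Rintegral _ _ _ = \int[P]_t \sum_(y <- reach d N)
   (f y * g t y - \sum_e (g t y * om t y e * k y e))); last first.
  apply: eq_Rintegral => t _; rewrite (E t).
  apply: eq_bigr => y _; rewrite mulrBr [f y * _]mulrC; congr (_ - _).
  by rewrite mulrCA !mulr_sumr; apply: eq_bigr => e _; rewrite /k; ring.
rewrite Rintegral_sum => [|y]; last exact: (integrableB _ (gfi y) (ai y _)).
apply: eq_bigr => y _; rewrite RintegralB // RintegralZl // mulrC; congr (_ - _).
rewrite Rintegral_sum => [|e].
  rewrite mulr_sumr; apply: eq_bigr => e _; rewrite RintegralZr // /k mulrCA.
  by [].
rewrite [X in P.-integrable _ (EFin \o X)](_ : _ = fun t => k y e * (g t y * om t y e)).
  by apply: (integrableZl _ (k y e)) (gei y e).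
by apply/funext => t; rewrite mulrC.
Qed.

(** Optional stopping for Kalikow's walk: the accumulated decrease [rho] plus the value of [f]
    carried out at exits cannot exceed the initial value. *)
Lemma annealed_supermartingale (f rho : Zd d -> R) :
  (forall y, y \in B' -> 0 <= f y) ->
  (forall y, y \in B' -> rho y <= \sum_e G e y * (f y - f (y + unitv e))) ->
  (forall y, y \notin B' -> rho y = 0) ->
  z * \sum_(y <- reach d N)
    (rho y + \sum_e G e y * (((y + unitv e) \notin B')%:R * f (y + unitv e))) <= f 0.
Proof.
move=> f0 hrho rho0; rewrite [leRHS]annealed_dynkin mulr_sumr; apply: ler_sum => y _.
case: (boolP (y \in B')) => yB; last first.
  rewrite rho0 // G0E !big1 ?addr0 ?mulr0 ?mul0r ?subr0 // => e _; rewrite G_out //; exact: mul0r.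
(* Killing by the discount, decrease along a step, and exit from [B']. The first part is nonnegative
   and is thrown away. *)
have E : G0 y * f y - z * (\sum_e G e y * (((y + unitv e) \in B')%:R * f (y + unitv e))) =
   (1 - z) * (G0 y * f y) + z * (\sum_e G e y * (f y - f (y + unitv e)))
   + z * (\sum_e G e y * (((y + unitv e) \notin B')%:R * f (y + unitv e))).
  rewrite -addrA -mulrDr -big_split /=.
  have -> : \sum_e (G e y * (f y - f (y + unitv e)) +
      G e y * (((y + unitv e) \notin B')%:R * f (y + unitv e))) =
    \sum_e (G e y * f y - G e y * (((y + unitv e) \in B')%:R * f (y + unitv e))).
    apply: eq_bigr => e _; case: (y + unitv e \in B'); rewrite /=; ring.
  by rewrite sumrB -mulr_suml -G0E; ring.
rewrite E mulrDr lerD2r -[leLHS]add0r lerD //.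
  rewrite mulr_ge0 ?subr_ge0 ?(ltW (andP z01).2) // mulr_ge0 ?f0 //.
  by rewrite G0E sumr_ge0.
by rewrite ler_wpM2l // hrho.
Qed.

Lemma pw_superharmonic l y :
  c * c * (levd y == l)%:R * G0 y <=
  \sum_e G e y * (pw c (levd y - l) - pw c (levd (y + unitv e) - l)).
Proof.
rewrite (sum_updn (hd := hd)); last first.
  by move=> e h1 h2; rewrite /levd lev_other // subrr mulr0.
rewrite /levd lev_up lev_dn -/levd -/up -/dn.
rewrite (addrAC _ 1) (addrAC _ (-1)) -subr_eq0.
apply: pw_step; rewrite ?(ltW hc) //.
by rewrite G0E (bigD1 up) //= lerDl sumr_ge0.
Qed.

(** Test with [pw] whose kink lies at the level of [y]: each site of that level contributes
    [c * c * G0], and the total is at most the value of [pw] at the start, hence at most 1. *)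
Lemma annealed_gz_bound y : z * (c * c * G0 y) <= 1.
Proof.
case: (boolP (y \in B')) => yB; last first.
  by rewrite G0E big1 ?mulr0 // => e _; rewrite G_out.
have yr : y \in reach d N by move: yB => /set_mem[].
pose rho u := c * c * (levd u == levd y)%:R * G0 u.
have h := @annealed_supermartingale (fun u => pw c (levd u - levd y)) rho.
have {h} : z * \sum_(u <- reach d N) (rho u + \sum_e G e u *
   (((u + unitv e) \notin B')%:R * pw c (levd (u + unitv e) - levd y))) <= pw c (levd 0 - levd y).
  apply: h => [u _|u _|u uB]; [exact: (pw_ge0 _ c1) | exact: pw_superharmonic |].
  by rewrite /rho G0E big1 ?mulr0 // => e _; rewrite G_out.
move=> h; apply: le_trans (pw_le1 (levd 0 - levd y) c01); apply: le_trans h.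
have ge0 u : 0 <= rho u + \sum_e G e u *
   (((u + unitv e) \notin B')%:R * pw c (levd (u + unitv e) - levd y)).
  rewrite addr_ge0 // ?sumr_ge0 // => [|e _]; last by rewrite !mulr_ge0 ?(pw_ge0 _ c1).
  by rewrite /rho !mulr_ge0 ?(ltW hc) // G0E sumr_ge0.
rewrite ler_wpM2l // (bigD1_seq y) ?reach_uniq //= -[leLHS]addr0 lerD ?sumr_ge0 //.
rewrite /rho eqxx mulr1 -[leLHS]addr0 lerD2l sumr_ge0 // => e _.
by rewrite !mulr_ge0 ?(pw_ge0 _ c1).
Qed.

(** Test with [L - lev], which starts at [L] and loses the drift, at least [c] times the Green
    measure, at each site. *)
Lemma annealed_time_bound (L : nat) : (forall x, B x -> levd x < L%:Z) ->
  z * (c * \sum_(y <- reach d N) G0 y) <= L%:R.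
Proof.
move=> BL.
pose f u : R := L%:R - (levd u)%:~R.
have BL' u : u \in B' -> levd u < L%:Z by move=> /set_mem[/BL].
pose rho u := c * G0 u.
have h := @annealed_supermartingale f rho.
have fe u : \sum_e G e u * (f u - f (u + unitv e)) = G up u - G dn u.
  rewrite (sum_updn (hd := hd)); last first.
    by move=> e h1 h2; rewrite /f /levd lev_other // subrr mulr0.
  by rewrite /f /levd lev_up lev_dn !intrD -/up -/dn; ring.
have {h} : z * \sum_(u <- reach d N) (rho u + \sum_e G e u *
   (((u + unitv e) \notin B')%:R * f (u + unitv e))) <= f 0.
  apply: h => [u uB|u _|u uB].
  - rewrite /f subr_ge0 -[L%:R]/(L%:Z%:~R) ler_int ltW //; exact: BL'.
  - by rewrite fe; exact: G_drift.
  - by rewrite /rho G0E big1 ?mulr0 // => e _; rewrite G_out.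
have -> : f 0 = L%:R by rewrite /f /levd lev0 subr0.
apply: le_trans; rewrite ler_wpM2l // mulr_sumr; apply: ler_sum => u _.
rewrite lerDl sumr_ge0 // => e _.
(* A single step from below level [L] cannot pass above it, so the test function is nonnegative at
   exit points too. *)
case: (boolP (u \in B')) => uB; last by rewrite G_out // mul0r.
rewrite !mulr_ge0 // /f subr_ge0 -[L%:R]/(L%:Z%:~R) ler_int.
have uL := BL' u uB; have [->|n1] := eqVneq e up; first by rewrite /levd lev_up lezD1.
have [->|n2] := eqVneq e dn.
  by rewrite /levd lev_dn; apply: ltW; apply: le_lt_trans uL; rewrite gerBl.
by rewrite /levd lev_other // ltW.
Qed.

(** With the kink at level -1, [pw] equals 1 wherever the walk leaves [B] and [1 - c] at the origin.
    Exits through the truncation carry a nonnegative value and are dropped. *)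
Lemma annealed_exit_bound : (forall x, (0 <= levd x) = (x \in B)) ->
  \sum_(y <- reach d N) z * (\sum_e G e y * ((y + unitv e) \notin B)%:R) <= 1 - c.
Proof.
move=> BL.
have h := @annealed_supermartingale (fun u => pw c (levd u - (-1))) (fun=> 0).
have {h} : z * \sum_(u <- reach d N) (0 + \sum_e G e u *
   (((u + unitv e) \notin B')%:R * pw c (levd (u + unitv e) - (-1)))) <= pw c (levd 0 - (-1)).
  apply: h => // [u _|u _]; first exact: (pw_ge0 _ c1).
  apply: (le_trans _ (pw_superharmonic (-1) u)).
  by rewrite !mulr_ge0 ?(ltW hc) // G0E sumr_ge0.
have -> : pw c (levd 0 - (-1)) = 1 - c by rewrite /levd lev0 /pw /= expr1.
apply: le_trans; rewrite -mulr_sumr ler_wpM2l //; apply: ler_sum => u _.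
rewrite add0r; apply: ler_sum => e _; apply: ler_wpM2l => //.
case: (boolP (u + unitv e \in B)) => uB; first by rewrite mulr_ge0 // (pw_ge0 _ c1).
have -> : u + unitv e \notin B'.
  by apply: contra uB => /set_mem[uB _]; apply/mem_set.
by rewrite /= mul1r pw_neg // opprK lezD1; move: uB; rewrite -BL -ltNge.
Qed.

End fixB.

End Annealed.

Lemma dotR_lev (R : realType) d (hd : (0 < d)%N) (x : Zd d) :
  dotR x (e1vec R d) = (lev hd x)%:~R.
Proof.
rewrite /dotR (bigD1 (Ordinal hd)) //= mxE /e1idx /= mulr1 big1 ?addr0 //.
move=> i /negP ni; rewrite mxE; case: ifP => [/eqP i0|_]; last by rewrite mulr0.
by case: ni; apply/eqP/val_inj.
Qed.

Lemma nneseries_le_sup (R : realType) (u : nat -> R) (C : R) : (forall n, 0 <= u n) ->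
  (forall k, \sum_(n < k) u n <= C) -> (\sum_(0 <= n <oo) (u n)%:E <= C%:E)%E.
Proof.
move=> u0 h; apply: lime_le; first by apply: is_cvg_nneseries => n _ _; rewrite lee_fin.
by apply: nearW => k; rewrite sumEFin lee_fin big_mkord.
Qed.

Lemma nneseries_ge_partial (R : realType) (u : nat -> R) k : (forall n, 0 <= u n) ->
  ((\sum_(n < k) u n)%:E <= \sum_(0 <= n <oo) (u n)%:E)%E.
Proof.
move=> u0; rewrite -sumEFin -(big_mkord xpredT (fun n => (u n)%:E)).
by apply: nneseries_lim_ge => n _ _; rewrite lee_fin.
Qed.

Lemma gz_le_green (R : realType) d (B : set (Zd d)) (w : env R d) z x y :
  0 <= z < 1 -> substoch w -> ((gz B w z x y)%:E <= green B x y w)%E.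
Proof.
move=> z01 hw; have /andP[z0 z1] := z01; rewrite greenE.
have hk n : 0 <= kill B w n x y by exact: kill_ge0.
have cv := @gz_is_cvg _ _ _ z01 B _ x y hw; rewrite /gz -EFin_lim //.
apply: lime_le.
  apply/cvg_ex; exists (limn (series (fun n => z ^+ n * kill B w n x y)))%:E.
  by apply: cvg_EFin; [exact: nearW | exact: cv].
apply: nearW => n /=; apply: le_trans (nneseries_ge_partial n hk).
rewrite lee_fin /series /= big_mkord; apply: ler_sum => k _.
by rewrite ler_piMl // exprn_ile1 // ltW.
Qed.

(** * Undiscounted bounds and Kalikow's condition *)

Section Consequences.
Context (R : realType) (d : nat) dT (T : measurableType dT) (P : probability T R).
Variable om : T -> env R d.
Hypothesis hd : (0 < d)%N.
Hypothesis hpv : prob_vectors om.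
Hypothesis hiid : iid_env P om.
Hypothesis heps : 0 < eps_env P om < 1.
Hypothesis hc : 0 < kalikow_const P om.
Let up := dir_up hd.
Let dn := dir_dn hd.
Let c := kalikow_const P om.
Let mom : forall x e, measurable_fun setT (fun t => om t x e) := iid_measurable hiid.
Let hss : forall t, substoch (om t) := prob_vectors_substoch hpv.
Let levd := lev hd.

Let ki B n x y : P.-integrable setT (EFin \o (fun t => kill B (om t) n x y)).
Proof.
apply: (@bounded_integrable _ _ _ _ _ 1); first exact: measurable_kill.
by move=> t; rewrite ger0_norm ?kill_ge0 ?kill_le1.
Qed.

Let si B n x : P.-integrable setT (EFin \o (fun t => surv B (om t) n x)).
Proof.
apply: (@bounded_integrable _ _ _ _ _ 1); first exact: measurable_surv.
by move=> t; rewrite ger0_norm ?surv_ge0 ?surv_le1.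
Qed.

Let omle1 t x e : om t x e <= 1.
Proof.
have [w0 w1] := hss t.
by rewrite (le_trans _ (w1 x)) // (bigD1 e) //= lerDl sumr_ge0.
Qed.

Let mulomi (f : T -> R) M x e : measurable_fun setT f -> (forall t, 0 <= f t <= M) ->
  P.-integrable setT (EFin \o (fun t => f t * om t x e)).
Proof.
move=> mf f0; apply: (@bounded_integrable _ _ _ _ _ (M * 1)); first exact: measurable_funM.
move=> t; have /andP[h0 h1] := f0 t; have o0 := (hss t).1 x e.
by rewrite ger0_norm ?mulr_ge0 // ler_pM.
Qed.

Let sum_kill_le_gz B z x y k (v : T -> R) : 0 <= z < 1 -> measurable_fun setT v ->
  (forall t, 0 <= v t <= 1) ->
  \sum_(n < k) z ^+ n * \int[P]_t (kill B (om t) n x y * v t) <=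
  \int[P]_t (gz B (om t) z x y * v t).
Proof.
move=> z01 mv v01; have /andP[z0 z1] := z01.
have kvi n : P.-integrable setT (EFin \o (fun t => kill B (om t) n x y * v t)).
  apply: (@bounded_integrable _ _ _ _ _ (1 * 1)).
    by apply: measurable_funM => //; exact: measurable_kill.
  move=> t; have /andP[h0 h1] := v01 t.
  by rewrite normrM ler_pM // ger0_norm ?kill_ge0 ?kill_le1.
have kvi' (n : nat) : P.-integrable setT (EFin \o (fun t => z ^+ n * (kill B (om t) n x y * v t))).
  by apply: (integrableZl _ (z ^+ n)) (kvi n).
under eq_bigr do rewrite -RintegralZl //.
rewrite -Rintegral_sum //; apply: le_Rintegral => //.
- exact: sum_integrable.
- apply: (@bounded_integrable _ _ _ _ _ ((1 - z)^-1 * 1)).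
    by apply: measurable_funM => //; exact: measurable_gz.
  move=> t; have /andP[h0 h1] := v01 t.
  by rewrite normrM ler_pM // ger0_norm ?gz_ge0 ?gz_le.
move=> t _; have /andP[h0 h1] := v01 t.
under eq_bigr do rewrite mulrA.
by rewrite -mulr_suml ler_wpM2r // gz_ge_partial.
Qed.

Let sum_kill_le_gz1 B z x y k : 0 <= z < 1 ->
  \sum_(n < k) z ^+ n * \int[P]_t kill B (om t) n x y <= \int[P]_t gz B (om t) z x y.
Proof.
move=> z01; have v1 (t : T) : 0 <= (1 : R) <= 1 by rewrite ler01 lexx.
have m1 : measurable_fun setT (fun _ : T => 1 : R) by exact: measurable_cst.
have := @sum_kill_le_gz B z x y k (fun=> 1) z01 m1 v1.
have -> : \int[P]_t (gz B (om t) z x y * 1) = \int[P]_t gz B (om t) z x y.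
  by apply: eq_Rintegral => t _; rewrite mulr1.
apply: le_trans; rewrite le_eqVlt; apply/orP; left; apply/eqP; apply: eq_bigr => n _.
by congr (_ * _); apply: eq_Rintegral => t _; rewrite mulr1.
Qed.

Let discount_sum (u : nat -> R) z k : 0 <= z < 1 -> (forall n, 0 <= u n) ->
  z ^+ k * \sum_(n < k) u n <= \sum_(n < k) z ^+ n * u n.
Proof.
move=> /andP[z0 z1] u0; rewrite mulr_sumr; apply: ler_sum => n _.
by apply: ler_wpM2r => //; apply: ler_wiXn2l => //; [exact: ltW | exact: ltnW].
Qed.

Lemma annealed_kill_sum B y k : B 0 ->
  \sum_(n < k) \int[P]_t kill B (om t) n 0 y <= (c * c)^-1.
Proof.
move=> B0; have cc : 0 < c * c by rewrite mulr_gt0.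
(* [k] powers of [z] pay for the discounted partial sum, one more for the factor [z] in
   [annealed_gz_bound]. *)
apply: (@abel_bound _ _ _ k.+1) => z /andP[z0 z1].
have z01 : 0 <= z < 1 by rewrite ltW.
rewrite -[leRHS]mul1r ler_pdivlMr // mulrC.
apply: le_trans (annealed_gz_bound hd hpv hiid heps hc k z01 B0 y).
rewrite -/c [leRHS]mulrCA ler_wpM2l ?(ltW cc) // exprS -mulrA ler_wpM2l ?(ltW z0) //.
have k0 n : 0 <= \int[P]_t kill B (om t) n 0 y.
  by apply: Rintegral_ge0 => t _; exact: kill_ge0.
apply: (le_trans (@discount_sum (fun n => \int[P]_t kill B (om t) n 0 y) z k z01 k0)).
apply: (le_trans _ (@sum_kill_le_gz1 (inreach B k) z 0 y k z01)); rewrite le_eqVlt; apply/orP; left; apply/eqP.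
apply: eq_bigr => n _; congr (_ * _); apply: eq_Rintegral => t _.
by rewrite (@kill_local _ _ B _ k n 0) ?inE // addn0 ltnW.
Qed.

Lemma annealed_time_sum (L k : nat) : (0 < L)%N ->
  \sum_(n < k) \int[P]_t surv [set x | levd x < L%:Z] (om t) n 0 <= L%:R / c.
Proof.
move=> L0; set B := [set x | levd x < L%:Z].
have B0 : B 0 by rewrite /B /= /levd lev0.
apply: (@abel_bound _ _ _ k.+1) => z /andP[z0 z1].
have z01 : 0 <= z < 1 by rewrite ltW.
rewrite ler_pdivlMr // mulrC.
apply: le_trans (annealed_time_bound hpv hiid heps k z01 B0 (fun x h => h)).
rewrite -/c [leRHS]mulrCA ler_wpM2l ?(ltW hc) // exprS -mulrA ler_wpM2l ?(ltW z0) //.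
have k0 n : 0 <= \int[P]_t surv B (om t) n 0.
  by apply: Rintegral_ge0 => t _; exact: surv_ge0.
apply: (le_trans (@discount_sum (fun n => \int[P]_t surv B (om t) n 0) z k z01 k0)).
have E (n : nat) : (n <= k)%N -> \int[P]_t surv B (om t) n 0 =
    \sum_(y <- reach d k) \int[P]_t kill (inreach B k) (om t) n 0 y.
  move=> nk; rewrite -Rintegral_sum //; apply: eq_Rintegral => t _.
  rewrite -(@surv_local _ _ B _ k n 0) ?inE ?addn0 //.
  by apply: surv_kill; [exact: reach_uniq | move=> y []].
under eq_bigr => n _ do rewrite E ?mulr_sumr 1?ltnW //.
rewrite exchange_big /=; apply: ler_sum => y _.
exact: sum_kill_le_gz1.
Qed.

Lemma annealed_surv_ge n :
  c <= \int[P]_t surv [set x | 0 <= levd x] (om t) n 0.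
Proof.
set B := [set x | 0 <= levd x].
have B0 : B 0 by rewrite /B /= /levd lev0.
have BL x : (0 <= levd x) = (x \in B).
  by apply/idP/idP => [h|/set_mem //]; exact/mem_set.
suff : 1 - \int[P]_t surv B (om t) n 0 <= 1 - c by lra.
apply: (@abel_bound _ _ _ n) => z /andP[z0 z1].
have z01 : 0 <= z < 1 by rewrite ltW.
apply: le_trans (annealed_exit_bound hpv hiid heps hc n z01 B0 BL).
have i1 y e : P.-integrable setT (EFin \o (fun t => gz (inreach B n) (om t) z 0 y * om t y e)).
  apply: (@mulomi _ ((1 - z)^-1)); first exact: measurable_gz.
  by move=> t; rewrite gz_ge0 ?gz_le.
have i2 y e : P.-integrable setT (EFin \o (fun t => (z * (y + unitv e \notin B)%:R) *
      (gz (inreach B n) (om t) z 0 y * om t y e))).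
  by apply: (integrableZl _ (z * (y + unitv e \notin B)%:R)) (i1 y e).
have -> : z ^+ n * (1 - \int[P]_t surv B (om t) n 0) =
    \int[P]_t (z ^+ n * (1 - surv B (om t) n 0)).
  rewrite RintegralZl //; last first.
    apply: (@bounded_integrable _ _ _ _ _ 1).
      by apply: measurable_funB; [exact: measurable_cst | exact: measurable_surv].
    move=> t; have := surv_ge0 B n 0 (hss t); have := surv_le1 B n 0 (hss t).
    by move=> h1 h2; rewrite ger0_norm; lra.
  rewrite RintegralB // ?Rintegral_cstT //.
  by apply: (@bounded_integrable _ _ _ _ _ 1) => [|t]; [exact: measurable_cst | rewrite normr1].
have -> : \sum_(y <- reach d n) z * (\sum_e (\int[P]_t (gz (inreach B n) (om t) z 0 y * om t y e)) *
    ((y + unitv e) \notin B)%:R) =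
  \int[P]_t \sum_(y <- reach d n) \sum_e ((z * (y + unitv e \notin B)%:R) *
      (gz (inreach B n) (om t) z 0 y * om t y e)).
  rewrite Rintegral_sum => [|y]; last exact: sum_integrable.
  apply: eq_bigr => y _; rewrite Rintegral_sum // mulr_sumr; apply: eq_bigr => e _.
  by rewrite RintegralZl // -mulrA [X in _ = _ * X]mulrC.
apply: le_Rintegral => //.
- apply: (@bounded_integrable _ _ _ _ _ (1 * 1)).
    apply: measurable_funM; first exact: measurable_cst.
    by apply: measurable_funB; [exact: measurable_cst | exact: measurable_surv].
  move=> t; have h1 := surv_ge0 B n 0 (hss t); have h2 := surv_le1 B n 0 (hss t).
  rewrite normrM ler_pM //.
    by rewrite ger0_norm ?exprn_ge0 ?exprn_ile1 // ltW.
  by rewrite ger0_norm; lra.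
- by apply: sum_integrable => y; exact: sum_integrable.
move=> t _.
have r0 : 0 \in reach d 0 by rewrite inE.
have nn : (n + 0 <= n)%N by rewrite addn0.
apply: (le_trans (exit_prob_le (hss t) (hpv.2 t) z01 r0 nn (mem_set B0))).
rewrite le_eqVlt; apply/orP; left; apply/eqP; apply: eq_bigr => y _.
by rewrite !mulr_sumr; apply: eq_bigr => e _; ring.
Qed.

Lemma elliptic_ae x : {ae P, forall t, forall e, (4 * d%:R)^-1 <= om t x e}.
Proof.
have d0 : 0 < d%:R :> R by rewrite ltr0n.
have [_ h2 _] := hiid.
have mA : measurable [set r : R | (4 * d%:R)^-1 <= r].
  rewrite [X in measurable X](_ : _ = `[(4 * d%:R)^-1, +oo[%classic) //.
  by apply/seteqP; split=> r /=; rewrite in_itv /= andbT.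
have mE y : measurable [set t | forall e, [set r : R | (4 * d%:R)^-1 <= r] (om t y e)].
  have := @measurable_rectangle R d _ T om [:: y] (fun _ _ => [set r : R | (4 * d%:R)^-1 <= r]) mom (fun _ _ => mA).
  congr measurable; apply/seteqP; split=> t /=; first by move=> h e; apply: h; rewrite inE.
  by move=> h u; rewrite inE => /eqP ->.
have h0 : {ae P, forall t, forall e, (4 * d%:R)^-1 <= om t 0 e}.
  apply: filterS (eps_env_ae hd heps) => t h e.
  have := h e; rewrite ler_norml => /andP[h1 _].
  have /andP[_ e1] := heps.
  have h3 : eps_env P om / (4 * d%:R) <= (4 * d%:R)^-1.
    by rewrite ler_pdivrMr ?mulr_gt0 // mulVf ?gt_eqF ?mulr_gt0 // ltW.
  have h4 : (2 * d%:R)^-1 = (4 * d%:R)^-1 + (4 * d%:R)^-1 :> R by field; rewrite gt_eqF.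
  by rewrite h4 in h1; lra.
have Z : P (~` [set t | forall e, [set r : R | (4 * d%:R)^-1 <= r] (om t 0 e)]) = 0%E.
  by apply/(negligibleP _ (measurableC (mE 0))); exact: h0.
apply/(negligibleP _ (measurableC (mE x))).
apply: (etrans (probability_setC P (mE x))).
by rewrite (h2 x (fun=> [set r : R | (4 * d%:R)^-1 <= r])) // -Z probability_setC.
Qed.

Lemma wt_elliptic_ae x s : {ae P, forall t, (4 * d%:R)^-1 ^+ size s <= wt (om t) x s}.
Proof.
have d0 : 0 <= (4 * d%:R)^-1 :> R by rewrite invr_ge0 mulr_ge0.
elim: s x => [|e s IH] x /=; first by apply: aeW => t; rewrite expr0.
apply: filterS2 (elliptic_ae x) (IH (x + unitv e)) => t h1 h2.
by rewrite exprS ler_pM // exprn_ge0.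
Qed.

(** A single path inside [B] from 0 to [y] has weight at least (4d)^(-n) almost surely. This makes
    the denominator of Kalikow's environment positive, so that its division is a genuine one. *)
Lemma annealed_kill_gt0 B y : nn_connected B -> B 0 -> B y ->
  exists n, 0 < \int[P]_t kill B (om t) n 0 y.
Proof.
move=> cB B0 By; have [n [s [sB sy]]] := cB 0 y B0 By; exists n.
have d0 : 0 < (4 * d%:R)^-1 :> R by rewrite invr_gt0 mulr_gt0 // ltr0n.
have [g gK1 gK2] := ffun_tuple_bij d n; pose u := g s.
have us : ffun_tuple u = s by rewrite gK2.
have hu : inside B 0 u && (endpt 0 u == y).
  rewrite -inside_ffun_tuple us; apply/andP; split.
    by apply/forallP => k; apply/mem_set.
  by rewrite -sy -us pos_ffun_tuple take_oversize // size_tuple.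
apply: (lt_le_trans (exprn_gt0 n d0)); rewrite -subr_ge0.
have ci : P.-integrable setT (EFin \o (fun _ : T => (4 * d%:R)^-1 ^+ n : R)).
  apply: (@bounded_integrable _ _ _ _ _ `|(4 * d%:R)^-1 ^+ n|) => [|t //].
  exact: measurable_cst.
rewrite -[X in _ - X](Rintegral_cstT P) -RintegralB //.
apply: Rintegral_ae_ge0; first exact: (integrableB _ (ki B n 0 y) ci).
apply: filterS (wt_elliptic_ae 0 u) => t; rewrite size_tuple subr_ge0 => h.
apply: (le_trans h); rewrite -killE (bigD1 u) //= lerDl sumr_ge0 // => *.
exact: wt_ge0.
Qed.

Lemma kalikow_env_drift B y : nn_connected B -> B 0 -> B y ->
  c <= kalikow_env P om B 0 y up - kalikow_env P om B 0 y dn.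
Proof.
move=> cB B0 By.
pose k n := \int[P]_t kill B (om t) n 0 y.
pose ke e n := \int[P]_t (kill B (om t) n 0 y * om t y e).
have kei n e : P.-integrable setT (EFin \o (fun t => kill B (om t) n 0 y * om t y e)).
  apply: (@mulomi _ 1); first exact: measurable_kill.
  by move=> t; rewrite kill_ge0 ?kill_le1.
have k0 n : 0 <= k n by apply: Rintegral_ge0 => t _; exact: kill_ge0.
have ke0 e n : 0 <= ke e n.
  by apply: Rintegral_ge0 => t _; rewrite mulr_ge0 ?kill_ge0 ?(hss t).1.
have kele e n : ke e n <= k n.
  apply: le_Rintegral => // t _; rewrite ler_piMr ?kill_ge0 //.
have IE : (\int[P]_t green B 0%R y (om t) = \sum_(0 <= n <oo) (k n)%:E)%E.
  under eq_integral do rewrite greenE.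
  rewrite integral_nneseries //.
  - by apply: eq_eseriesr => n _; rewrite RintegralE.
  - by move=> n; apply/measurable_EFinP; exact: measurable_kill.
  - by move=> n t _; rewrite lee_fin kill_ge0.
have IEe e : (\int[P]_t (green B 0%R y (om t) * (om t y e)%:E) = \sum_(0 <= n <oo) (ke e n)%:E)%E.
  under eq_integral => t _.
    rewrite greenE muleC -nneseriesZl //; last by move=> n _; rewrite lee_fin kill_ge0.
    over.
  rewrite integral_nneseries //.
  - apply: eq_eseriesr => n _; rewrite -RintegralE //.
    by apply: eq_integral => t _; rewrite -EFinM mulrC.
  - move=> n; under eq_fun do rewrite -EFinM.
    by apply/measurable_EFinP; apply: measurable_funM => //; exact: measurable_kill.
  - by move=> n t _; rewrite -EFinM lee_fin mulr_ge0 ?kill_ge0 ?(hss t).1.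
have Sle : (\sum_(0 <= n <oo) (k n)%:E <= ((c * c)^-1)%:E)%E.
  by apply: nneseries_le_sup => // K; exact: annealed_kill_sum.
have Sele e : (\sum_(0 <= n <oo) (ke e n)%:E <= ((c * c)^-1)%:E)%E.
  apply: (le_trans _ Sle); apply: lee_nneseries => n _ *; rewrite lee_fin //.
have fin u : (forall n, 0 <= u n) -> (\sum_(0 <= n <oo) (u n)%:E <= ((c * c)^-1)%:E)%E ->
    (\sum_(0 <= n <oo) (u n)%:E)%E \is a fin_num.
  move=> u0 h; rewrite ge0_fin_numE; first exact: le_lt_trans h (ltry _).
  by apply: nneseries_ge0 => n _ _; rewrite lee_fin.
pose S := fine (\sum_(0 <= n <oo) (k n)%:E)%E.
pose Se e := fine (\sum_(0 <= n <oo) (ke e n)%:E)%E.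
have SE : (\sum_(0 <= n <oo) (k n)%:E)%E = S%:E by rewrite /S fineK //; exact: fin.
have SeE e : (\sum_(0 <= n <oo) (ke e n)%:E)%E = (Se e)%:E by rewrite /Se fineK //; exact: fin.
have S0 : 0 < S.
  have [n kn] := annealed_kill_gt0 cB B0 By; apply: (lt_le_trans kn).
  have := nneseries_ge_partial n.+1 k0; rewrite SE lee_fin; apply: le_trans.
  by rewrite big_ord_recr /= lerDr sumr_ge0.
(* With the downward term moved to the left, every term is nonnegative. The left side is then
   approached by discounted partial sums and the right side dominates through [gz <= green], so no
   limit of a difference is taken. *)
have part K : \sum_(n < K) (ke dn n + c * k n) <= Se up.
  apply: (@abel_bound _ _ _ K) => z /andP[z0 z1].
  have z01 : 0 <= z < 1 by rewrite ltW.
  have yB : y \in B by exact/mem_set.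
  have gei e : P.-integrable setT (EFin \o (fun t => gz B (om t) z 0 y * om t y e)).
    apply: (@mulomi _ ((1 - z)^-1)); first exact: measurable_gz.
    by move=> t; rewrite gz_ge0 ?gz_le.
  have h1 := gz_drift_ge hd hpv hiid heps 0 z01 yB.
  have h2 : \int[P]_t (gz B (om t) z 0 y * (om t y up - om t y dn)) =
     \int[P]_t (gz B (om t) z 0 y * om t y up) - \int[P]_t (gz B (om t) z 0 y * om t y dn).
    by rewrite -RintegralB //; apply: eq_Rintegral => t _; rewrite mulrBr.
  have h3 : \int[P]_t (gz B (om t) z 0 y * om t y up) <= Se up.
    rewrite -lee_fin -SeE -IEe -RintegralE //; apply: ge0_le_integral => //.
    - by move=> t _; rewrite lee_fin mulr_ge0 ?gz_ge0 ?(hss t).1.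
    - by apply/measurable_EFinP; apply: measurable_funM => //; exact: measurable_gz.
    - apply: emeasurable_funM; last exact/measurable_EFinP.
      under eq_fun do rewrite greenE.
      apply: ge0_emeasurable_sum => n *; first by rewrite lee_fin kill_ge0.
      by apply/measurable_EFinP; exact: measurable_kill.
    - move=> t _; rewrite EFinM lee_wpmul2r ?gz_le_green // lee_fin; exact: (hss t).1.
  have om01 t : 0 <= om t y dn <= 1 by rewrite omle1 (hss t).1.
  have h4 := @sum_kill_le_gz B z 0 y K (fun t => om t y dn) z01 (mom y dn) om01.
  have h6 : \sum_(n < K) z ^+ n * k n <= \int[P]_t gz B (om t) z 0 y.
    exact: sum_kill_le_gz1.
  have u0 n : 0 <= ke dn n + c * k n by rewrite addr_ge0 ?mulr_ge0 ?(ltW hc).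
  apply: (le_trans (@discount_sum _ z K z01 u0)).
  under eq_bigr do rewrite mulrDr mulrCA.
  rewrite big_split /= -mulr_sumr.
  have := ler_wpM2l (ltW hc) h6; rewrite -/c.
  move: h1 h4; rewrite h2 -/c -/up -/dn; lra.
have fin_ineq : Se dn + c * S <= Se up.
  have u0 n : 0 <= ke dn n + c * k n by rewrite addr_ge0 ?mulr_ge0 ?(ltW hc).
  rewrite -lee_fin; apply: le_trans (nneseries_le_sup u0 part).
  rewrite EFinD EFinM -SE -SeE.
  rewrite -nneseriesZl ?lee_fin ?(ltW hc) //; last by move=> n _; rewrite lee_fin.
  rewrite -nneseriesD //.
  - by move=> n _ _; rewrite lee_fin.
  - by move=> n _ _; rewrite -EFinM lee_fin mulr_ge0 ?(ltW hc).
rewrite /kalikow_env IE !IEe SE !SeE /= -mulrBl ler_pdivlMr //.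
lra.
Qed.

Lemma kalikow_condition_e1 : kalikow_condition P om (e1vec R d).
Proof.
rewrite /kalikow_condition; apply: (lt_le_trans hc); apply: lb_le_inf.
  (* [lb_le_inf] requires a nonempty set. The singleton {0} is connected by the empty path and is
     proper because it misses e_1. *)
  exists (kalikow_drift_dot P om [set 0] 0 0 (e1vec R d)), [set 0], 0; split => //.
  - move=> x y -> ->; exists 0%N, [ffun=> up]; split=> [k|]; by rewrite /pos /= big_ord0 addr0.
  - move=> /seteqP[_ /(_ (unitv up) I)] /= /(congr1 levd).
    by rewrite -[unitv up]add0r /levd lev_up lev0.
move=> _ [B [y [cB _ B0 By ->]]].
rewrite /kalikow_drift_dot (sum_updn (hd := hd)); last first.
  move=> e h1 h2; rewrite (dotR_lev R hd) -[unitv e]add0r lev_other // lev0.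
  by rewrite mulr0.
rewrite !(dotR_lev R hd) -[unitv _]add0r -[unitv (dir_dn hd)]add0r lev_up lev_dn lev0.
rewrite add0r sub0r mulr1 mulrN1; exact: kalikow_env_drift.
Qed.

End Consequences.

(** * Regeneration levels of integer paths *)

HB.instance Definition _ := isPointed.Build int 0.

Section PathSpace.

Definition determined (n : nat) (A : set (nat -> int)) :=
  forall y y', (forall k, (k <= n)%N -> y k = y' k) -> A y -> A y'.

(** Arbitrary sets determined by a finite prefix are taken as generators. There are countably many
    integer prefixes, so this is still the product sigma-algebra, and measurability of prefix events
    is immediate. *)
Definition cylinders : set (set (nat -> int)) := [set A | exists n, determined n A].

Definition path_space : measurableType cylinders.-sigma := g_sigma_algebraType cylinders.

Lemma determined_le n m A : (n <= m)%N -> determined n A -> determined m A.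
Proof.
move=> nm dA y y' h; apply: dA => k kn; apply: h; exact: leq_trans nm.
Qed.

Lemma determinedI n A B : determined n A -> determined n B -> determined n (A `&` B).
Proof. by move=> dA dB y y' h [Ay By]; split; [exact: dA Ay | exact: dB By]. Qed.

Lemma cylinders_setI : setI_closed cylinders.
Proof.
move=> A B [n dA] [m dB]; exists (maxn n m); apply: determinedI.
  by apply: determined_le dA; exact: leq_maxl.
by apply: determined_le dB; exact: leq_maxr.
Qed.

Lemma determined_measurable n A : determined n A -> measurable (A : set path_space).
Proof. by move=> dA; apply: sub_sigma_algebra; exists n. Qed.

Definition hit (i n : nat) : set path_space := [set y | y n = i%:Z /\ forall k, (k < n)%N -> y k < i%:Z].
Definition sh (n i : nat) (y : path_space) : path_space := fun k => y (n + k)%N - i%:Z.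
Definition stay_upto (m : nat) : set path_space := [set y | forall k, (k <= m)%N -> 0 <= y k].
Definition stay : set path_space := [set y | forall k, 0 <= y k].
Definition below (L n : nat) : set path_space := [set y | forall k, (k <= n)%N -> y k < L%:Z].
Definition reg (j : nat) : set path_space :=
  [set y | exists2 n, hit j n y & forall k, (n <= k)%N -> j%:Z <= y k].

Lemma determined_hit i n : determined n (hit i n).
Proof.
move=> y y' h [h1 h2]; split=> [|k kn]; first by rewrite -h.
by rewrite -h ?h2 // ltnW.
Qed.

Lemma determined_stay_upto m : determined m (stay_upto m).
Proof. by move=> y y' h hy k km; rewrite -h // hy. Qed.

Lemma determined_below L n : determined n (below L n).
Proof. by move=> y y' h hy k km; rewrite -h // hy. Qed.

Lemma determined_sh n i m A : determined m A -> determined (n + m)%N (sh n i @^-1` A).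
Proof.
move=> dA y y' h; apply: dA => k km; rewrite /sh h // leq_add2l //.
Qed.

Lemma measurable_hit i n : measurable (hit i n).
Proof. exact: determined_measurable (@determined_hit i n). Qed.

Lemma measurable_stay_upto m : measurable (stay_upto m).
Proof. exact: determined_measurable (@determined_stay_upto m). Qed.

Lemma measurable_below L n : measurable (below L n).
Proof. exact: determined_measurable (@determined_below L n). Qed.

Lemma stayE : stay = \bigcap_m stay_upto m.
Proof.
by apply/seteqP; split=> y h => [m _ k _|k]; [exact: h | exact: (h k I k)].
Qed.

Lemma measurable_stay : measurable stay.
Proof. by rewrite stayE; apply: bigcapT_measurable => m; exact: measurable_stay_upto. Qed.

Lemma measurable_sh n i : measurable_fun setT (sh n i).
Proof.
apply: measurability => // _ [A [m dA] <-]; rewrite setTI.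
exact: determined_measurable (@determined_sh n i m A dA).
Qed.

Lemma measurable_sh_preimage n i A : measurable A -> measurable (sh n i @^-1` A).
Proof. by move=> mA; rewrite -[X in measurable X]setTI; exact: measurable_sh. Qed.

Lemma regE j : reg j = \bigcup_n (hit j n `&` sh n j @^-1` stay).
Proof.
apply/seteqP; split=> y.
  by move=> [n hn h]; exists n => //; split=> // k; rewrite /sh subr_ge0 h // leq_addr.
move=> [n _ [hn h]]; exists n => // k nk.
by have := h (k - n)%N; rewrite /sh subr_ge0 subnKC.
Qed.

Lemma measurable_reg j : measurable (reg j).
Proof.
rewrite regE; apply: bigcupT_measurable => n; apply: measurableI; first exact: measurable_hit.
exact: measurable_sh_preimage measurable_stay.
Qed.

Lemma hit_uniq i n n' y : hit i n y -> hit i n' y -> n = n'.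
Proof.
move=> [e h] [e' h']; case: (ltngtP n n') => // l.
  by have := h' _ l; rewrite e ltxx.
by have := h _ l; rewrite e' ltxx.
Qed.

Lemma hit_ltn i j n m y : (i < j)%N -> hit i n y -> hit j m y -> (n < m)%N.
Proof.
move=> ij [e h] [e' h']; rewrite ltnNge leq_eqVlt; apply/negP => /orP[/eqP mn|mn].
  by move: e; rewrite -mn e' => -[ji]; rewrite ji ltnn in ij.
by have := h _ mn; rewrite e' ltz_nat ltnNge ltnW.
Qed.

Lemma hit_sh i j n m y : hit i n y -> hit j m (sh n i y) <-> hit (i + j) (n + m) y.
Proof.
move=> [e h]; rewrite /hit /sh /=; split=> -[e' h'].
  split=> [|k km]; first by rewrite PoszD -e'; ring.
  case: (ltnP k n) => kn; first by rewrite (lt_le_trans (h _ kn)) // lez_nat leq_addr.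
  have := h' (k - n)%N; rewrite subnKC // ltrBlDl PoszD; apply.
  by rewrite ltn_subLR.
split=> [|k km]; first by rewrite e' PoszD; ring.
by rewrite ltrBlDl -PoszD h' // ltn_add2l.
Qed.

Lemma hit_shE i j n y m : hit i n y -> hit (i + j) m y -> exists2 m', m = (n + m')%N & hit j m' (sh n i y).
Proof.
move=> hn hm; have nm : (n <= m)%N.
  case: j hm => [|j] hm; first by rewrite addn0 in hm; rewrite (hit_uniq hn hm).
  by apply: ltnW; apply: hit_ltn hn hm; rewrite addnS ltnS leq_addr.
by exists (m - n)%N; [rewrite subnKC | apply/hit_sh => //; rewrite subnKC].
Qed.

(** Regeneration at a level not below [i] concerns only the path after the first visit to [i], so it
    can be read off the shifted path even if that path later falls below [i]. *)
Lemma reg_sh i j n y : hit i n y -> reg j (sh n i y) <-> reg (i + j) y.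
Proof.
move=> hn; split=> -[m hm h].
  exists (n + m)%N; first exact/hit_sh.
  move=> k km; have nk : (n <= k)%N by apply: leq_trans km; exact: leq_addr.
  have := h (k - n)%N; rewrite /sh subnKC // lerBrDl PoszD; apply.
  by rewrite leq_subRL.
have [m' mE hm'] := hit_shE hn hm; exists m' => // k mk.
by rewrite /sh lerBrDl -PoszD h // mE leq_add2l.
Qed.

End PathSpace.

(** * From prefix events to full independence at a first visit *)

Section Renewal.
Context (R : realType) (Q : probability path_space R).
Hypothesis renewal : forall i n m (F A : set path_space),
  determined n F -> F `<=` hit i n -> determined m A -> A `<=` stay_upto m ->
  Q (F `&` sh n i @^-1` A) = (Q F * Q A)%E.

(** The hypothesis [renewal] sees only finite horizons. Staying nonnegative forever is the
    decreasing limit of [stay_upto (m + k)], and both sides are continuous along it. *)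
Lemma renewal_stay_determined i n m (F A : set path_space) :
  determined n F -> F `<=` hit i n -> determined m A ->
  Q (F `&` sh n i @^-1` (stay `&` A)) = (Q F * Q (stay `&` A))%E.
Proof.
move=> dF Fh dA.
pose A_ k := A `&` stay_upto (m + k).
have dA_ k : determined (m + k)%N (A_ k).
  by apply: determinedI; [apply: determined_le dA; exact: leq_addr | exact: determined_stay_upto].
have mA_ k : measurable (A_ k) := determined_measurable (dA_ k).
have mF : measurable F := determined_measurable dF.
have AE : stay `&` A = \bigcap_k A_ k.
  apply/seteqP; split=> y.
    by move=> [sy Ay] k _; split=> // l _; exact: sy.
  move=> h; split; last by case: (h 0%N I).
  by move=> k; have [_] := h k I; apply; exact: leq_addl.
have ndA k l : (k <= l)%N -> A_ l `<=` A_ k.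
  move=> kl y [Ay sy]; split=> // j jm; apply: sy; apply: (leq_trans jm).
  by rewrite leq_add2l.
have c1 : (fun k => Q (A_ k)) @ \oo --> Q (stay `&` A).
  rewrite AE; apply: nonincreasing_cvg_mu => //.
  - by apply: (le_lt_trans (probability_le1 _ _)) => //; exact: ltry.
  - by apply: bigcapT_measurable.
  - by move=> k l kl; apply/subsetPset; exact: ndA.
have c2 : (fun k => Q (F `&` sh n i @^-1` A_ k)) @ \oo --> Q (F `&` sh n i @^-1` (stay `&` A)).
  have mk k : measurable (F `&` sh n i @^-1` A_ k).
    by apply: measurableI => //; exact: measurable_sh_preimage.
  have E : F `&` sh n i @^-1` (stay `&` A) = \bigcap_k (F `&` sh n i @^-1` A_ k).
    rewrite AE; apply/seteqP; split=> y.
      by move=> [Fy h] k _; split=> //; exact: h.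
    by move=> h; split; [case: (h 0%N I) | move=> k _; case: (h k I)].
  rewrite E; apply: nonincreasing_cvg_mu => //.
  - by apply: (le_lt_trans (probability_le1 _ _)) => //; exact: ltry.
  - by apply: bigcapT_measurable.
  - by move=> k l kl; apply/subsetPset => y [Fy h]; split=> //; exact: ndA h.
have QF : Q F \is a fin_num by exact: fin_num_measure.
apply: (cvg_unique _ c2) => //.
rewrite (_ : (fun k => _) = fun k => (Q F * Q (A_ k))%E); last first.
  by apply/funext => k; apply: (renewal dF Fh (dA_ k)) => y [].
by apply: cvgeZl.
Qed.

(** Dynkin's pi-lambda argument over [A]. Complements are taken relative to [stay], so the case of
    the whole space, proved first, is what makes the class stable. *)
Lemma renewal_stay i n (F A : set path_space) :
  determined n F -> F `<=` hit i n -> measurable A ->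
  Q (F `&` sh n i @^-1` (stay `&` A)) = (Q F * Q (stay `&` A))%E.
Proof.
move=> dF Fh mA.
have mF : measurable F := determined_measurable dF.
have mFs B : measurable B -> measurable (F `&` sh n i @^-1` (stay `&` B)).
  move=> mB; apply: measurableI => //; apply: measurable_sh_preimage.
  by apply: measurableI => //; exact: measurable_stay.
have mS B : measurable B -> measurable (stay `&` B).
  by move=> mB; apply: measurableI => //; exact: measurable_stay.
have QF : Q F \is a fin_num by exact: fin_num_measure.
pose Pr (B : set path_space) := Q (F `&` sh n i @^-1` (stay `&` B)) = (Q F * Q (stay `&` B))%E.
have PrT : Pr setT.
  by apply: (@renewal_stay_determined i n 0 F setT) => // y y' _ [].
apply: (@dynkin_induction _ path_space cylinders Pr) => //.
- exact: cylinders_setI.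
- by move=> B [m dB]; exact: (renewal_stay_determined dF Fh dB).
- move=> S mS' PS.
  have mC : measurable (~` S) by exact: measurableC.
  have D1 : (Q (F `&` sh n i @^-1` (stay `&` setT)) =
     Q (F `&` sh n i @^-1` (stay `&` S)) + Q (F `&` sh n i @^-1` (stay `&` ~` S)))%E.
    rewrite -measureU; [|exact: mFs..|].
      congr (Q _); apply/seteqP; split=> y.
        by move=> [Fy [sy _]]; case: (pselect (S (sh n i y))) => h; [left | right].
      by move=> [] [Fy [sy _]].
    by apply/seteqP; split=> y // -[[_ [_ h]] [_ [_ /(_ h)]]].
  have D2 : (Q (stay `&` setT) = Q (stay `&` S) + Q (stay `&` ~` S))%E.
    rewrite -measureU; [|exact: mS..|].
      congr (Q _); apply/seteqP; split=> y.
        by move=> [sy _]; case: (pselect (S y)) => h; [left | right].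
      by move=> [] [sy _].
    by apply/seteqP; split=> y // -[[_ h] [_ /(_ h)]].
  have f1 : Q (F `&` sh n i @^-1` (stay `&` S)) \is a fin_num.
    by apply: fin_num_measure; exact: mFs.
  move: PrT; rewrite /Pr D1 D2 PS ge0_muleDr //.
  have f2 : (Q F * Q (stay `&` S))%E \is a fin_num by rewrite -PS.
  by move=> /(congr1 (fun u => u - Q F * Q (stay `&` S))%E); rewrite addeAC subee // add0e addeAC subee // add0e.
- move=> G mG tG PG; rewrite /Pr.
  rewrite (_ : F `&` _ = \bigcup_k (F `&` sh n i @^-1` (stay `&` G k))); last first.
    apply/seteqP; split=> y.
      by move=> [Fy [sy [k _ Gy]]]; exists k.
    by move=> [k _ [Fy [sy Gy]]]; split=> //; split=> //; exists k.
  rewrite measure_bigcup //; last 2 first.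
  - by move=> k _; exact: mFs.
  - apply/trivIsetP => k l _ _ kl; apply/seteqP; split=> y // -[[_ [_ h1]] [_ [_ h2]]].
    by move/trivIsetP: tG => /(_ k l I I kl) /seteqP[/(_ (sh n i y) (conj h1 h2))].
  rewrite setI_bigcupr measure_bigcup //; last 2 first.
  - by move=> k _; exact: mS.
  - apply/trivIsetP => k l _ _ kl; apply/seteqP; split=> y // -[[_ h1] [_ h2]].
    by move/trivIsetP: tG => /(_ k l I I kl) /seteqP[/(_ y (conj h1 h2))].
  rewrite -(fineK QF) -nneseriesZl //; apply: eq_eseriesr => k _.
  by rewrite fineK //; exact: PG.
Qed.

(* Regeneration identity: after the first visit to level [i], on the event of never going
   below [i] the walk only sees fresh environment. *)
Lemma renewal_level i (F : nat -> set path_space) (A : set path_space) :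
  (forall n, determined n (F n)) -> (forall n, F n `<=` hit i n) -> measurable A ->
  Q (\bigcup_n (F n `&` sh n i @^-1` (stay `&` A))) = (Q (\bigcup_n F n) * Q (stay `&` A))%E.
Proof.
move=> dF Fh mA.
have mF n : measurable (F n) := determined_measurable (dF n).
have mS : measurable (stay `&` A) by apply: measurableI => //; exact: measurable_stay.
have QS : Q (stay `&` A) \is a fin_num by exact: fin_num_measure.
have tF : trivIset setT F.
  apply/trivIsetP => k l _ _ kl; apply/seteqP; split=> y // -[/Fh h1 /Fh h2].
  by move: kl; rewrite (hit_uniq h1 h2) eqxx.
rewrite !measure_bigcup //; last 2 first.
- by move=> n _; apply: measurableI => //; exact: measurable_sh_preimage.
- apply/trivIsetP => k l _ _ kl; apply/seteqP; split=> y // -[[h1 _] [h2 _]].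
  by move/trivIsetP: tF => /(_ k l I I kl) /seteqP[/(_ y (conj h1 h2))].
rewrite -(fineK QS) muleC -nneseriesZl //; apply: eq_eseriesr => n _.
by rewrite fineK // muleC; exact: renewal_stay.
Qed.

End Renewal.

(** * Pathwise estimates on regeneration levels *)

Section Counting.

Definition cnt (n : nat) (y : path_space) : nat := (\sum_(j < n) (y \in reg j))%N.

Definition full : set path_space := [set y | forall i, exists n, hit i n y].

(** The bound [M] on the window length makes windows that start below [N] end by [N + M], so a
    covering overshoots by a bounded amount. It disappears in the increasing union over [M]. *)
Definition bad (a M : nat) : set path_space := [set y | exists n, [/\ (0 < n)%N, (n <= M)%N &
  exists2 t, hit n t y & (a * cnt n y < t)%N]].

Definition bad_at (a M i : nat) : set path_space :=
  \bigcup_n (hit i n `&` sh n i @^-1` (stay `&` bad a M)).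

Lemma cnt_sh i n t y : hit i t y -> cnt n (sh t i y) = (\sum_(j < n) (y \in reg (i + j)))%N.
Proof.
move=> ht; rewrite /cnt; apply: eq_bigr => j _; congr nat_of_bool.
by apply/idP/idP => /set_mem h; apply/mem_set/(reg_sh _ ht).
Qed.

Lemma measurable_cnt_lt a n t : measurable [set y : path_space | (a * cnt n y < t)%N].
Proof.
have mf : measurable_fun [set: path_space] (cnt n).
  rewrite /cnt; elim: n => [|n IH].
    by under eq_fun do rewrite big_ord0; exact: measurable_cst.
  under eq_fun do rewrite big_ord_recr /=.
  apply: measurable_fun_addn => //.
  move=> _ Y _; rewrite setTI.
  have mr := measurable_reg n.
  have mi (C : Prop) : measurable (if pselect C then setT else set0 : set path_space).
    by case: (pselect C) => ?; [exact: measurableT | exact: measurable0].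
  rewrite [X in measurable X](_ : _ = (reg n `&` (if pselect (Y 1%N) then setT else set0)) `|`
     (~` reg n `&` (if pselect (Y 0%N) then setT else set0))).
    by apply: measurableU; apply: measurableI => //; exact: measurableC.
  apply/seteqP; split=> y /=.
    case: (boolP (y \in reg n)) => h Yh.
      by left; split; [exact: set_mem | case: pselect].
    by right; split; [move/mem_set; apply/negP | case: pselect].
  move=> [] [h].
    by rewrite (mem_set h); case: pselect.
  by rewrite (memNset h); case: pselect.
by have := mf measurableT [set c | (a * c < t)%N]; rewrite setTI; exact.
Qed.

Lemma measurable_bad a M : measurable (bad a M).
Proof.
rewrite [X in measurable X](_ : _ = \bigcup_n \bigcup_t
  ((if (0 < n <= M)%N then setT else set0) `&` (hit n t `&` [set y | (a * cnt n y < t)%N]))).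
  apply: bigcupT_measurable => n; apply: bigcupT_measurable => t.
  apply: measurableI; first by case: ifP.
  by apply: measurableI; [exact: measurable_hit | exact: measurable_cnt_lt].
apply/seteqP; split=> y.
  by move=> [n [n0 nM [t ht hc]]]; exists n => //; exists t => //; rewrite n0 nM.
move=> [n _ [t _ [h [ht hc]]]]; exists n.
by move: h; case: ifP => // /andP[n0 nM] _; split=> //; exists t.
Qed.

Lemma measurable_full : measurable full.
Proof.
rewrite [X in measurable X](_ : _ = \bigcap_i \bigcup_n hit i n).
  by apply: bigcapT_measurable => i; apply: bigcupT_measurable => n; exact: measurable_hit.
apply/seteqP; split=> y h i; first by move=> _; have [n hn] := h i; exists n.
by have [n _ hn] := h i I; exists n.
Qed.

Lemma measurable_bad_at a M i : measurable (bad_at a M i).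
Proof.
apply: bigcupT_measurable => n; apply: measurableI; first exact: measurable_hit.
apply: measurable_sh_preimage; apply: measurableI; first exact: measurable_stay.
exact: measurable_bad.
Qed.

(* Cover the bad levels greedily by disjoint windows [s, s + n) witnessing badness of [s]: bad
   levels are regeneration levels, so a window holds at most [cnt] of them, which by badness is
   less than its crossing time divided by [a]. *)
Lemma bad_covering (a M N : nat) (y : path_space) (tau : nat -> nat) :
  (forall i, hit i (tau i) y) ->
  (a * \sum_(i < N) (y \in bad_at a M i) <= tau (N + M))%N.
Proof.
move=> htau.
have mono i j : (i <= j)%N -> (tau i <= tau j)%N.
  by rewrite leq_eqVlt => /orP[/eqP -> //|ij]; apply: ltnW; exact: hit_ltn ij (htau i) (htau j).
have badP i : y \in bad_at a M i -> y \in reg i /\ exists n, [/\ (0 < n)%N, (n <= M)%N &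
    (a * \sum_(j < n) (y \in reg (i + j)) < tau (i + n) - tau i)%N].
  move=> /set_mem[t _ [ht [st [n [n0 nM [t' ht' hc]]]]]].
  split; first by apply/mem_set; rewrite regE; exists t.
  exists n; split=> //; rewrite -(cnt_sh _ ht).
  have <- := hit_uniq ht (htau i).
  have <- : (t + t')%N = tau (i + n)%N by apply: hit_uniq (htau _); exact/hit_sh.
  by rewrite addKn.
have arith (p q r u v : nat) : (p <= q)%N -> (q <= r)%N -> (u <= q - p)%N -> (v <= r - q)%N ->
    (u + v <= r - p)%N by lia.
have key k : forall s, (N - s <= k)%N ->
    (a * \sum_(s <= i < N) (y \in bad_at a M i) <= tau (N + M) - tau s)%N.
  elim: k => [|k IH] s hs.
    by rewrite big_geq ?muln0 // -subn_eq0 -leqn0.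
  case: (leqP N s) => sN; first by rewrite big_geq ?muln0.
  have sub (r1 r2 r3 : nat) : (r1 <= r2)%N -> (r2 <= r3)%N -> (r3 - r2 <= r3 - r1)%N by lia.
  have sM : (tau s <= tau (N + M))%N by apply: mono; lia.
  case: (boolP (y \in bad_at a M s)) => sb; last first.
    rewrite big_ltn // (negbTE sb) add0n; apply: (leq_trans (IH s.+1 _)); first lia.
    by apply: sub; apply: mono; lia.
  have [_ [n [n0 nM hc]]] := badP s sb.
  have le1 r (m : nat) : (\sum_(r <= i < r + m) (y \in bad_at a M i) <= \sum_(j < m) (y \in reg (r + j)))%N.
    rewrite -{1}[r]add0n [(r + m)%N]addnC big_addn addnK big_mkord; apply: leq_sum => j _.
    rewrite addnC; case: (boolP (y \in bad_at a M (r + j))) => // h.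
    by have [-> _] := badP _ h.
  have snM : (tau (s + n) <= tau (N + M))%N by apply: mono; lia.
  have sn : (tau s <= tau (s + n))%N by apply: mono; lia.
  case: (leqP (s + n) N) => snN.
    rewrite (@big_cat_nat _ _ _ (s + n)%N s N) //=; last lia.
    rewrite mulnDr.
    have h1 : (a * \sum_(s <= i < s + n) (y \in bad_at a M i) <= tau (s + n) - tau s)%N.
      by apply: (leq_trans _ (ltnW hc)); rewrite leq_mul2l le1 orbT.
    have h2 : (a * \sum_(s + n <= i < N) (y \in bad_at a M i) <= tau (N + M) - tau (s + n))%N.
      by apply: IH; lia.
    exact: arith sn snM h1 h2.
  have h1 : (\sum_(s <= i < N) (y \in bad_at a M i) <= \sum_(s <= i < s + n) (y \in bad_at a M i))%N.
    by rewrite (@big_cat_nat _ _ _ N s (s + n)%N) //= ?leq_addr //; lia.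
  apply: (@leq_trans (a * \sum_(j < n) (y \in reg (s + j)))).
    by rewrite leq_mul2l (leq_trans h1) ?le1 ?orbT.
  apply: (leq_trans (ltnW hc)); exact: leq_sub2r.
have := key N 0%N (leq_subr _ _); rewrite big_mkord => h; apply: (leq_trans h).
exact: leq_subr.
Qed.

(** Given a time [m], take the least [n] such that level [i + n] is first visited after [m]. As [i]
    is not bad, [m - t] is at most [a * r], where [r] counts the regeneration levels in [i, i + n).
    The highest of these is at least [i + r - 1] and was visited by time [m], so [y m >= r - 1];
    hence the [+ 1]. *)
Lemma linear_growth (y : path_space) (a i : nat) : full y -> reg i y ->
  (forall M, ~ bad_at a M i y) ->
  exists K : nat, forall m, (K <= m)%N -> m%:Z <= a%:Z * (y m + 1) + K%:Z.
Proof.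
move=> fy [t ht hge] nb.
have [tau htau] : {tau : nat -> nat & forall i, hit i (tau i) y}.
  by exists (fun i => sval (cid (fy i))) => j; exact: (svalP (cid (fy j))).
have te : tau i = t := hit_uniq (htau i) ht.
have inc j k : (j < k)%N -> (tau j < tau k)%N by move=> jk; exact: hit_ltn jk (htau j) (htau k).
have mono j k : (j <= k)%N -> (tau j <= tau k)%N.
  by rewrite leq_eqVlt => /orP[/eqP -> //|jk]; apply: ltnW; exact: inc.
have grow n : (n <= tau n)%N.
  by elim: n => // n IH; apply: (leq_ltn_trans IH); exact: inc.
exists t => m tm.
have ex : exists n, (m < tau (i + n))%N.
  by exists m.+1; apply: (leq_trans _ (grow _)); lia.
case: (ex_minnP ex) => n hn nmin.
have n0 : (0 < n)%N.
  by case: n hn {nmin} => //; rewrite addn0 te ltnNge tm.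
have hprev : (tau (i + n.-1) <= m)%N.
  rewrite leqNgt; apply/negP => h; have := nmin _ h; lia.
set r := cnt n (sh t i y).
have hr : (tau (i + n) - t <= a * r)%N.
  rewrite leqNgt; apply/negP => hc; apply: (nb n).
  exists t => //; split=> //; split.
    by move=> k; rewrite /sh subr_ge0; apply: hge; exact: leq_addr.
  have [t' tE ht'] := hit_shE ht (htau (i + n)%N).
  by exists n; split=> //; exists t' => //; rewrite tE addKn in hc.
have r0 : (0 < r)%N.
  by rewrite lt0n; apply/eqP => r0; move: hr; rewrite r0 muln0; lia.
(* Pigeonhole: if all regeneration levels of the window had offset below [r - 1], there would be at
   most [r - 1] of them. *)
have [j [jn jr hj]] : exists j, [/\ (j < n)%N, (r <= j.+1)%N & reg (i + j) y].
  apply: contrapT => hno.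
  have : (r <= \sum_(j < n) ((j < r.-1)%N : nat))%N.
    have rE : r = (\sum_(j < n) (y \in reg (i + j)))%N by exact: cnt_sh.
    rewrite [X in (X <= _)%N]rE; apply: leq_sum => j _.
    case: (boolP (y \in reg (i + j))) => //= /set_mem hj.
    rewrite lt0b ltnNge; apply/negP => rj; apply: hno; exists j; split=> //.
    by rewrite -(prednK r0) ltnS.
  have : (\sum_(j < n) ((j < r.-1)%N : nat) <= r.-1)%N.
    rewrite -(big_mkord xpredT (fun j => ((j < r.-1)%N : nat))).
    elim: (n) => [|k IHk]; first by rewrite big_geq.
    rewrite big_nat_recr //=; case: (leqP r.-1 k) => rk; first by rewrite addn0.
    rewrite addn1; apply: (@leq_ltn_trans (\sum_(0 <= j < k) 1)%N); last by rewrite sum_nat_const_nat subn0 muln1.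
    by apply: leq_sum => l _; case: (_ < _)%N.
  lia.
case: hj => t' ht' hge'.
have t'm : (t' <= m)%N.
  rewrite (hit_uniq ht' (htau _)); apply: leq_trans hprev; apply: mono; lia.
have ym : (r%:Z <= y m + 1).
  have := hge' m t'm; lia.
have : m%:Z <= (a * r)%N%:Z + t%:Z by lia.
move/le_trans; apply; rewrite lerD2r PoszM.
by apply: ler_wpM2l.
Qed.

End Counting.

Section MonotoneLimits.
Context (R : realType) dT (T : measurableType dT) (Q : probability T R).

Lemma measure_bigcup_le (F : nat -> set T) (b : \bar R) : (forall n, measurable (F n)) ->
  (forall n m, (n <= m)%N -> F n `<=` F m) -> (forall n, (Q (F n) <= b)%E) ->
  (Q (\bigcup_n F n) <= b)%E.
Proof.
move=> mF ndF h.
have cv : (fun n => Q (F n)) @ \oo --> Q (\bigcup_n F n).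
  apply: nondecreasing_cvg_mu => //; first exact: bigcupT_measurable.
  by move=> n m nm; apply/subsetPset; exact: ndF.
rewrite -(cvg_lim _ cv) //; apply: lime_le; first exact: cvgP cv.
exact: nearW.
Qed.

Lemma measure_bigcap_ge (F : nat -> set T) (b : \bar R) : (forall n, measurable (F n)) ->
  (forall n m, (n <= m)%N -> F m `<=` F n) -> (forall n, (b <= Q (F n))%E) ->
  (b <= Q (\bigcap_n F n))%E.
Proof.
move=> mF ndF h.
have cv : (fun n => Q (F n)) @ \oo --> Q (\bigcap_n F n).
  apply: nonincreasing_cvg_mu => //; last 2 first.
  - exact: bigcapT_measurable.
  - by move=> n m nm; apply/subsetPset; exact: ndF.
  by apply: (le_lt_trans (probability_le1 _ _)) => //; exact: ltry.
rewrite -(cvg_lim _ cv) //; apply: lime_ge; first exact: cvgP cv.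
exact: nearW.
Qed.

Lemma null_ae (A : set T) : measurable A -> Q A = 0%E -> {ae Q, forall y, ~ A y}.
Proof. by move=> mA A0; exists A; split=> // y /contrapT. Qed.

Lemma measure_setI_ae (A C : set T) : measurable A -> measurable C ->
  {ae Q, forall y, C y} -> Q (A `&` C) = Q A.
Proof.
move=> mA mC /negligibleP -/(_ (measurableC mC)) C0.
have D0 : Q (A `\` C) = 0%E.
  apply/eqP; rewrite eq_le measure_ge0 andbT -C0; apply: le_measure; rewrite ?inE.
  - exact: measurableD.
  - exact: measurableC.
  - by move=> y [].
apply/esym; apply: (etrans (measureDI Q mA mC)); rewrite -[RHS]add0e.
by congr (_ + _)%E; exact: D0.
Qed.

Lemma eq0_of_le_invn (x : \bar R) (C : R) : (0 <= x)%E ->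
  (forall n, (0 < n)%N -> (n%:R%:E * x <= C%:E)%E) -> x = 0%E.
Proof.
move=> x0 h; have := h 1%N isT; rewrite mul1e => xC.
have : x \is a fin_num by rewrite ge0_fin_numE // (le_lt_trans xC) ?ltry.
move=> xf; rewrite -(fineK xf) in x0 h *; move: (fine x) x0 h => r; rewrite lee_fin => r0 h.
congr EFin; apply/eqP; rewrite eq_le r0 andbT leNgt; apply/negP => rp.
have C0 : 0 <= C by have := h 1%N isT; rewrite mul1e lee_fin; exact: le_trans.
pose n := (Num.truncn (C / r)).+1.
have := h n isT; rewrite -EFinM lee_fin -ler_pdivlMr // leNgt => /negP; apply.
by rewrite /n; apply: truncnS_gt.
Qed.

End MonotoneLimits.

(** * Almost sure linear growth under an abstract renewal law *)

Section Regeneration.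
Context (R : realType) (Q : probability path_space R) (c : R).
Hypothesis c0 : 0 < c.
Hypothesis renewal : forall i n m (F A : set path_space),
  determined n F -> F `<=` hit i n -> determined m A -> A `<=` stay_upto m ->
  Q (F `&` sh n i @^-1` A) = (Q F * Q A)%E.

Definition nearest (n : nat) : set path_space :=
  [set y | y 0%N = 0 /\ forall k, (k < n)%N -> y k.+1 <= y k + 1].

Hypothesis nearestQ : forall n, Q (nearest n) = 1%E.
Hypothesis timeQ : forall L k : nat, (0 < L)%N ->
  (\sum_(n < k) Q (below L n) <= (L%:R / c)%:E)%E.
Hypothesis stayQ : forall n, (c%:E <= Q (stay_upto n))%E.

Lemma measurable_nearest n : measurable (nearest n).
Proof.
apply: (@determined_measurable n) => y y' h [y0 hy]; split=> [|k kn]; first by rewrite -h.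
by rewrite -!h // ?hy // ltnW.
Qed.

(** Upward steps have size at most 1, so the first time at or above [L] is a visit to [L] itself. *)
Lemma hit_level y L n : (forall m, nearest m y) -> ~ below L n y -> (0 < L)%N ->
  exists m, hit L m y.
Proof.
move=> hy nb L0.
have ex : exists k, L%:Z <= y k.
  apply: contrapT => h; apply: nb => k _; rewrite ltNge; apply/negP => hk.
  by apply: h; exists k.
case: (ex_minnP ex) => m hm mmin; exists m.
have lt k : (k < m)%N -> y k < L%:Z.
  by move=> km; rewrite ltNge; apply/negP => /mmin; rewrite leqNgt km.
split=> //; apply/eqP; rewrite eq_le hm andbT.
case: m hm mmin lt => [|m] hm mmin lt.
  by have [-> _] := hy 0%N; rewrite lez_nat.
have [_ /(_ m (ltnSn m)) h] := hy m.+1.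
by apply: (le_trans h); rewrite lezD1 lt.
Qed.

(** The intersection lies in each [below L n], so [k] times its probability is at most the bound
    [L / c] on the mean passage time, for every [k]. *)
Let below_lim L : (0 < L)%N -> Q (\bigcap_n below L n) = 0%E.
Proof.
move=> L0; apply: (@eq0_of_le_invn R _ (L%:R / c)) => // k k0.
have mB : measurable (\bigcap_n below L n).
  by apply: bigcapT_measurable => n; exact: measurable_below.
apply: (le_trans _ (timeQ k L0)).
apply: (@le_trans _ _ (\sum_(n < k) Q (\bigcap_n below L n))%E).
  have f : Q (\bigcap_n below L n) \is a fin_num by exact: fin_num_measure.
  by rewrite -(fineK f) sumEFin sumr_const card_ord -EFinM mulr_natl.
apply: lee_sum => n _; apply: le_measure; rewrite ?inE //; first exact: measurable_below.
by move=> y h; exact: (h n I).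
Qed.

Lemma good_ae : {ae Q, forall y, (forall m, nearest m y) /\ full y}.
Proof.
have h1 : {ae Q, forall y m, nearest m y}.
  apply: ae_foralln => m; apply/(negligibleP _ (measurableC (measurable_nearest m))).
  by apply: (etrans (probability_setC Q (measurable_nearest m))); rewrite nearestQ subee.
have h2 : {ae Q, forall y (L : nat), ~ (\bigcap_n below L.+1 n) y}.
  apply: ae_foralln => L.
  have mB : measurable (\bigcap_n below L.+1 n).
    by apply: bigcapT_measurable => n; exact: measurable_below.
  by apply: null_ae => //; exact: below_lim.
apply: filterS2 h1 h2 => y hn hb; split=> // -[|L].
  by exists 0%N; split=> //; case: (hn 0%N).
have [n nb] : exists n, ~ below L.+1 n y.
  by apply: contrapT => h; apply: (hb L) => n _; apply: contrapT => hh; apply: h; exists n.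
exact: hit_level hn nb _.
Qed.

Let stay_ge : (c%:E <= Q stay)%E.
Proof.
rewrite stayE; apply: measure_bigcap_ge => //; first exact: measurable_stay_upto.
by move=> n m nm y h k kn; apply: h; exact: leq_trans nm.
Qed.

Let Qfull (A : set path_space) : measurable A -> Q (A `&` full) = Q A.
Proof.
move=> mA; apply: measure_setI_ae => //; first exact: measurable_full.
by apply: filterS good_ae => y [].
Qed.

Definition unsettled (j n : nat) : set path_space :=
  [set y | forall j', (j' <= j)%N -> exists2 k, (k <= n)%N &
     y k < j'%:Z /\ exists2 m, (m <= k)%N & hit j' m y].

(* [unsettled j n]: by time [n] each level up to [j] has been left downwards. Such a prefix is
   independent of a regeneration at level [i], so c Q(E j i) <= Q(NR j) - Q(NI); let i, then j,
   tend to infinity. *)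
Lemma no_regeneration : Q (\bigcap_j ~` reg j) = 0%E.
Proof.
pose NR j := \bigcap_(j' in [set j' | (j' <= j)%N]) ~` reg j'.
pose NI := \bigcap_j ~` reg j.
have mNR j : measurable (NR j).
  by apply: bigcap_measurableType => k _; apply: measurableC; exact: measurable_reg.
have mNI : measurable NI.
  by apply: bigcapT_measurable => k; apply: measurableC; exact: measurable_reg.
have NIE : NI = \bigcap_j NR j.
  apply/seteqP; split=> y h j _; first by move=> k _; exact: h.
  by apply: (h j I); rewrite /= leqnn.
pose F j i n := hit i n `&` unsettled j n.
have dF j i n : determined n (F j i n).
  apply: determinedI; first exact: determined_hit.
  move=> y y' h hy j' jj; have [k kn [yk [m mk hm]]] := hy j' jj; exists k => //; split.
    by rewrite -h.
  exists m => //; apply: (@determined_hit j' m y) => // l lm; apply: h.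
  by apply: (leq_trans lm); apply: (leq_trans mk).
have FNR j i n : F j i n `<=` NR j.
  move=> y [_ hu] j' /= jj [m0 hm0 hge].
  have [k kn [yk [m mk hm]]] := hu j' jj.
  have e := hit_uniq hm hm0; rewrite e in mk.
  by have := hge k mk; rewrite leNgt yk.
pose E j i := \bigcup_n F j i n.
have mE j i : measurable (E j i).
  by apply: bigcupT_measurable => n; exact: determined_measurable (dF j i n).
have mD j i n : measurable (F j i n `&` sh n i @^-1` (stay `&` setT)).
  apply: measurableI; first exact: determined_measurable (dF j i n).
  by apply: measurable_sh_preimage; rewrite setIT; exact: measurable_stay.
have ineq j i : (Q (E j i) * c%:E + Q NI <= Q (NR j))%E.
  apply: (@le_trans _ _ (Q (E j i) * Q (stay `&` setT) + Q NI)%E).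
    by rewrite leeD2r // setIT lee_wpmul2l.
  have Fh n : F j i n `<=` hit i n by move=> y [].
  rewrite -(renewal_level renewal (dF j i) Fh) //.
  rewrite -measureU //; [|exact: bigcupT_measurable|].
    apply: le_measure; rewrite ?inE //.
      by apply: measurableU => //; exact: bigcupT_measurable.
    move=> y [[n _ [/FNR //]]|]; rewrite NIE; exact.
  apply/seteqP; split=> y // -[[n _ [[hy _] [sy _]]] /(_ i I)]; apply.
  by rewrite regE; exists n.
have ineq2 j : (Q NI * c%:E + Q NI <= Q (NR j))%E.
  have QNRf : Q (NR j) \is a fin_num by exact: fin_num_measure.
  have QNIf : Q NI \is a fin_num by exact: fin_num_measure.
  have ub : (Q (\bigcup_i (E j i `&` full)) <= ((fine (Q (NR j)) - fine (Q NI)) / c)%R%:E)%E.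
    apply: measure_bigcup_le => [i|i i' ii|i].
    - by apply: measurableI => //; exact: measurable_full.
    - move=> y [[n _ [hn hu]] fy]; split=> //; have [n' hn'] := fy i'; exists n' => //; split=> //.
      have nn : (n <= n')%N.
        move: ii; rewrite leq_eqVlt => /orP[/eqP e|ii]; first by rewrite -e in hn'; rewrite (hit_uniq hn hn').
        by apply: ltnW; exact: hit_ltn ii hn hn'.
      move=> j' jj; have [k kn h] := hu j' jj; exists k => //; exact: leq_trans nn.
    - have Ef : Q (E j i) \is a fin_num by exact: fin_num_measure.
      rewrite Qfull // -(fineK Ef) lee_fin ler_pdivlMr // lerBrDr.
      by rewrite -lee_fin EFinD EFinM !fineK.
  have sub : (Q NI <= Q (\bigcup_i (E j i `&` full)))%E.
    rewrite -(Qfull mNI); apply: le_measure; rewrite ?inE.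
    + by apply: measurableI => //; exact: measurable_full.
    + by apply: bigcupT_measurable => i; apply: measurableI => //; exact: measurable_full.
    move=> y [hy fy].
    have ex j' : exists n, exists2 k, (k <= n)%N & y k < j'%:Z /\ exists2 m, (m <= k)%N & hit j' m y.
      have [m hm] := fy j'; apply: contrapT => hno; apply: (hy j' I); exists m => // k mk.
      rewrite leNgt; apply/negP => yk; apply: hno; exists k, k => //; split=> //.
      by exists m.
    have [N hN] : exists N, unsettled j N y.
      elim: (j) => [|j1 [N IH]].
        have [n [k kn h]] := ex 0%N; exists n => j'; rewrite leqn0 => /eqP ->; by exists k.
      have [n [k kn h]] := ex j1.+1; exists (maxn N n) => j'; rewrite leq_eqVlt => /orP[/eqP ->|].
        by exists k => //; rewrite leq_max kn orbT.
      rewrite ltnS => jj; have [k' kn' h'] := IH j' jj; exists k' => //.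
      by rewrite leq_max kn'.
    (* Level [N] serves as [i]: first-visit times increase strictly, so level [N] is not reached
       before time [N], when all levels up to [j] have already been undercut. *)
    have [n hn] := fy N; exists N => //; split=> //; exists n => //; split=> //.
    have Nn : (N <= n)%N.
      have [tau htau] : {tau : nat -> nat & forall i, hit i (tau i) y}.
        by exists (fun i => sval (cid (fy i))) => l; exact: (svalP (cid (fy l))).
      rewrite (hit_uniq hn (htau N)); elim: (N) => // l IH.
      by apply: (leq_ltn_trans IH); exact: hit_ltn (ltnSn l) (htau l) (htau l.+1).
    by move=> j' jj; have [k kn h] := hN j' jj; exists k => //; exact: leq_trans Nn.
  have := le_trans sub ub; rewrite -(fineK QNIf) lee_fin ler_pdivlMr // lerBrDr.
  by rewrite -lee_fin EFinD EFinM !fineK.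
have QNIf : Q NI \is a fin_num by exact: fin_num_measure.
have : (Q NI * c%:E + Q NI <= Q NI)%E.
  rewrite {3}NIE; apply: measure_bigcap_ge => // n m nm y h k /= kn; apply: h.
  exact: leq_trans nm.
have : (0 <= Q NI)%E by [].
rewrite -(fineK QNIf) -EFinM -EFinD !lee_fin => p0; rewrite gerDr => hle.
by congr EFin; apply/eqP; rewrite eq_le p0 andbT; rewrite pmulr_lle0 in hle.
Qed.

(* Maximal inequality: average the covering bound over levels [i < N], use that all [bad_at a M i]
   have the same probability, and let [N] tend to infinity. *)
Lemma bad_bound a M : (0 < a)%N -> (Q (stay `&` bad a M) <= (c * a%:R)^-1%:E)%E.
Proof.
move=> a0.
have mB : measurable (stay `&` bad a M).
  by apply: measurableI; [exact: measurable_stay | exact: measurable_bad].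
have Bf : Q (stay `&` bad a M) \is a fin_num by exact: fin_num_measure.
set b := fine (Q (stay `&` bad a M)).
have QE i : Q (bad_at a M i) = b%:E.
  rewrite /bad_at (renewal_level renewal (@determined_hit i) (fun n => @subset_refl _ _) (measurable_bad _ M)).
  rewrite (_ : Q (\bigcup_n hit i n) = 1%E) ?mul1e ?fineK //.
  have mH : measurable (\bigcup_n hit i n).
    by apply: bigcupT_measurable => n; exact: measurable_hit.
  rewrite -[RHS](probability_setT Q) -(Qfull mH) -(Qfull measurableT).
  congr (Q _); apply/seteqP; split=> y [_ fy]; split=> //.
  by have [n hn] := fy i; exists n.
(* Expectation of the covering bound: [bad_at a M i] has probability [b] for every [i], and the mean
   of the passage time to [N + M] is controlled by [timeQ]. [N = 0] is set aside since [timeQ] is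
   stated for positive levels. *)
have key N : (a%:R * (N%:R * b) <= (N + M)%:R / c) \/ N = 0%N.
  case: N => [|N]; [by right | left].
  set L := (N.+1 + M)%N.
  have L0 : (0 < L)%N by rewrite /L addSn.
  rewrite -lee_fin.
  have h1 : (\int[Q]_y \sum_(n <oo) (\1_(below L n) y)%:E <= (L%:R / c)%:E)%E.
    rewrite integral_nneseries //; last first.
      by move=> n; apply/measurable_EFinP; exact: measurable_indic (measurable_below L n).
    apply: lime_le.
      apply: is_cvg_nneseries => n _ _; apply: integral_ge0 => y _.
      by rewrite lee_fin.
    apply: nearW => k; rewrite big_mkord.
    have E n : (\int[Q]_y (\1_(below L n) y)%:E = Q (below L n))%E.
      by rewrite integral_indic ?setIT //; exact: measurable_below.
    by rewrite (eq_bigr (fun n : 'I_k => Q (below L n))) => [|n _]; [exact: timeQ | exact: E].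
  apply: le_trans h1.
  have -> : ((a%:R * (N.+1%:R * b))%:E =
     \int[Q]_y (a%:R * \sum_(i < N.+1) \1_(bad_at a M i) y)%:E)%E.
    have ii i : Q.-integrable setT (EFin \o (\1_(bad_at a M i) : path_space -> R)).
      apply: (@bounded_integrable _ _ _ _ _ 1).
        exact: measurable_indic (measurable_bad_at a M i).
      by move=> y; rewrite indicE ger0_norm ?lern1 ?leq_b1.
    pose g (i : 'I_N.+1) : path_space -> R := \1_(bad_at a M i).
    have gi i : Q.-integrable setT (EFin \o g i) by exact: ii.
    have si := sum_integrable (index_enum 'I_N.+1) gi.
    have zi : Q.-integrable setT (EFin \o (fun y => a%:R * \sum_(i < N.+1) g i y)).
      exact: (integrableZl measurableT (a%:R : R) si).
    rewrite [RHS](RintegralE zi).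
    rewrite RintegralZl //; congr (_ * _)%:E; rewrite (@Rintegral_sum _ _ _ _ _ _ g) //.
    rewrite (eq_bigr (fun=> b)) ?sumr_const ?card_ord ?mulr_natl // => i _.
    by rewrite /Rintegral /g (integral_indic Q measurableT (measurable_bad_at a M i)) setIT; exact: (congr1 fine (QE i)).
  apply: ae_ge0_le_integral => //.
  - by move=> y _; rewrite lee_fin mulr_ge0 // sumr_ge0.
  - apply/measurable_EFinP; apply: measurable_funM; first exact: measurable_cst.
    by apply: measurable_fun_bigsum => i; exact: measurable_indic (measurable_bad_at a M i).
  - by move=> y _; apply: nneseries_ge0 => n _ _; rewrite lee_fin.
  - apply: ge0_emeasurable_sum => n *; first by rewrite lee_fin.
    by apply/measurable_EFinP; exact: measurable_indic (measurable_below L n).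
  apply: filterS good_ae => y [_ fy] _.
  have [tau htau] : {tau : nat -> nat & forall i, hit i (tau i) y}.
    by exists (fun i => sval (cid (fy i))) => l; exact: (svalP (cid (fy l))).
  have := bad_covering a M N.+1 htau.
  rewrite -(ler_nat R) natrM natr_sum => hcov.
  under eq_bigr do rewrite indicE.
  apply: (@le_trans _ _ (tau L)%:R%:E); first by rewrite lee_fin.
  have h0 n : 0 <= (\1_(below L n) y : R) by [].
  apply: le_trans (nneseries_ge_partial (tau L) h0).
  rewrite lee_fin (eq_bigr (fun=> 1)) ?sumr_const ?card_ord // => n _.
  rewrite indicE mem_set // => k kn; have [_] := htau L; apply.
  exact: leq_ltn_trans kn _.
rewrite -(fineK Bf) -/b lee_fin -[leRHS]mul1r ler_pdivlMr ?mulr_gt0 ?ltr0n //.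
rewrite mulrCA leNgt; apply/negP => h.
(* The averaged bound reads [N * e <= M]. If [e] were positive, an [N] beyond [M / e] would violate
   it. *)
pose e := c * (a%:R * b) - 1.
have e0 : 0 < e by rewrite /e [a%:R * b]mulrC subr_gt0.
pose N := (Num.truncn (M%:R / e)).+1.
case: (key N) => // hN.
have : N%:R * e <= M%:R.
  move: hN; rewrite ler_pdivlMr // natrD /e => hN.
  rewrite mulrBr mulr1 lerBlDl; apply: le_trans hN.
  by rewrite le_eqVlt; apply/orP; left; apply/eqP; ring.
rewrite -ler_pdivlMr // leNgt => /negP; apply.
by rewrite /N; apply: truncnS_gt.
Qed.

(** The bound 1/(c a) does not depend on [M], so it survives the increasing union; intersecting over
    [a] leaves probability 0. *)
Lemma bad_at_null i : Q (\bigcap_a \bigcup_M bad_at a.+1 M i) = 0%E.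
Proof.
have mU a : measurable (\bigcup_M bad_at a M i).
  by apply: bigcupT_measurable => M; exact: measurable_bad_at.
have mI : measurable (\bigcap_a \bigcup_M bad_at a.+1 M i) by apply: bigcapT_measurable.
apply: (@eq0_of_le_invn R _ c^-1) => // -[//|a] _.
have f : Q (\bigcap_a \bigcup_M bad_at a.+1 M i) \is a fin_num by exact: fin_num_measure.
have : (Q (\bigcap_a \bigcup_M bad_at a.+1 M i) <= ((c * a.+1%:R)^-1)%:E)%E.
  apply: (@le_trans _ _ (Q (\bigcup_M bad_at a.+1 M i))).
    by apply: le_measure; rewrite ?inE // => y /(_ a I).
  apply: measure_bigcup_le => [M|M M' MM|M]; first exact: measurable_bad_at.
    move=> y [n _ [hn [sy [k [k0 kM h]]]]]; exists n => //; split=> //; split=> //.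
    by exists k; split=> //; exact: leq_trans MM.
  rewrite /bad_at (renewal_level renewal (@determined_hit i) (fun n => @subset_refl _ _) (measurable_bad _ M)).
  apply: (le_trans _ (bad_bound M (ltn0Sn a))).
  rewrite -[leRHS]mul1e lee_wpmul2r //; apply: probability_le1.
  by apply: bigcupT_measurable => n; exact: measurable_hit.
rewrite -(fineK f) -EFinM !lee_fin invfM ler_pdivlMr ?ltr0n //.
by rewrite [X in X <= _ -> _]mulrC.
Qed.

Lemma ballistic_ae : {ae Q, forall y : path_space, exists a K : nat, (0 < a)%N /\
  forall m, (K <= m)%N -> m%:Z <= a%:Z * (y m + 1) + K%:Z}.
Proof.
have h1 : {ae Q, forall y, ~ (\bigcap_j ~` reg j) y}.
  have mI : measurable (\bigcap_j ~` reg j).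
    by apply: bigcapT_measurable => k; apply: measurableC; exact: measurable_reg.
  by apply: null_ae => //; exact: no_regeneration.
have h2 : {ae Q, forall y (i : nat), ~ (\bigcap_a \bigcup_M bad_at a.+1 M i) y}.
  apply: ae_foralln => i.
  have mI : measurable (\bigcap_a \bigcup_M bad_at a.+1 M i).
    apply: bigcapT_measurable => a; apply: bigcupT_measurable => M; exact: measurable_bad_at.
  by apply: null_ae => //; exact: bad_at_null.
apply: filterS3 good_ae h1 h2 => y [_ fy] nr nb.
have [i ri] : exists i, reg i y.
  by apply: contrapT => h; apply: nr => i _ ri; apply: h; exists i.
have [a na] : exists a, forall M, ~ bad_at a.+1 M i y.
  apply: contrapT => h; apply: (nb i) => a _; apply: contrapT => hh; apply: h; exists a => M hM.
  by apply: hh; exists M.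
have [K hK] := linear_growth fy ri na.
by exists a.+1, K.
Qed.

End Regeneration.

(** * Law of the level process *)

Section PathLists.
Context (d : nat).

Definition paths n : seq (seq (Dir d)) := [seq val s | s <- enum {: n.-tuple (Dir d)}].

Lemma mem_paths n s : (s \in paths n) = (size s == n).
Proof.
apply/mapP/eqP => [[u _ ->]|sn]; first exact: size_tuple.
have sn' : size s == n by exact/eqP.
by exists (Tuple sn'); rewrite ?mem_enum.
Qed.

Lemma paths_uniq n : uniq (paths n).
Proof. by rewrite map_inj_uniq ?enum_uniq //; exact: val_inj. Qed.

Lemma big_paths (R : realType) n (C : pred (seq (Dir d))) (F : seq (Dir d) -> R) :
  \sum_(s <- paths n | C s) F s = \sum_(s : n.-tuple (Dir d) | C s) F s.
Proof. by rewrite big_map big_enum_cond; apply: eq_bigl. Qed.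

Lemma unitv_inj : injective (@unitv d).
Proof.
move=> [i b] [i' b'] /rowP h.
have := h i; rewrite !mxE /= eqxx; case: eqP => [<-|_]; last by case: (b).
by case: (b); case: (b').
Qed.

Lemma endpt_take_S (x : Zd d) s e0 k : (k < size s)%N ->
  endpt x (take k.+1 s) = endpt x (take k s) + unitv (nth e0 s k).
Proof.
by move=> ks; rewrite (take_nth e0) // /endpt big_rcons /= addrA addrAC.
Qed.

Lemma endpt_inj (s s' : seq (Dir d)) : size s = size s' ->
  (forall k, (k <= size s)%N -> endpt 0 (take k s) = endpt 0 (take k s')) -> s = s'.
Proof.
move=> ss h; case: s => [|e0 s0] in ss h *; first by case: s' ss {h}.
apply: (@eq_from_nth _ e0) => // k ks; apply: unitv_inj.
have := h k.+1 ks; rewrite !(endpt_take_S _ e0) -?ss // (h k (ltnW ks)).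
exact: addrI.
Qed.

Lemma inside_endpt (B : set (Zd d)) x s :
  inside B x s <-> forall k, (k <= size s)%N -> B (endpt x (take k s)).
Proof.
elim: s x => [|e s IH] x /=.
  rewrite andbT; split=> [/set_mem xB k _|h]; first by rewrite endpt_nil.
  by apply/mem_set; have := h 0%N isT; rewrite endpt_nil.
split=> [/andP[/set_mem xB /IH h] [|k] ks|h].
- by rewrite endpt_nil.
- by rewrite endpt_cons; exact: h.
apply/andP; split; first by apply/mem_set; have := h 0%N isT; rewrite endpt_nil.
by apply/IH => k ks; have := h k.+1 ks; rewrite endpt_cons.
Qed.

Lemma wt_eq (R : realType) (w w' : env R d) x s :
  (forall k, (k < size s)%N -> w (endpt x (take k s)) = w' (endpt x (take k s))) ->
  wt w x s = wt w' x s.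
Proof.
elim: s x => //= e s IH x h; congr (_ * _).
  by have := h 0%N isT; rewrite endpt_nil => ->.
by apply: IH => k ks; have := h k.+1 ks; rewrite /= endpt_cons.
Qed.

Lemma wt_shift (R : realType) (w : env R d) x u s : wt (fun y => w (x + y)) u s = wt w (x + u) s.
Proof. by elim: s u => //= e s IH u; rewrite IH addrA. Qed.

End PathLists.

Lemma measure_seq_union (R : realType) dT (T : measurableType dT) (P : probability T R)
  (I : eqType) (r : seq I) (F : I -> set T) : uniq r -> (forall i, measurable (F i)) ->
  (forall i j t, i \in r -> j \in r -> F i t -> F j t -> i = j) ->
  measurable [set t | exists2 i, i \in r & F i t] /\
  P [set t | exists2 i, i \in r & F i t] = (\sum_(i <- r) P (F i))%E.
Proof.
move=> + mF; elim: r => [|i r IH] /=.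
  move=> _ _; rewrite (_ : [set t | _] = set0); first by rewrite big_nil measure0.
  by apply/seteqP; split=> t // -[].
move=> /andP[ir ur] dis.
have [|m1 E1] := IH ur; first by move=> j k t jr kr; apply: dis; rewrite inE ?jr ?kr orbT.
have -> : [set t | exists2 j, j \in i :: r & F j t] = F i `|` [set t | exists2 j, j \in r & F j t].
  apply/seteqP; split=> t.
    by move=> [j]; rewrite inE => /orP[/eqP -> Fi|jr Fj]; [left | right; exists j].
  by move=> [Fi|[j jr Fj]]; [exists i; rewrite ?inE ?eqxx | exists j; rewrite ?inE ?jr ?orbT].
split; first exact: measurableU.
rewrite big_cons -E1; apply: measureU => //.
apply/seteqP; split=> t // -[Fi [j jr Fj]].
have e : i = j by apply: dis Fi Fj; rewrite ?inE ?eqxx ?jr ?orbT.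
by move: ir; rewrite e jr.
Qed.

(** * The renewal property of the annealed level process *)

Section WalkLaw.
Context (R : realType) (d : nat) dT (T : measurableType dT) (P : probability T R).
Variables (om : T -> env R d) (X : nat -> T -> Zd d).
Hypothesis hd : (0 < d)%N.
Hypothesis hpv : prob_vectors om.
Hypothesis hiid : iid_env P om.
Hypothesis hX : annealed_walk P om X.
Let mom : forall x e, measurable_fun setT (fun t => om t x e) := iid_measurable hiid.
Let hss : forall t, substoch (om t) := prob_vectors_substoch hpv.

Let wle1 t x s : 0 <= wt (om t) x s <= 1.
Proof.
rewrite wt_ge0 //=; elim: s x => //= e s IH x.
have [w0 w1] := hss t.
have h1 : om t x e <= 1 by rewrite (le_trans _ (w1 x)) // (bigD1 e) //= lerDl sumr_ge0.
by rewrite -[leRHS]mulr1 ler_pM // wt_ge0.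
Qed.

Let wi x s : P.-integrable setT (EFin \o (fun t => wt (om t) x s)).
Proof.
apply: (@bounded_integrable _ _ _ _ _ 1); first exact: measurable_wt.
by move=> t; case/andP: (wle1 t x s) => h0 h1; rewrite ger0_norm.
Qed.

Definition path_prob s : R := \int[P]_t wt (om t) 0 s.

Lemma wt_shift_int x s : \int[P]_t wt (om t) x s = path_prob s.
Proof.
(* The absolute value makes [psi] nonnegative on all of [env_space], as [shift_law] requires, and
   changes nothing at the environments [om t]. *)
pose psi (w : env_space R d) : \bar R := `|wt w 0 s|%:E.
have E y t : `|wt (om t) y s| = wt (om t) y s by rewrite ger0_norm //; case/andP: (wle1 t y s).
have mpsi : measurable_fun [set: env_space R d] psi.
  apply/measurable_EFinP; apply: measurableT_comp => //.
  by apply: measurable_wt; exact: measurable_coord.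
have psi0 w : (0 <= psi w)%E by rewrite lee_fin.
rewrite /path_prob /Rintegral; congr fine.
transitivity (\int[P]_t psi (fun y => om t (x + y)%R))%E.
  by apply: eq_integral => t _; rewrite /psi wt_shift addr0 E.
by rewrite -(shift_law hiid x mpsi psi0); apply: eq_integral => t _; rewrite /psi E.
Qed.

(** The weight of [s] reads the environment strictly below level [i] and that of [s'] only at or
    above it; the junction site belongs to [s'], since a path does not use the environment at its
    endpoint. Resampling above level [i] factorizes the integral, and stationarity brings the second
    factor back to the origin. *)
Lemma path_prob_cat (i : int) s s' :
  (forall k, (k < size s)%N -> lev hd (endpt 0 (take k s)) < i) ->
  (forall k, (k < size s')%N -> i <= lev hd (endpt (endpt 0 s) (take k s'))) ->
  path_prob (s ++ s') = path_prob s * path_prob s'.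
Proof.
move=> hs hs'.
pose A := [pred x | lev hd x < i].
have m1 w w' : wt (mix A w w') 0 (s ++ s') = wt w 0 s * wt w' (endpt 0 s) s' :> R.
  rewrite wt_cat; congr (_ * _); apply: wt_eq => k ks; rewrite /mix /=.
    by rewrite hs.
  by rewrite ltNge hs'.
have nn y u t : `|wt (om t) y u| = wt (om t) y u by rewrite ger0_norm //; case/andP: (wle1 t y u).
have := @mix_law _ _ _ _ P om hiid A (fun w : env_space R d => `|wt w 0 (s ++ s')|%:E).
move=> h; apply: EFin_inj; rewrite /path_prob -RintegralE //.
transitivity (\int[P]_t `|wt (om t) 0 (s ++ s')|%:E)%E.
  by apply: eq_integral => t _; rewrite nn.
rewrite h //; last first.
  apply/measurable_EFinP; apply: measurableT_comp => //.
  by apply: measurable_wt; exact: measurable_coord.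
transitivity (\int[P]_t (path_prob s' * wt (om t) 0 s)%:E)%E.
  apply: eq_integral => t _; rewrite -(wt_shift_int (endpt 0 s) s') -RintegralZr // -RintegralE.
    by apply: eq_integral => t' _; rewrite m1 normrM !nn mulrC.
  rewrite [X in P.-integrable _ (EFin \o X)](_ : _ = fun t' => wt (om t) 0 s * wt (om t') (endpt 0 s) s').
    by apply: (integrableZl _ (wt (om t) 0 s)) (wi _ _).
  by apply/funext => t'; rewrite mulrC.
rewrite RintegralE ?RintegralZl //; first by rewrite mulrC.
by apply: (integrableZl _ (path_prob s')) (wi _ _).
Qed.

Definition cyl s : set T := [set t | forall k, (k <= size s)%N -> X k t = endpt 0 (take k s)].

Lemma measurable_cyl s : measurable (cyl s).
Proof.
rewrite [X in measurable X](_ : _ = \bigcap_(k in [set k | (k <= size s)%N]) [set t | X k t = endpt 0 (take k s)]).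
  by apply: bigcap_measurableType => k _; exact: hX.1.
by apply/seteqP; split=> t h k ks; exact: h.
Qed.

Lemma cyl_prob s : P (cyl s) = (path_prob s)%:E.
Proof.
rewrite /path_prob -RintegralE //.
have := hX.2 (size s) (ffun_tuple (in_tuple s)).
under eq_integral do rewrite path_weight_tuple.
move=> <-; congr (P _); apply/seteqP; split=> t h.
  by move=> k; rewrite h ?pos_ffun_tuple // -ltnS.
by move=> k ks; have := h (Ordinal (ltnSE ks : (k < (size s).+1)%N)); rewrite pos_ffun_tuple.
Qed.

Definition level_path (t : T) : path_space := fun k => lev hd (X k t).
Definition levs s : path_space := fun k => lev hd (endpt 0 (take k s)).

Lemma level_path_cyl s t k : cyl s t -> (k <= size s)%N -> level_path t k = levs s k.
Proof. by move=> ct ks; rewrite /level_path ct. Qed.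

Lemma measurable_level_path : measurable_fun setT level_path.
Proof.
apply: measurability => // _ [A [n dA] <-]; rewrite setTI.
(* A prefix event is a countable union over the possible first [n + 1] positions. *)
pose F (z : n.+1.-tuple 'rV[int]_d) : set T :=
  if pselect (A (fun k => lev hd (nth 0 z k))) then
    \bigcap_(k in [set k | (k <= n)%N]) [set t | X k t = nth 0 z k] else set0.
rewrite [X in measurable X](_ : _ = \bigcup_z F z).
  apply: countable_bigcupT_measurable => [|z]; first exact: countableP.
  rewrite /F; case: pselect => Az; last exact: measurable0.
  by apply: bigcap_measurableType => k _; exact: hX.1.
apply/seteqP; split=> t.
  move=> At; pose z : n.+1.-tuple 'rV[int]_d := [tuple X k t | k < n.+1].
  have zE k : (k <= n)%N -> nth 0 z k = X k t.
    by move=> kn; rewrite -(tnth_nth 0 z (Ordinal (kn : (k < n.+1)%N))) tnth_mktuple.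
  exists z => //; rewrite /F; case: pselect => [Az k kn|nA]; first by rewrite /= zE.
  by case: nA; apply: dA At => k kn; rewrite zE.
move=> [z _]; rewrite /F; case: pselect => [Az h|] //.
by apply: (dA _ _ _ Az) => k kn; rewrite /level_path (h k kn).
Qed.

(** The cylinders of the paths of length [n] are disjoint and have total mass 1, so up to a null set
    the process follows one of them. The enumeration [r] is left free so that concatenations can be
    used in [level_path_renewal]. *)
Lemma level_path_prob n (r : seq (seq (Dir d))) (A : set path_space) : uniq r ->
  (forall s, (s \in r) = (size s == n)) -> determined n A ->
  P (level_path @^-1` A) = (\sum_(s <- r | `[< A (levs s) >]) path_prob s)%:E.
Proof.
move=> ur rn dA.
have dis (r' : seq (seq (Dir d))) : {subset r' <= r} ->
    forall s s' t, s \in r' -> s' \in r' -> cyl s t -> cyl s' t -> s = s'.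
  move=> sub s s' t /sub; rewrite rn => /eqP sn /sub; rewrite rn => /eqP sn' cs cs'.
  by apply: endpt_inj; rewrite ?sn ?sn' // => k kn; rewrite -cs ?sn // cs' ?sn'.
have [mV VE] := @measure_seq_union _ _ _ P _ r cyl ur measurable_cyl (dis r (fun s h => h)).
have total : \sum_(s <- r) path_prob s = 1.
  have -> : \sum_(s <- r) path_prob s = \sum_(s <- paths d n) path_prob s.
    apply: perm_big; apply: uniq_perm => //; first exact: paths_uniq.
    by move=> s; rewrite rn mem_paths.
  rewrite big_paths -Rintegral_sum // -[RHS](Rintegral_cstT P); apply: eq_Rintegral => t _.
  have -> : \sum_(s : n.-tuple (Dir d)) wt (om t) 0 s = surv setT (om t) n 0.
    rewrite -survE; apply: eq_bigl => s; apply/esym/inside_endpt => //.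
  elim: n {rn dA} (0 : Zd d) => [|n IH] x /=; rewrite in_setT //.
  by rewrite mul1r; under eq_bigr do rewrite IH mulr1; rewrite hpv.2.
set V := [set t | exists2 s, s \in r & cyl s t] in mV VE.
have V1 : {ae P, forall t, V t}.
  apply/(negligibleP _ (measurableC mV)); apply: (etrans (probability_setC P mV)).
  rewrite VE; under eq_bigr do rewrite cyl_prob.
  by rewrite sumEFin total subee.
have mA : measurable (level_path @^-1` A).
  by rewrite -[X in measurable X]setTI; apply: measurable_level_path => //; exact: determined_measurable dA.
rewrite -(measure_setI_ae mA mV V1).
pose r' := [seq s <- r | `[< A (levs s) >]].
have sub : {subset r' <= r} by move=> s; rewrite mem_filter => /andP[].
have [_ UE] := @measure_seq_union _ _ _ P _ r' cyl (filter_uniq _ ur) measurable_cyl (dis r' sub).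
rewrite (_ : _ `&` V = [set t | exists2 s, s \in r' & cyl s t]).
  by rewrite UE; under eq_bigr do rewrite cyl_prob; rewrite sumEFin big_filter.
apply/seteqP; split=> t.
  move=> [At [s sr cs]]; exists s => //; rewrite mem_filter sr andbT; apply/asboolP.
  apply: dA At => k kn; apply: level_path_cyl => //.
  by move: sr; rewrite rn => /eqP ->.
move=> [s]; rewrite mem_filter => /andP[/asboolP As sr] cs; split; last by exists s.
apply: dA As => k kn; rewrite -(level_path_cyl cs) //.
by move: sr; rewrite rn => /eqP ->.
Qed.

Lemma level_path_surv n (B : set (Zd d)) (A : set path_space) : determined n A ->
  (forall s, size s = n -> A (levs s) <-> forall k, (k <= n)%N -> B (endpt 0 (take k s))) ->
  P (level_path @^-1` A) = (\int[P]_t surv B (om t) n 0)%:E.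
Proof.
move=> dA hA; rewrite (level_path_prob (paths_uniq d n) (@mem_paths d n) dA).
congr EFin; rewrite big_paths /path_prob.
transitivity (\int[P]_t \sum_(s : n.-tuple (Dir d) | inside B 0 s) wt (om t) 0 s); last first.
  by apply: eq_Rintegral => t _; rewrite survE.
have -> : \int[P]_t \sum_(s : n.-tuple (Dir d) | inside B 0 s) wt (om t) 0 s =
  \int[P]_t \sum_(s <- [seq s <- index_enum _ | inside B 0 (tval s)]) wt (om t) 0 (tval (s : n.-tuple (Dir d))).
  by apply: eq_Rintegral => t _; rewrite big_filter.
rewrite Rintegral_sum // big_filter; apply: eq_bigl => s.
apply/asboolP/idP => [/(hA _ (size_tuple s)) h|/inside_endpt h].
  by apply/inside_endpt => k; rewrite size_tuple; exact: h.
by apply/(hA _ (size_tuple s)) => k kn; apply: h; rewrite size_tuple.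
Qed.

(** Enumerate paths of length [n + m] as concatenations. [F] forces the first piece to stay below
    level [i] before ending on it, [A] forces the second to stay at or above [i], and
    [path_prob_cat] factorizes each term. *)
Lemma level_path_renewal i n m (F A : set path_space) :
  determined n F -> F `<=` hit i n -> determined m A -> A `<=` stay_upto m ->
  P (level_path @^-1` (F `&` sh n i @^-1` A)) =
  (P (level_path @^-1` F) * P (level_path @^-1` A))%E.
Proof.
move=> dF Fh dA As.
have dFA : determined (n + m)%N (F `&` sh n i @^-1` A).
  apply: determinedI; first by apply: determined_le dF; exact: leq_addr.
  exact: determined_sh.
pose r := [seq s ++ s' | s <- paths d n, s' <- paths d m].
have ur : uniq r.
  apply: allpairs_uniq; try exact: paths_uniq.
  move=> [s1 s1'] [s2 s2'] /allpairsP[[a b] /= [h1 h2 [-> ->]]] /allpairsP[[a' b'] /= [h1' h2' [-> ->]]].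
  move: h1 h1' h2 h2'; rewrite !mem_paths => /eqP sa /eqP sa' _ _ e.
  by move/eqP: e; rewrite eqseq_cat ?sa ?sa' // => /andP[/eqP -> /eqP ->].
have rn s : (s \in r) = (size s == n + m)%N.
  apply/allpairsP/eqP => [[[a b] /= [+ + ->]]|sn].
    by rewrite !mem_paths size_cat => /eqP -> /eqP ->.
  exists (take n s, drop n s); rewrite /= !mem_paths cat_take_drop size_drop size_take sn.
  by split=> //; apply/eqP; [case: ltnP => //; lia | lia].
rewrite (level_path_prob ur rn dFA).
rewrite (level_path_prob (paths_uniq d n) (@mem_paths d n) dF).
rewrite (level_path_prob (paths_uniq d m) (@mem_paths d m) dA).
rewrite -EFinM; congr EFin.
rewrite big_mkcond /r big_allpairs_dep /= mulr_suml [RHS]big_mkcond /=.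
rewrite !big_seq; apply: eq_bigr => s; rewrite mem_paths => /eqP sn.
rewrite mulr_sumr.
have lev1 s' k : (k <= n)%N -> levs (s ++ s') k = levs s k.
  by move=> kn; rewrite /levs takel_cat // sn.
case: asboolP => Fs; last first.
  rewrite big1 // => s' _; case: asboolP => // -[Fss _]; case: Fs.
  by apply: dF Fss => k kn; exact: lev1.
rewrite [RHS]big_mkcond /= !big_seq; apply: eq_bigr => s'; rewrite mem_paths => /eqP sn'.
have [hn hlt] := Fh _ Fs.
have ls : lev hd (endpt 0 s) = i%:Z by rewrite -hn /levs take_oversize ?sn.
have lev2 k : (k <= m)%N -> sh n i (levs (s ++ s')) k = levs s' k.
  move=> km; rewrite /sh /levs take_cat sn ltnNge leq_addr /= addKn endpt_cat.
  rewrite /lev /endpt add0r !mxE -ls /lev /endpt !mxE; ring.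
have e1 : `[< (F `&` sh n i @^-1` A) (levs (s ++ s')) >] = `[< A (levs s') >].
  apply: asbool_equiv_eq; split=> [[_ h]|h].
    by apply: dA h => k km; exact: lev2.
  split; first by apply: dF Fs => k kn; rewrite lev1.
  by apply: dA h => k km; rewrite lev2.
rewrite e1; case: asboolP => // As'.
apply: (path_prob_cat (i := i%:Z)) => [k|k ks].
  by rewrite sn => kn; have := hlt k kn.
have := As _ As' k (ltac:(by rewrite -sn' ltnW)).
have := lev2 k (ltac:(by rewrite -sn' ltnW)).
rewrite /sh /levs take_cat sn ltnNge leq_addr /= addKn endpt_cat => <-.
by rewrite subr_ge0.
Qed.

End WalkLaw.

Lemma limn_einf_gt0 (R : realType) (u : nat -> R) (a K : nat) : (0 < a)%N ->
  (forall m, (K <= m)%N -> m%:R <= a%:R * (u m + 1) + K%:R) ->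
  (0 < limn_einf (fun n => (u n / n%:R)%:E))%E.
Proof.
move=> a0 h; have ap : 0 < a%:R :> R by rewrite ltr0n.
(* For [m > 2 (K + a)] the hypothesis gives a u(m) >= m - K - a >= m/2, hence the explicit bound
   1/(2a). *)
apply: (@lt_le_trans _ _ ((2 * a%:R)^-1)%:E).
  by rewrite lte_fin invr_gt0 mulr_gt0.
rewrite limn_einf_lim; apply: lime_ge; first exact: is_cvg_einfs.
exists (2 * (K + a)).+1 => // n /= nK; apply: le_ereal_inf_tmp => _ [m /= nm <-].
have mK : (2 * (K + a) < m)%N by exact: leq_trans nm.
have m0 : 0 < m%:R :> R by rewrite ltr0n; exact: leq_ltn_trans mK.
have Km : (K <= m)%N by apply: ltnW; apply: leq_ltn_trans mK; rewrite mul2n -addnn -addnA leq_addr.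
have h1 := h m Km.
have h2 : 2 * (K%:R + a%:R) <= m%:R :> R by rewrite -natrD -natrM ler_nat ltnW.
rewrite lee_fin ler_pdivlMr // mulrC ler_pdivrMr ?mulr_gt0 //.
lra.
Qed.

Theorem theorem1p2 (R : realType) (d : nat) (hd : (2 <= d)%N)
  (dT : measure_display) (T : measurableType dT) (P : probability T R)
  (om : T -> env R d) (X : nat -> T -> Zd d) :
  prob_vectors om ->
  iid_env P om ->
  0 < eps_env P om < 1 ->
  annealed_walk P om X ->
  lambda_env P om > 4 * d%:R * sigma_env P om ^+ 2 * (1 + 9 * eps_env P om) ->
  kalikow_condition P om (e1vec R d) /\
  {ae P, forall t,
     (0 < limn_einf (fun n => (dotR (X n t) (e1vec R d) / n%:R)%:E))%E}.
Proof.
move=> hpv hiid heps hX hlam.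
have hd0 : (0 < d)%N by exact: ltnW.
set c := kalikow_const P om.
have c0 : 0 < c.
  (* The assumption on lambda has 1 + 9 eps, which is at least the 1 + eps of [kalikow_const]. *)
  rewrite /c /kalikow_const lt_min invr_gt0 ltr0n /= subr_gt0.
  apply: le_lt_trans hlam; have /andP[e0 _] := heps.
  apply: ler_wpM2l; last by lra.
  by rewrite mulr_ge0 ?sqr_ge0 // mulr_ge0.
split; first exact: (kalikow_condition_e1 hd0).
have mL := measurable_level_path hd0 hX.
pose L : {mfun T >-> path_space} := HB.pack (level_path X hd0)
  (isMeasurableFun.Build _ _ _ _ _ mL).
pose Q : probability path_space R := distribution P L.
have QE A : Q A = P (level_path X hd0 @^-1` A) by [].
have ren i n m (F A : set path_space) : determined n F -> F `<=` hit i n ->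
    determined m A -> A `<=` stay_upto m -> Q (F `&` sh n i @^-1` A) = (Q F * Q A)%E.
  by move=> dF Fh dA As; rewrite !QE; exact: (level_path_renewal hd0 hpv hiid hX dF Fh dA As).
have near1 n : Q (nearest n) = 1%E.
  have dn : determined n (nearest n).
    move=> y y' h [y0 hy]; split=> [|k kn]; first by rewrite -h.
    by rewrite -!h // ?hy // ltnW.
  (* Every direction sequence from the origin gives a nearest-neighbour level path, so this event is
     survival in the whole lattice, which has probability 1. *)
  rewrite QE (level_path_surv hpv hiid hX (B := setT) dn).
    rewrite -[RHS](congr1 EFin (Rintegral_cstT P 1)); congr EFin; apply: eq_Rintegral => t _.
    elim: n {dn} (0 : Zd d) => [|n IH] x /=; rewrite in_setT //.
    by rewrite mul1r; under eq_bigr do rewrite IH mulr1; rewrite hpv.2.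
  move=> s sn; split=> // _; split; first by rewrite /levs take0 endpt_nil lev0.
  move=> k kn; rewrite /levs (endpt_take_S _ (dir_up hd0)) ?sn //; set e := nth _ _ _.
  have [->|e1] := eqVneq e (dir_up hd0); first by rewrite lev_up.
  have [->|e2] := eqVneq e (dir_dn hd0); first by rewrite lev_dn lerD2l.
  by rewrite lev_other // lerDl.
have time l k : (0 < l)%N -> (\sum_(n < k) Q (below l n) <= (l%:R / c)%:E)%E.
  move=> l0; apply: (le_trans _ (_ : (_%:E <= _)%E)); last first.
    by rewrite lee_fin; exact: (annealed_time_sum hd0 hpv hiid heps c0 k l0).
  rewrite -sumEFin; apply: lee_sum => n _; rewrite QE.
  rewrite (level_path_surv hpv hiid hX (B := [set x | lev hd0 x < l%:Z]) (@determined_below l n)) //.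
have stayQ n : (c%:E <= Q (stay_upto n))%E.
  rewrite QE (level_path_surv hpv hiid hX (B := [set x | 0 <= lev hd0 x])
    (@determined_stay_upto n)) //.
  by rewrite lee_fin; exact: annealed_surv_ge.
have [N [mN N0 NS]] := ballistic_ae c0 ren near1 time stayQ.
(* The exceptional null set of the path law is pulled back to the space carrying the walk. *)
exists (level_path X hd0 @^-1` N); split.
- by rewrite -[X in measurable X]setTI; exact: (mL measurableT N mN).
- exact: N0.
move=> t nt; apply: NS => -[a [K [a0 h]]]; apply: nt.
apply: (@limn_einf_gt0 _ _ a K) => // m Km; rewrite (dotR_lev R hd0).
have := h m Km; rewrite -(ler_int R) !intrD intrM.
by rewrite intrD.
Qed.
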